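(* Let $0<\alpha<n$ and $b$ be locally integrable on $\mathbb{Q}_p^n$. The following are equivalent: (T.1) $b\in\mathrm{BMO}(\mathbb{Q}_p^n)$. (T.2) $\mathcal{M}^p_{\alpha,b}$ is bounded from $L^{r(\cdot)}(\mathbb{Q}_p^n)$ to $L^{q(\cdot)}(\mathbb{Q}_p^n)$ for all $r(\cdot),q(\cdot)\in\mathscr{C}^{\log}(\mathbb{Q}_p^n)$ with $r(\cdot)\in\mathscr{P}(\mathbb{Q}_p^n)$, $r_+<n/\alpha$, $1/q(\cdot)=1/r(\cdot)-\alpha/n$. (T.3) The same boundedness holds for some such $r(\cdot),q(\cdot)$. (T.4) For some such $r(\cdot),q(\cdot)$, $$\sup_{\gamma\in\mathbb{Z},x\in\mathbb{Q}_p^n}\frac{\big\|(b-b_{B_\gamma(x)})\chi_{B_\gamma(x)}\big\|_{L^{q(\cdot)}}}{\|\chi_{B_\gamma(x)}\|_{L^{q(\cdot)}}}<\infty.\quad(\ddagger)$$ (T.5) $(\ddagger)$ holds for all such $r(\cdot),q(\cdot)$.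
   Context: Fix a prime $p$; $\mathbb{Q}_p^n$ with $|x|_p=\max_j|x_j|_p$; balls $B_\gamma(x)=\{y:|y-x|_p\le p^\gamma\}$; Haar measure with $|B_\gamma(x)|_h=p^{n\gamma}$; $\chi_E$ indicator; $f_B=|B|_h^{-1}\int_Bf$. For $0\le\alpha<n$ the maximal commutator is $\mathcal{M}^p_{\alpha,b}(f)(x)=\sup_{\gamma\in\mathbb{Z}}|B_\gamma(x)|_h^{\alpha/n-1}\int_{B_\gamma(x)}|b(x)-b(y)||f(y)|dy$. $\mathrm{BMO}(\mathbb{Q}_p^n)$: locally integrable $b$ with $\sup_{\gamma,x}|B_\gamma(x)|_h^{-1}\int_{B_\gamma(x)}|b-b_{B_\gamma(x)}|<\infty$. Variable exponents: $q_-=\operatorname{ess\,inf}q$, $q_+=\operatorname{ess\,sup}q$, $q_\pm(B)$ ess inf/sup over $B$. $\mathscr{P}$: measurable $q$ with $1<q_-\le q_+<\infty$. $L^{q(\cdot)}$ with Luxemburg norm $\|f\|_{L^{q(\cdot)}}=\inf\{\eta>0:\int(|f(x)|/\eta)^{q(x)}dx\le1\}$. $\mathscr{C}^{\log}_0$: $\gamma(q_-(B_\gamma(x))-q_+(B_\gamma(x)))\le C$ for all $\gamma,x$; $\mathscr{C}^{\log}_\infty$: $|q(x)-q(y)|\le C/\log_p(p+\min\{|x|_p,|y|_p\})$; $\mathscr{C}^{\log}=\mathscr{C}^{\log}_0\cap\mathscr{C}^{\log}_\infty$. *)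

(* Defs.v *)
From HB Require Import structures.
From mathcomp Require Import all_boot all_order all_algebra.
From mathcomp Require Import all_classical all_reals all_analysis.
From mathcomp Require Import measurable_realfun.

Set Implicit Arguments.
Unset Strict Implicit.
Unset Printing Implicit Defensive.

Import Order.TTheory GRing.Theory Num.Theory.
Import numFieldNormedType.Exports.

Local Open Scope classical_set_scope.
Local Open Scope ring_scope.

(* The p-adic field Q_p, via canonical digit expansions                *)
(*   x = sum_{k in Z} x_k p^k,  x_k in {0,..,p-1}, x_k = 0 for k << 0. *)
(* Only the metric/measure structure of Q_p^n enters the statement.    *)

Definition is_padic_digits (p : nat) (x : int -> nat) : Prop :=
  (forall k : int, (x k <= p.-1)%N) /\ exists N : int, forall k : int, k < N -> x k = 0%N.

Record Qp (p : nat) : Type := MkQp {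
  qdigit : int -> nat ;
  qdigit_ok : is_padic_digits p qdigit }.

Lemma Qp0_proof (p : nat) : is_padic_digits p (fun _ => 0%N).
Proof. by split=> // ; exists 0. Qed.

Definition Qp0 (p : nat) : Qp p := @MkQp p (fun _ => 0%N) (Qp0_proof p).

HB.instance Definition _ (p : nat) := gen_eqMixin (Qp p).
HB.instance Definition _ (p : nat) := gen_choiceMixin (Qp p).
HB.instance Definition _ (p : nat) := isPointed.Build (Qp p) (Qp0 p).

Definition Qpvec (p n : nat) : Type := 'I_n -> Qp p.
HB.instance Definition _ (p n : nat) := gen_eqMixin (Qpvec p n).
HB.instance Definition _ (p n : nat) := gen_choiceMixin (Qpvec p n).
HB.instance Definition _ (p n : nat) :=
  isPointed.Build (Qpvec p n) (fun _ => Qp0 p).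

(* |x - y|_p <= p^g in Q_p  iff the digit expansions of x and y agree
   at every index k < -g *)
Definition qp_close (p : nat) (g : int) (x y : Qp p) : Prop :=
  forall k : int, k < - g -> qdigit x k = qdigit y k.

(* B_g(x) = { y : |y - x|_p <= p^g }, with |.|_p the max-norm on Q_p^n *)
Definition qp_ball (p n : nat) (x : Qpvec p n) (g : int) : set (Qpvec p n) :=
  [set y | forall j : 'I_n, qp_close g (x j) (y j)].

Definition qp_balls (p n : nat) : set (set (Qpvec p n)) :=
  [set B | exists x g, B = qp_ball x g].

(* Q_p^n with its Borel sigma-algebra (generated by the qp_balls) *)
Definition QpM (p n : nat) := g_sigma_algebraType (@qp_balls p n).

(* |x|_p = max_j |x_j|_p = inf { p^g : x in B_g(0) } *)
Definition qp_pnorm (R : realType) (p n : nat) (x : Qpvec p n) : R :=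
  inf [set (p%:R ^ g : R) | g in [set g : int | forall (j : 'I_n) (k : int),
                                     k < - g -> qdigit (x j) k = 0%N]].

Section Defs.
Context (R : realType) (p n : nat).
Local Notation T := (QpM p n).
Variable mu : {measure set T -> \bar R}.

Definition qp_padic_haar : Prop :=
  forall (x : T) (g : int), mu (qp_ball x g) = ((p%:R : R) ^ (n%:Z * g))%:E.

Definition qp_locally_integrable (b : T -> R) : Prop :=
  forall (x : T) (g : int), mu.-integrable (qp_ball x g) (EFin \o b).

Definition qp_avg (b : T -> R) (B : set T) : R :=
  fine (\int[mu]_(y in B) (b y)%:E) / fine (mu B).

Definition qp_BMO (b : T -> R) : Prop :=
  exists C : R, forall (x : T) (g : int),
    ((((p%:R : R) ^ (n%:Z * g))^-1)%:E *
      \int[mu]_(y in qp_ball x g) (`|b y - qp_avg b (qp_ball x g)|)%:E <= C%:E)%E.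

Definition qp_maxcomm (alpha : R) (b : T -> R) (f : T -> R) (x : T) : \bar R :=
  ereal_sup [set ((((p%:R : R) ^ (n%:Z * g)) `^ (alpha / n%:R - 1))%:E *
                  \int[mu]_(y in qp_ball x g) (`|b x - b y| * `|f y|)%:E)%E
            | g in [set: int]].

Definition qp_essinf_on (A : set T) (q : T -> R) : \bar R :=
  ereal_sup [set y : \bar R | \forall x \ae mu, A x -> (y <= (q x)%:E)%E].
Definition qp_esssup_on (A : set T) (q : T -> R) : \bar R :=
  ereal_inf [set y : \bar R | \forall x \ae mu, A x -> ((q x)%:E <= y)%E].

Definition qp_var_exp (q : T -> R) : Prop :=
  measurable_fun setT q /\ (1%:E < qp_essinf_on setT q)%E /\ (qp_esssup_on setT q < +oo)%E.

Definition qp_Clog0 (q : T -> R) : Prop :=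
  exists C : R, forall (x : T) (g : int),
    ((g%:~R)%:E * (qp_essinf_on (qp_ball x g) q - qp_esssup_on (qp_ball x g) q) <= C%:E)%E.

Definition qp_Clog_inf (q : T -> R) : Prop :=
  exists C : R, forall x y : T,
    `|q x - q y| <= C / (ln (p%:R + Order.min (qp_pnorm R x) (qp_pnorm R y)) / ln p%:R).

Definition qp_Clog (q : T -> R) : Prop := qp_Clog0 q /\ qp_Clog_inf q.

Definition qp_lux (q : T -> R) (g : T -> \bar R) : \bar R :=
  ereal_inf [set eta%:E | eta in [set eta : R | 0 < eta /\
     (\int[mu]_x poweR (`|g x| * (eta^-1)%:E)%E (q x) <= 1)%E]].

Definition qp_bounded_op (r q : T -> R) (Op : (T -> R) -> T -> \bar R) : Prop :=
  exists C : R, forall f : T -> R,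
    measurable_fun setT f -> (qp_lux r (EFin \o f) < +oo)%E ->
    measurable_fun [set: T] (Op f : T -> \bar R) /\ (qp_lux q (Op f) <= C%:E * qp_lux r (EFin \o f))%E.

Definition qp_admissible (alpha : R) (r q : T -> R) : Prop :=
  [/\ qp_Clog r, qp_Clog q, qp_var_exp r,
      (qp_esssup_on setT r < (n%:R / alpha)%:E)%E &
      forall x : T, (q x)^-1 = (r x)^-1 - alpha / n%:R].

Definition qp_ddagger (q : T -> R) (b : T -> R) : Prop :=
  exists C : R, forall (x : T) (g : int),
    (qp_lux q (fun y => ((b y - qp_avg b (qp_ball x g)) * \1_(qp_ball x g) y)%:E)
      <= C%:E * qp_lux q (fun y => (\1_(qp_ball x g) y)%:E))%E.

End Defs.

(* Main.v *)
(** Balls of a fixed radius partition Q_p^n, so averages over balls behave like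
conditional expectations, and maximal functions are handled by stopping times
(the largest ball on which an average exceeds a level).

(T.1) => (T.2).  By Young's inequality the commutator average over the ball of
radius p^g at x is at most (|b x - b_g x| + C) times the fractional average
[G_g = |B|^(alpha/n) (E |f|^s)^(1/s)] for a fixed 1 < s < r_-.  On the balls
selected by stopping [G] at a level, the oscillation of b has all its moments
bounded (John-Nirenberg), so the weight |b x - b_g x| + C can be integrated
out, leaving the fractional maximal function, which a Hedberg inequality bounds
by a Hardy-Littlewood maximal function.  Where |f| <= 1 the log-Hoelder
condition at infinity reduces the exponents to constants; where |f| > 1 only
small balls have [G_g > 1], and there the local log-Hoelder condition lets the
exponent be frozen.

(T.3) => (T.4).  Test the operator on the indicator of a ball; Young's
inequality alone gives ||1_B||_r <= 2 |B|^(alpha/n) ||1_B||_q.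

(T.4) => (T.1).  The modular of (b - b_B) 1_B at the scale of ||1_B||_q controls
the L^1 average, again by the log-Hoelder conditions.  Hence (T.4) for one pair
gives (T.1), and so (T.5). *)

Require Import Defs.
From HB Require Import structures.
From mathcomp Require Import all_boot all_order all_algebra.
From mathcomp Require Import all_classical all_reals all_analysis.
From mathcomp Require Import measurable_realfun.
From mathcomp Require Import zify ring lra.

Set Implicit Arguments.
Unset Strict Implicit.
Unset Printing Implicit Defensive.

Import Order.TTheory GRing.Theory Num.Theory.
Local Open Scope classical_set_scope.
Local Open Scope ring_scope.

(** The weight |b x - b_g x| is unbounded and changes with the radius, so the supremum over g cannot
    be separated from it. At a fixed level, stopping at the largest selected ball helps: every other
    selected ball around x is smaller, and [osc], which contains a supremum over all smaller balls,
    bounds all their weights at once. The remaining factor, a power of the level, can then be taken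
    out of the average over the stopped ball. For a variable exponent this factor c ^ q(x) is
    constant only up to a bounded multiple, and bounding that multiple is the task of the
    log-Hoelder conditions. A largest ball exists only when the radii are capped by p ^ N; the cap
    is removed by a monotone limit, except for large values of f, where only small balls matter. In
    the choice of s, s > 1 leaves a dual exponent for the oscillation of b, and s < r_- makes the
    maximal theorem available with an exponent larger than 1. *)

Local Notation mfun := (measurable_fun setT).

(** * Balls and their countable partitions *)

Section Balls.
Context (p n : nat).
Local Notation T := (QpM p n).
Implicit Types (x y z : T) (g h : int).

Lemma qp_ball_sym x y g : qp_ball x g y -> qp_ball y g x.
Proof. by move=> xy j k kg; rewrite xy. Qed.

Lemma qp_ball_trans x y z g : qp_ball x g y -> qp_ball y g z -> qp_ball x g z.
Proof. by move=> xy yz j k kg; rewrite xy// yz. Qed.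

Lemma qp_ball_eq x y g : qp_ball x g y -> qp_ball x g = qp_ball y g.
Proof.
move=> xy; apply/seteqP; split=> z; first exact/qp_ball_trans/qp_ball_sym.
exact: qp_ball_trans.
Qed.

Lemma qp_ball_le x g h : g <= h -> qp_ball x g `<=` qp_ball x h.
Proof. by move=> gh y xy j k kh; apply: xy; apply: (lt_le_trans kh); rewrite lerN2. Qed.

Lemma measurable_qp_ball x g : measurable (qp_ball x g : set T).
Proof. by apply: sub_sigma_algebra; exists x, g. Qed.

Lemma qp_ball_exit x y : exists i : nat, qp_ball x i%:Z y.
Proof.
have H (j : 'I_n) : {M : nat | forall k : int, k < - (M%:Z) -> qdigit (x j) k = qdigit (y j) k}.
  apply: cid; have [_ [N HN]] := qdigit_ok (x j); have [_ [N' HN']] := qdigit_ok (y j).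
  by exists (`|N| + `|N'|)%N => k kN; rewrite HN ?HN'//; lia.
exists (\max_(j < n) sval (H j))%N => // j k kM; apply: (svalP (H j)).
apply: (lt_le_trans kM).
have := @leq_bigmax _ (fun j => sval (H j)) j.
rewrite -lez_nat => h; rewrite lerN2; exact: h.
Qed.

Lemma qp_ball_cover x : \bigcup_(i : nat) qp_ball x i%:Z = setT.
Proof. by apply/seteqP; split=> // y _; have [i xy] := qp_ball_exit x y; exists i. Qed.

(* [c] codes the digits of [x] below [- g]: the digits start at [- c.1] and
   [c.2] lists them, which makes the set of balls of radius [p ^ g] countable. *)
Definition qp_code_ok (g : int) (x : T) (c : nat * seq (seq nat)) : Prop :=
  forall (j : 'I_n) (k : int), k < - g ->
    qdigit (x j) k = if - (c.1%:Z) <= k then nth 0%N (nth [::] c.2 j) `|(k + c.1%:Z)%R|%N else 0%N.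

Lemma qp_code_ex g x : exists m, exists c, pickle c = m /\ qp_code_ok g x c.
Proof.
have [M HM0] := qp_ball_exit (fun _ => Qp0 p : Qp p) x.
have HM j k : k < - (M%:Z) -> qdigit (x j) k = 0%N by move=> /HM0.
pose c := (M, [seq [seq qdigit (x j) (i%:Z - M%:Z) | i <- iota 0 `|(M%:Z - g)%R|%N] | j <- enum 'I_n]).
exists (pickle c), c; split=> // j k kg /=.
have [kM|kM] := leP (- (M%:Z)) k; last by rewrite HM.
rewrite (nth_map j) ?size_enum_ord//.
rewrite (nth_map 0%N) ?size_iota; last by lia.
rewrite nth_iota; last by lia.
rewrite nth_ord_enum; congr (qdigit (x j) _); lia.
Qed.

(** A code determines the digits below [- g], so the least code of a point labels its ball. Labels
    in [nat] turn integrals into series over balls and make every union of balls of one radius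
    measurable. *)
Lemma qp_ball_class g : exists cl : T -> nat, forall x y, cl x = cl y <-> qp_ball x g y.
Proof.
pose P x := fun m => `[< exists c, pickle c = m /\ qp_code_ok g x c >].
have exP x : exists m, P x m.
  by have [m Hm] := qp_code_ex g x; exists m; apply/asboolP.
exists (fun x => ex_minn (exP x)) => x y; split.
  case: ex_minnP => m /asboolP[c [cm cx]] _; case: ex_minnP => m' /asboolP[c' [cm' cy]] _ mm'.
  have cc : c = c' by apply: (pcan_inj pickleK); rewrite cm cm' mm'.
  by subst c' => j k kg; rewrite cx// cy.
move=> xy; have PE : P x = P y.
  apply/funext => m; apply/asboolP/asboolP => -[c [cm cx]]; exists c; split=> // j k kg.
    by rewrite -xy// cx.
  by rewrite xy// cx.
case: ex_minnP => m Pm minm; case: ex_minnP => m' Pm' minm'.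
by apply/eqP; rewrite eqn_leq minm ?PE// minm' -?PE.
Qed.

(** Measurability with respect to the partition into balls of radius [p ^ g]: in martingale terms,
    being adapted at scale [g]. *)
Definition ball_inv (A : Type) (g : int) (w : T -> A) := forall x y, qp_ball x g y -> w x = w y.

Lemma ball_inv_set g (X : set T) : (forall x y, qp_ball x g y -> X x -> X y) -> measurable X.
Proof.
have [cl clP] := qp_ball_class g => iX.
have -> : X = \bigcup_(i in cl @` X) (cl @^-1` [set i]).
  apply/seteqP; split=> x; first by move=> Xx; exists (cl x) => //; exists x.
  by move=> [_ [y Xy <-]] /= /esym/clP/iX; exact.
apply: bigcup_measurable => i [y Xy <-].
have -> : cl @^-1` [set cl y] = qp_ball y g.
  by apply/seteqP; split=> x /=; [move/esym/clP|move/clP].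
exact: measurable_qp_ball.
Qed.

Lemma ball_inv_measurable d (A : measurableType d) g (w : T -> A) :
  ball_inv g w -> mfun w.
Proof.
by move=> iw _ Y mY; rewrite setTI; apply: (@ball_inv_set g) => x y xy /=; rewrite (iw _ _ xy).
Qed.

End Balls.

(** * Integrals and measurability of nonnegative functions *)

Section IntegralFacts.
Context d (T : measurableType d) (R : realType) (mu : {measure set T -> \bar R}).
Local Open Scope ereal_scope.

(** The integral of a nonnegative function is a supremum over the simple functions below it, and a
    larger function has more of them. *)
Lemma ge0_integral_le (D : set T) (f g : T -> \bar R) :
  (forall x, D x -> 0 <= f x) -> (forall x, D x -> f x <= g x) ->
  \int[mu]_(x in D) f x <= \int[mu]_(x in D) g x.
Proof.
move=> f0 fg; rewrite !(integral_mkcond D).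
have f0' x : 0 <= (f \_ D) x by apply: erestrict_ge0.
have g0' x : 0 <= (g \_ D) x by apply: erestrict_ge0 => y Dy; exact: le_trans (f0 _ Dy) (fg _ Dy).
rewrite !ge0_integralTE//; apply: ereal_sup_le => _ [h /= hf <-].
exists h => // x.
apply: le_trans (hf x) _; rewrite /patch; case: ifPn => // xD.
by apply: fg; rewrite inE in xD.
Qed.

Lemma ae_forall_count (I : countType) (P : I -> T -> Prop) :
  (forall g, {ae mu, forall x, P g x}) -> {ae mu, forall x, forall g, P g x}.
Proof.
move=> H; have : {ae mu, forall x, forall m : nat, forall g, unpickle m = Some g -> P g x}.
  apply: ae_foralln => m; case mg : (unpickle m) => [g|]; last by apply: aeW => x h.
  by apply: filterS (H g) => x Pgx h [<-].
by apply: filterS => x K g; apply: (K (pickle g)); rewrite pickleK.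
Qed.

Lemma integral_indic_mul (D : set T) (f : T -> \bar R) :
  \int[mu]_x ((\1_D x)%:E * f x) = \int[mu]_(x in D) f x.
Proof.
rewrite [RHS]integral_mkcond; apply: eq_integral => x _.
rewrite patchE indicE; case: (x \in D); first by rewrite mul1e.
by rewrite mul0e.
Qed.

Lemma measurable_powR2 (f q : T -> R) :
  mfun f -> mfun q -> mfun (fun x => f x `^ q x)%R.
Proof.
move=> mf mq; apply: measurable_fun_ifT.
- exact: measurable_fun_eqr.
- apply: measurableT_comp => //; apply: measurable_fun_ifT => //.
  exact: measurable_fun_eqr.
- apply: measurableT_comp => //; apply: measurable_funM => //.
  by apply: measurableT_comp => //; exact: measurable_ln.
Qed.

Lemma measurable_poweR2 (f : T -> \bar R) (q : T -> R) :
  mfun f -> mfun q -> mfun (fun x => poweR (f x) (q x)).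
Proof.
move=> mf mq; under eq_fun do rewrite poweRE.
have mb (y : \bar R) : mfun (fun x => f x == y).
  apply: (measurable_fun_bool true).
  rewrite (_ : _ @^-1` _ = f @^-1` [set y]); first exact: mf.
  by apply/seteqP; split=> x /=; [move/eqP|move=> ->; rewrite eqxx].
apply: measurable_fun_ifT.
- exact: measurable_fun_eqr.
- apply: measurableT_comp => //; apply: measurable_fun_ifT => //.
  + apply: (measurable_fun_bool true); exact: emeasurable_fin_num.
  + apply: measurable_powR2 => //; exact: measurableT_comp.
- apply: measurable_fun_ifT => //; apply: measurable_fun_ifT => //.
  by apply: measurableT_comp => //; apply: measurable_powR2 => //; exact: measurableT_comp.
Qed.

(** Monotone convergence along an exhaustion [h]; it removes truncations, lowest levels and radius
    caps from the later estimates. *)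
Lemma ge0_integral_sup_le (f : T -> \bar R) (h : nat -> T -> \bar R) (c : \bar R) :
  (forall m, mfun (h m)) -> (forall m x, 0 <= h m x) ->
  (forall x, {homo h^~ x : i j / (i <= j)%N >-> i <= j}) ->
  (forall m, \int[mu]_x h m x <= c) -> (forall x, 0 <= f x) ->
  (forall x, f x <= ereal_sup (range (h^~ x))) -> \int[mu]_x f x <= c.
Proof.
move=> mh h0 hnd hc f0 fh.
have hcvg x : h m x @[m --> \oo] --> ereal_sup (range (h^~ x)) by exact: ereal_nondecreasing_cvgn.
apply: (@le_trans _ _ (\int[mu]_x (limn (h^~ x)))).
  apply: ge0_integral_le => // x _; apply: le_trans (fh x) _.
  by rewrite (cvg_lim _ (hcvg x)).
rewrite monotone_convergence//.
apply: lime_le; last exact: nearW.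
apply: ereal_nondecreasing_is_cvgn => i j ij; apply: ge0_integral_le => // x _; exact: hnd.
Qed.

Lemma integral_eseries_le (f : nat -> T -> \bar R) (h : nat -> T -> \bar R) (D : set T) : measurable D ->
  (forall m, measurable_fun D (f m)) -> (forall m, measurable_fun D (h m)) ->
  (forall m x, D x -> 0 <= f m x) -> (forall m x, D x -> 0 <= h m x) ->
  (forall m, \int[mu]_(x in D) f m x <= \int[mu]_(x in D) h m x) ->
  \int[mu]_(x in D) (\sum_(m <oo) f m x) <= \int[mu]_(x in D) (\sum_(m <oo) h m x).
Proof.
move=> mD mf mh f0 h0 fh; rewrite !integral_nneseries//.
apply: lee_nneseries => m _; last exact: fh.
by move=> _; apply: integral_ge0 => x; exact: f0.
Qed.

Lemma measurable_ereal_sup (I : countType) (h : I -> T -> \bar R) :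
  (forall i, mfun (h i)) ->
  mfun (fun x => ereal_sup (range (h^~ x))).
Proof.
move=> mh; apply: (measurability _ (ErealGenOInfty.measurableE R)) => _ [_ [c ->] <-].
rewrite setTI preimage_itvoy.
rewrite (_ : [set x | _] = \bigcup_(i in [set: I]) [set x | c%:E < h i x]); last first.
  apply/seteqP; split=> x /=.
    by move/ereal_sup_gt => [_ [i _ <-] ci]; exists i.
  by move=> [i _ /= ci]; apply: lt_le_trans ci _; apply: ereal_sup_ubound; exists i.
apply: countable_bigcupT_measurable => [|i]; first exact: countableP.
by rewrite -[X in measurable X]setTI; exact: emeasurable_fun_o_infty.
Qed.

End IntegralFacts.

Lemma intdistK (g N : int) : g <= N -> N - `|(N - g)%R|%N%:Z = g.
Proof. lia. Qed.

Lemma subz_le (N : int) (i : nat) : N - i%:Z <= N.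
Proof. lia. Qed.

Lemma subz_le2 (N : int) (i j : nat) : (i <= j)%N -> N - j%:Z <= N - i%:Z.
Proof. lia. Qed.

Lemma subzS (N : int) (i : nat) : N - i.+1%:Z + 1 = N - i%:Z.
Proof. lia. Qed.

(** * Dyadic sums, powers and Young inequalities *)

Section RealFacts.
Context (R : realType).
Implicit Types (a b c e t : R).

Lemma powR2_gt1 t : 0 < t -> 1 < 2 `^ t :> R.
Proof.
move=> t0; have := @gt0_ltr_powR R t t0 1 2; rewrite powR1; apply.
- by rewrite nnegrE.
- by rewrite nnegrE ler0n.
- by rewrite ltr1n.
Qed.

(** With [r = 2 ^ t], a geometric sum is at most [r / (r - 1)] times its last term, and the last
    selected term is below [a ^ t]. *)
Lemma dyadic_sum_le e a t (m : nat) : 0 < e -> 0 <= a -> 0 < t ->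
  \sum_(j < m) (if e * 2 ^+ j < a then (e * 2 ^+ j) `^ t else 0) <=
  (2 `^ t / (2 `^ t - 1)) * a `^ t.
Proof.
move=> e0 a0 t0; set r := 2 `^ t; pose E := e `^ t.
have r1 : 1 < r by exact: powR2_gt1.
have E0 : 0 < E by exact: powR_gt0.
have levelE j : (e * 2 ^+ j) `^ t = E * r ^+ j.
  by rewrite powRM ?exprn_ge0 ?ltW// -powR_mulrn// powRAC powR_mulrn// powR_ge0.
have S1 k : \sum_(j < k) (if e * 2 ^+ j < a then (e * 2 ^+ j) `^ t else 0) <= E * r ^+ k / (r - 1).
  have rn : 0 < r - 1 by rewrite subr_gt0.
  elim: k => [|k IH]; first by rewrite big_ord0 divr_ge0// ?mulr_ge0 ?exprn_ge0 ?ltW// (lt_trans ltr01).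
  rewrite big_ord_recr /=; apply: le_trans (lerD IH (_ : _ <= E * r ^+ k)) _.
    by case: ifP => _; [rewrite levelE|rewrite mulr_ge0 ?exprn_ge0 ?ltW// (lt_trans ltr01)].
  rewrite ler_pdivlMr// mulrDl divfK ?gt_eqF// exprS le_eqVlt; apply/orP; left; apply/eqP.
  by ring.
(* Either level [k] is selected and dominates all earlier ones through [S1], or it contributes 0. *)
elim: m => [|k IH].
  by rewrite big_ord0 mulr_ge0 ?powR_ge0// divr_ge0 ?powR_ge0// subr_ge0 ltW.
have := S1 k.+1; rewrite big_ord_recr /=; case: ifP => [ka|_ _]; last by rewrite addr0.
move=> H; apply: le_trans H _.
rewrite [leLHS](_ : _ = r / (r - 1) * (E * r ^+ k)); last by rewrite exprS; ring.
rewrite ler_pM2l; last by rewrite divr_gt0 ?subr_gt0// (lt_trans ltr01).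
rewrite -levelE; apply: ge0_ler_powR => //; rewrite ?ltW// nnegrE ?mulr_ge0 ?exprn_ge0 ?ltW//.
Qed.

Lemma dyadic_level e a : 0 < e -> e < a -> exists j, e * 2 ^+ j < a /\ a <= e * 2 ^+ j.+1.
Proof.
move=> e0 ea; pose P j := ~~ (e * 2 ^+ j < a).
have exP : exists j, P j.
  have [k Hk] : exists k : nat, a / e < k%:R by exists (Num.truncn (a / e)).+1; rewrite truncnS_gt.
  exists k; rewrite /P -leNgt mulrC -ler_pdivrMr// (le_trans (ltW Hk))// -natrX ler_nat.
  by rewrite ltnW// ltn_expl.
case: (ex_minnP exP) => -[|j]; rewrite /P -?leNgt => H1 H2.
  by move: H1; rewrite expr0 mulr1 leNgt ea.
exists j; split=> //; rewrite ltNge; apply/negP => K.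
by have := H2 j; rewrite -leNgt K => /(_ isT); rewrite ltnn.
Qed.

(** Young's inequality, whose weights [s^-1] and [s'^-1] are at most 1 and are dropped. *)
Lemma young_le (x y s s' : R) : 0 <= x -> 0 <= y -> 1 < s -> s^-1 + s'^-1 = 1 -> x * y <= x `^ s' + y `^ s.
Proof.
move=> x0 y0 s1 ss.
have s0 : 0 < s by rewrite (lt_trans _ s1).
have si1 : s^-1 < 1 by rewrite invf_lt1.
have s'0 : 0 < s' by rewrite -invr_gt0; move: ss si1; lra.
have s'i : 0 < s'^-1 by rewrite invr_gt0.
have si : 0 < s^-1 by rewrite invr_gt0.
have := @conjugate_powR R x y s' s x0 y0 s'0 s0; rewrite addrC => /(_ ss)/le_trans; apply.
apply: lerD; rewrite ler_piMr ?powR_ge0//; last by rewrite ltW.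
by move: ss si; lra.
Qed.

Lemma nneseries_le (f : nat -> \bar R) (c : \bar R) : (forall j, 0 <= f j)%E ->
  (forall m, \sum_(j < m) f j <= c)%E -> (\sum_(j <oo) f j <= c)%E.
Proof.
move=> f0 fc; apply: lime_le; first exact: is_cvg_nneseries.
by apply: nearW => m; rewrite big_mkord.
Qed.

Lemma nneseries_ge (f : nat -> \bar R) j : (forall j, 0 <= f j)%E -> (f j <= \sum_(j <oo) f j)%E.
Proof.
move=> f0; apply: le_trans (nneseries_lim_ge j.+1 _) => //.
by rewrite big_mkord big_ord_recr /= leeDr// sume_ge0.
Qed.

Lemma dyadic_series_le e a t : 0 < e -> 0 <= a -> 0 < t ->
  (\sum_(j <oo) (if e * 2 ^+ j < a then (e * 2 ^+ j) `^ t else 0)%:E <=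
  ((2 `^ t / (2 `^ t - 1)) * a `^ t)%:E)%E.
Proof.
move=> e0 a0 t0; apply: nneseries_le => [j|m].
  by rewrite lee_fin; case: ifP => _; rewrite ?powR_ge0.
by rewrite sumEFin lee_fin; exact: dyadic_sum_le.
Qed.

(** A dyadic layer cake: the single level with [e * 2 ^ j < u <= e * 2 ^ (j + 1)] already gives the
    bound. For [u = +oo] every large real [a] takes the place of [u]. *)
Lemma dyadic_series_ge e (u : \bar R) t : 0 < e -> (e%:E < u)%E -> 0 < t ->
  (poweR u t <= \sum_(j <oo) (if ((e * 2 ^+ j)%:E < u)%E then (2 * (e * 2 ^+ j)) `^ t else 0)%:E)%E.
Proof.
move=> e0 eu t0.
have f0 j : (0 <= (if ((e * 2 ^+ j)%:E < u)%E then (2 * (e * 2 ^+ j)) `^ t else 0)%:E)%E.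
  by rewrite lee_fin; case: ifP => _; rewrite ?powR_ge0.
have key a : e < a -> (a%:E <= u)%E ->
   ((a `^ t)%:E <= \sum_(j <oo) (if ((e * 2 ^+ j)%:E < u)%E then (2 * (e * 2 ^+ j)) `^ t else 0)%:E)%E.
  move=> ea au; have [j [ja aj]] := dyadic_level e0 ea.
  apply: le_trans (nneseries_ge j f0); rewrite ifT; last by apply: lt_le_trans au; rewrite lte_fin.
  rewrite lee_fin; apply: ge0_ler_powR; rewrite ?nnegrE ?(ltW t0)//.
  - by rewrite ltW// (lt_trans e0).
  - by rewrite !mulr_ge0// ?exprn_ge0// ltW.
  - by rewrite mulrCA -exprS.
case: u eu f0 key => [a||]; rewrite ?lte_fin//.
- by move=> ea f0 key; rewrite poweR_EFin; exact: key.
- move=> _ f0 key; rewrite poweRyr ?gt_eqF// leye_eq; apply/eqP/eqyP => A A0.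
  (* The last summand makes [a ^ t] at least [A]; the other two put [a] above the starting level. *)
  pose a := e + 1 + A `^ (t^-1).
  have e_a : e < a by rewrite /a -addrA ltrDl ltr_pwDl// powR_ge0.
  apply: le_trans (key a e_a (leey _)); rewrite lee_fin.
  rewrite -[leLHS](powRr1 (ltW A0)) -(mulVf (lt0r_neq0 t0)) powRrM.
  apply: ge0_ler_powR; rewrite ?nnegrE ?powR_ge0 ?(ltW t0)//.
  + by rewrite ltW// (lt_trans e0).
  + by rewrite /a lerDr addr_ge0// ltW.
Qed.

Lemma powR2_ge1 t : 0 <= t -> 1 <= 2 `^ t :> R.
Proof. by move=> t0; rewrite -[leLHS](powRr0 2); apply: ler_powR => //; rewrite ler1n. Qed.

Lemma powR_unbounded t a : 0 < t -> 0 < a -> exists i : nat, a <= i%:R `^ t.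
Proof.
move=> t0 a0; exists (Num.truncn (a `^ t^-1)).+1.
have aE : a = (a `^ t^-1) `^ t by rewrite -powRrM mulVf ?gt_eqF// powRr1// ltW.
rewrite [leLHS]aE; apply: ge0_ler_powR; rewrite ?nnegrE ?powR_ge0 ?(ltW t0) ?ler0n//.
by rewrite ltW// truncnS_gt.
Qed.

Lemma poweR_le (x y : \bar R) t : 0 <= t -> (0 <= x)%E -> (x <= y)%E -> (poweR x t <= poweR y t)%E.
Proof.
move=> t0 x0 xy; apply: gt0_ler_poweR => //; rewrite in_itv /= ?x0 ?leey//.
by rewrite (le_trans x0 xy).
Qed.

Lemma poweR_ge_le1 (w : \bar R) (u v : R) : (0 <= w)%E -> (w <= 1)%E -> 0 < u -> u <= v ->
  (poweR w v <= poweR w u)%E.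
Proof.
move=> w0 w1 u0 uv; have v0 := lt_le_trans u0 uv.
have fw : w \is a fin_num by rewrite ge0_fin_numE// (le_lt_trans w1) ?ltry.
have wE : w = (fine w)%:E by rewrite fineK.
move: w0 w1; rewrite wE; set a := fine w; rewrite !lee_fin => a0 a1.
have [->|an0] := eqVneq a 0; first by rewrite !powR0 ?gt_eqF.
by apply: ger_powR => //; rewrite a1 andbT lt_neqAle eq_sym an0.
Qed.

Lemma poweR_le_ge1 (w : \bar R) (u v : R) : (1 < w)%E -> 0 < v -> u <= v -> (poweR w u <= poweR w v)%E.
Proof.
move=> w1 v0 uv; case: w w1 => [a| |] //; last by rewrite (poweRyr (lt0r_neq0 v0)) leey.
by rewrite lte_fin !poweR_EFin lee_fin => a1; apply: ler_powR => //; exact: ltW.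
Qed.

Lemma poweR_add_le (x y : \bar R) t : 0 <= t -> (0 <= x)%E -> (0 <= y)%E ->
  (poweR (x + y) t <= (2 `^ t)%:E * (poweR x t + poweR y t))%E.
Proof.
move=> t0 x0 y0; wlog xy : x y x0 y0 / (x <= y)%E.
  move=> W; have [xy|/ltW yx] := leP x y; first exact: W.
  by rewrite addeC [X in (_ * X)%E]addeC; exact: W.
apply: (@le_trans _ _ (poweR (2%:E * y) t)).
  apply: poweR_le; rewrite ?adde_ge0//.
  by rewrite -[2]/(1 + 1) EFinD ge0_muleDl// !mul1e leeD.
rewrite poweRM// poweR_EFin lee_wpmul2l ?lee_fin ?powR_ge0//.
by rewrite leeDr// poweR_ge0.
Qed.

(** [r / (r - 1)] decreases in [r], so one constant serves all exponents above [t], as a variable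
    exponent requires. *)
Lemma dyadic_const_le t t' : 0 < t -> t <= t' ->
  2 `^ t' / (2 `^ t' - 1) <= 2 `^ t / (2 `^ t - 1) :> R.
Proof.
move=> t0 tt'; have r1 : 1 < 2 `^ t :> R by exact: powR2_gt1.
have rr : 2 `^ t <= 2 `^ t' :> R by apply: ler_powR => //; rewrite ler1n.
rewrite ler_pdivrMr; last by rewrite subr_gt0 (lt_le_trans r1).
rewrite mulrAC ler_pdivlMr ?subr_gt0//.
by move: r1 rr; move: (2 `^ t) (2 `^ t') => r r'; clear; nra.
Qed.

Lemma dyadic_const_gt0 t : 0 < t -> 0 < 2 `^ t / (2 `^ t - 1) :> R.
Proof.
by move=> t0; rewrite divr_gt0 ?powR_gt0// subr_gt0 powR2_gt1.
Qed.

Lemma dyadic_eseries_le e (u : \bar R) t t' : 0 < e -> (0 <= u)%E -> 0 < t -> t <= t' ->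
  (\sum_(j <oo) (if ((e * 2 ^+ j)%:E < u)%E then (e * 2 ^+ j) `^ t' else 0)%:E <=
  (2 `^ t / (2 `^ t - 1))%:E * poweR u t')%E.
Proof.
move=> e0 u0 t0 tt'; have t'0 : 0 < t' by exact: lt_le_trans tt'.
case: u u0 => [a a0|_|//]; last first.
  rewrite poweRyr ?gt_eqF// gt0_muley ?leey//.
  by rewrite lte_fin; exact: dyadic_const_gt0.
under eq_eseriesr do rewrite lte_fin.
apply: le_trans (dyadic_series_le _ _ _) _ => //.
by rewrite poweR_EFin -EFinM lee_fin ler_wpM2r ?powR_ge0//; exact: dyadic_const_le.
Qed.

Lemma poweR_sup_le (I : Type) (a : I -> \bar R) (B : \bar R) t : 0 < t -> (0 <= B)%E ->
  (forall i, 0 <= a i)%E -> (forall i, poweR (a i) t <= B)%E -> (0 <= ereal_sup (range a))%E ->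
  (poweR (ereal_sup (range a)) t <= B)%E.
Proof.
move=> t0 B0 a0 aB s0; have BE : B = poweR (poweR B t^-1) t.
  by rewrite -poweRrM mulVf ?gt_eqF// poweRe1.
rewrite [leRHS]BE; apply: poweR_le; rewrite ?(ltW t0)//.
apply: ge_ereal_sup => _ [i _ <-].
have -> : a i = poweR (poweR (a i) t) t^-1 by rewrite -poweRrM mulfV ?gt_eqF// poweRe1.
by apply: poweR_le; rewrite ?poweR_ge0// invr_ge0 ltW.
Qed.

Lemma poweR_le_add1 (x : \bar R) t t' : 0 <= t -> t <= t' -> (0 <= x)%E -> (poweR x t <= 1 + poweR x t')%E.
Proof.
move=> t0 tt' x0; have [x1|x1] := leP x 1%E.
  apply: (@le_trans _ _ 1%E); last by rewrite leeDl// poweR_ge0.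
  by rewrite -(poweR1r t); exact: poweR_le.
apply: (@le_trans _ _ (poweR x t')); last by rewrite leeDr.
have [t'0|t'0] := leP t' 0; last exact: poweR_le_ge1.
by have -> : t = t' by apply/eqP; rewrite eq_le tt' (le_trans t'0 t0).
Qed.

(** Since [m / rho = 1 + be * m], the left side is at most [V ^ (be * m) * F ^ (t * m / rho) = (V *
    F ^ t) ^ (be * m) * F ^ t]. The volume is absorbed in the first factor, which [k] bounds. *)
Lemma hedberg (m rho be s t V E F k : R) : 0 < m -> 0 < rho -> 0 <= be -> m^-1 = rho^-1 - be ->
  0 < s -> 0 < t -> 0 < V -> 0 <= E -> 0 <= F -> E <= F `^ (t * s / rho) -> V * F `^ t <= k -> 0 <= k ->
  (V `^ be * E `^ s^-1) `^ m <= k `^ (be * m) * F `^ t.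
Proof.
move=> m0 r0 be0 mE s0 t0 V0 E0 F0 EF VF k0.
have h : m / rho = 1 + be * m.
  have -> : rho^-1 = m^-1 + be by rewrite mE subrK.
  by rewrite mulrDr divff ?gt_eqF// mulrC addrC mulrC [m * be]mulrC addrC.
apply: (@le_trans _ _ ((V `^ be * (F `^ (t * s / rho)) `^ s^-1) `^ m)).
  apply: ge0_ler_powR; rewrite ?nnegrE ?mulr_ge0 ?powR_ge0 ?(ltW m0)//.
  by apply: ler_wpM2l; rewrite ?powR_ge0//; apply: ge0_ler_powR; rewrite ?nnegrE ?powR_ge0// invr_ge0 ltW.
rewrite powRM ?powR_ge0// -!powRrM.
have -> : t * s / rho * (s^-1 * m) = t + t * (be * m).
  have -> : t * s / rho * (s^-1 * m) = t * (m / rho) by field; rewrite !gt_eqF.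
  by rewrite h mulrDr mulr1.
rewrite powRD; last by rewrite gt_eqF//= ltr_wpDr// !mulr_ge0// ltW.
rewrite [t * (be * m)]mulrC mulrCA [in leRHS]mulrC; apply: ler_wpM2l; rewrite ?powR_ge0//.
rewrite [be * m * t]mulrC (powRrM F) -powRM ?powR_ge0 ?(ltW V0)//.
apply: ge0_ler_powR; rewrite ?nnegrE ?mulr_ge0 ?powR_ge0 ?(ltW V0) ?(ltW m0)//.
Qed.

(** Young's inequality against 1, with its weights kept: equality at [x = 1] is what yields Jensen's
    inequality with constant 1. *)
Lemma young1 (x a : R) : 0 <= x -> 1 < a -> x <= x `^ a / a + (1 - a^-1).
Proof.
move=> x0 a1; have a0 : 0 < a by rewrite (lt_trans _ a1).
have ai1 : a^-1 < 1 by rewrite invf_lt1.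
have b0 : 0 < (1 - a^-1)^-1 by rewrite invr_gt0 subr_gt0.
have := @conjugate_powR R x 1 a (1 - a^-1)^-1 x0 ler01 a0 b0.
by rewrite invrK addrC subrK mulr1 powR1 mul1r; exact.
Qed.

End RealFacts.

(** * Averages over balls as conditional expectations *)

Section Measure.
Context (R : realType) (p n : nat).
Local Notation T := (QpM p n).
Variable mu : {measure set T -> \bar R}.
Hypothesis p_gt1 : (1 < p)%N.
Hypothesis haar : qp_padic_haar mu.
Implicit Types (x y z : T) (g h : int).

Definition vol g : R := (p%:R : R) ^ (n%:Z * g).

Lemma p_gt0R : 0 < p%:R :> R. Proof. by rewrite ltr0n; lia. Qed.
Lemma p_gt1R : 1 < p%:R :> R. Proof. by rewrite ltr1n. Qed.

Lemma vol_gt0 g : 0 < vol g.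
Proof. by rewrite /vol exprz_gt0// p_gt0R. Qed.

Lemma vol_neq0 g : vol g != 0. Proof. by rewrite gt_eqF// vol_gt0. Qed.

Lemma volE g : vol g = p%:R `^ (n%:R * g%:~R).
Proof. by rewrite /vol -powR_intmul ?ltW ?p_gt0R// intrM. Qed.

Lemma volS g : vol (g + 1) = p%:R ^+ n * vol g.
Proof. by rewrite /vol mulrDr mulr1 expfzDr ?gt_eqF ?p_gt0R// mulrC. Qed.

Lemma vol0 : vol 0 = 1. Proof. by rewrite /vol mulr0. Qed.

Lemma vol_le g h : g <= h -> vol g <= vol h.
Proof.
move=> gh; rewrite !volE; apply: ler_powR; first by rewrite ltW// p_gt1R.
by rewrite ler_wpM2l ?ler0n// ler_int.
Qed.

Lemma mu_ball x g : mu (qp_ball x g) = (vol g)%:E. Proof. exact: haar. Qed.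

Definition Ex g (phi : T -> \bar R) x : \bar R :=
  (((vol g)^-1)%:E * \int[mu]_(y in qp_ball x g) phi y)%E.

Lemma Ex_inv g phi : ball_inv g (Ex g phi).
Proof. by move=> x y xy; rewrite /Ex (qp_ball_eq xy). Qed.

Lemma measurable_Ex g phi : mfun (Ex g phi).
Proof. exact: ball_inv_measurable (@Ex_inv g phi). Qed.

Lemma volV_ge0 g : (0 <= ((vol g)^-1)%:E :> \bar R)%E.
Proof. by rewrite lee_fin invr_ge0 ltW// vol_gt0. Qed.

Lemma Ex_ge0 g phi x : (forall y, qp_ball x g y -> 0 <= phi y)%E -> (0 <= Ex g phi x)%E.
Proof. by move=> h; rewrite mule_ge0 ?volV_ge0 ?integral_ge0. Qed.

Lemma Ex_le g phi psi x : (forall y, qp_ball x g y -> 0 <= phi y)%E ->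
  (forall y, qp_ball x g y -> phi y <= psi y)%E -> (Ex g phi x <= Ex g psi x)%E.
Proof. by move=> h1 h2; rewrite lee_wpmul2l ?volV_ge0//; apply: ge0_integral_le. Qed.

Lemma eq_Ex g phi psi x :
  (forall y, qp_ball x g y -> phi y = psi y)%E -> (Ex g phi x = Ex g psi x)%E.
Proof. by move=> h; congr (_ * _)%E; apply: eq_integral => y; rewrite inE => /h. Qed.

Lemma ExD g phi psi x : mfun phi -> mfun psi ->
  (forall y, qp_ball x g y -> 0 <= phi y)%E -> (forall y, qp_ball x g y -> 0 <= psi y)%E ->
  (Ex g (fun y => phi y + psi y) x = Ex g phi x + Ex g psi x)%E.
Proof.
move=> mphi mpsi phi0 psi0; rewrite /Ex ge0_integralD//.
- by rewrite ge0_muleDr// ?integral_ge0.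
- exact: measurable_qp_ball.
- exact: measurable_funTS.
- exact: measurable_funTS.
Qed.

Lemma ExZ g phi x (k : \bar R) : mfun phi ->
  (forall y, qp_ball x g y -> 0 <= phi y)%E -> (0 <= k)%E ->
  (Ex g (fun y => k * phi y) x = k * Ex g phi x)%E.
Proof.
move=> mphi phi0 k0; rewrite /Ex ge0_integralZl//.
- by rewrite muleCA.
- exact: measurable_qp_ball.
- exact: measurable_funTS.
Qed.

Lemma Ex_cst g (c : \bar R) x : Ex g (cst c) x = c.
Proof.
rewrite /Ex integral_cst; last exact: measurable_qp_ball.
by rewrite mu_ball muleCA -EFinM mulVf ?vol_neq0// mule1.
Qed.

(** The doubling constant: the ball of the next radius contains this one and has [p ^ n] times its
    volume. *)
Lemma ExS g phi x : mfun phi -> (forall y, 0 <= phi y)%E ->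
  (Ex g phi x <= (p%:R ^+ n)%:E * Ex (g + 1) phi x)%E.
Proof.
move=> mphi phi0; have pn0 : (p%:R ^+ n : R) != 0 by rewrite expf_neq0// gt_eqF// p_gt0R.
rewrite /Ex volS invfM muleA -EFinM mulrA divff// mul1r lee_wpmul2l ?volV_ge0//; apply: ge0_subset_integral => //.
- exact: measurable_qp_ball.
- exact: measurable_qp_ball.
- exact: measurable_funTS.
- by apply: qp_ball_le; rewrite lerDl.
Qed.

Lemma int_ball g (x : T) phi :
  (\int[mu]_(y in qp_ball x g) phi y = (vol g)%:E * Ex g phi x)%E.
Proof. by rewrite /Ex muleA -EFinM divff ?vol_neq0// mul1e. Qed.

Lemma integral_classes (cl : T -> nat) g phi : (forall x y, cl x = cl y <-> qp_ball x g y) ->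
  mfun phi -> (forall x, 0 <= phi x)%E ->
  (\int[mu]_x phi x = \sum_(i <oo) \int[mu]_(x in cl @^-1` [set i]) phi x)%E.
Proof.
move=> clP mphi phi0.
have mF i : measurable (cl @^-1` [set i] : set T).
  apply: (@ball_inv_set _ _ g) => x y /clP /= <- //.
have UF : \bigcup_i (cl @^-1` [set i]) = setT.
  by apply/seteqP; split=> // x _; exists (cl x).
rewrite -ge0_integral_bigcup//.
- by rewrite UF.
- by rewrite UF.
- by apply/trivIsetP => i j _ _ ij; apply/seteqP; split=> // x [/= -> e]; move: ij; rewrite e eqxx.
Qed.

(** The defining property of a conditional expectation: on each of the countably many balls [w] is
    constant and leaves the integral. *)
Lemma int_Ex g (w phi : T -> \bar R) : ball_inv g w -> (forall x, 0 <= w x)%E ->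
  mfun phi -> (forall x, 0 <= phi x)%E ->
  (\int[mu]_x (w x * phi x) = \int[mu]_x (w x * Ex g phi x))%E.
Proof.
move=> iw w0 mphi phi0; have [cl clP] := @qp_ball_class p n g.
have mw := ball_inv_measurable iw.
have E0 x : (0 <= Ex g phi x)%E by apply: Ex_ge0.
rewrite !(integral_classes clP) //; last first.
- by move=> x; rewrite mule_ge0.
- exact: emeasurable_funM.
- by move=> x; rewrite mule_ge0.
- by apply: emeasurable_funM => //; exact: measurable_Ex.
apply: eq_eseriesr => i _.
have [[x xi]|nx] := pselect (exists x, cl x = i); last first.
  rewrite (_ : _ @^-1` _ = set0) ?integral_set0//.
  by apply/seteqP; split=> // x xi; apply: nx; exists x.
have -> : cl @^-1` [set i] = qp_ball x g.
  by apply/seteqP; split=> y /=; rewrite -xi; [move/esym/clP|move/clP].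
transitivity (\int[mu]_(y in qp_ball x g) (w x * phi y))%E.
  by apply: eq_integral => y; rewrite inE => /iw ->.
transitivity (\int[mu]_(y in qp_ball x g) (w x * Ex g phi x))%E; last first.
  by apply: eq_integral => y; rewrite inE => xy; rewrite (iw _ _ xy) (Ex_inv _ xy).
rewrite integral_cst; last exact: measurable_qp_ball.
rewrite mu_ball ge0_integralZl//; last 2 first.
- exact: measurable_qp_ball.
- exact: measurable_funTS.
by rewrite -muleA; congr (_ * _)%E; rewrite int_ball muleC.
Qed.

(** There are countably many balls in all, so exceptional null sets may be chosen ball by ball. *)
Lemma ae_balls (Q : int -> T -> Prop) :
  (forall x g, {ae mu, forall y, qp_ball x g y -> Q g y}) ->
  {ae mu, forall y, forall g, Q g y}.
Proof.
move=> H; apply: ae_forall_count => g; have [cl clP] := @qp_ball_class p n g.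
have : {ae mu, forall y, forall i : nat, cl y = i -> Q g y}.
  apply: ae_foralln => i.
  have [[x xi]|nx] := pselect (exists x, cl x = i); last first.
    by apply: aeW => y yi; exfalso; apply: nx; exists y.
  by apply: filterS (H x g) => y Hy yi; apply: Hy; apply/clP; rewrite xi.
by apply: filterS => y K; exact: (K (cl y)).
Qed.

Lemma ball_not_null x g : ~ mu.-negligible (qp_ball x g).
Proof.
move=> [A [mA A0 sA]].
have : (mu (qp_ball x g) <= mu A)%E by apply: le_measure => //; rewrite inE//; exact: measurable_qp_ball.
by rewrite A0 mu_ball lee_fin leNgt vol_gt0.
Qed.

Lemma ae_ball_ex (P : T -> Prop) x g : {ae mu, forall y, qp_ball x g y -> P y} ->
  exists2 y, qp_ball x g y & P y.
Proof.
move=> H; apply: contrapT => nP; apply: (@ball_not_null x g).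
apply: negligibleS H => y xy /= K; apply: nP; exists y => //; exact: K.
Qed.

(** * Unions of balls and the differentiation theorem *)

Definition saturated g (U : set T) := forall x y, qp_ball x g y -> U x -> U y.

Lemma saturated_le g h U : g <= h -> saturated h U -> saturated g U.
Proof. by move=> gh sU x y /(qp_ball_le gh); exact: sU. Qed.

Lemma saturatedU g U V : saturated g U -> saturated g V -> saturated g (U `|` V).
Proof. by move=> sU sV x y xy [Ux|Vx]; [left; exact: sU Ux|right; exact: sV Vx]. Qed.

Lemma saturatedI g U V : saturated g U -> saturated g V -> saturated g (U `&` V).
Proof. by move=> sU sV x y xy [Ux Vx]; split; [exact: sU Ux|exact: sV Vx]. Qed.

Lemma saturatedC g U : saturated g U -> saturated g (~` U).
Proof. by move=> sU x y xy Ux Uy; apply: Ux; apply: sU Uy; exact: qp_ball_sym. Qed.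

Lemma saturated_ball x g : saturated g (qp_ball x g).
Proof. by move=> y z yz xy; exact: qp_ball_trans yz. Qed.

Lemma measurable_saturated g U : saturated g U -> measurable (U : set T).
Proof. exact: ball_inv_set. Qed.

Lemma indic_inv g (U : set T) : saturated g U -> ball_inv g (fun x => (\1_U x)%:E : \bar R).
Proof.
move=> sU x y xy; congr (_%:E); rewrite !indicE; congr (_%:R); congr nat_of_bool.
apply/idP/idP; rewrite !inE; first exact: sU xy.
by apply: sU; exact: qp_ball_sym.
Qed.

(* Unions of balls approximate measurable sets in measure; this replaces regularity
   in the proof of the differentiation theorem [lebesgue_le]. *)
Definition ball_approx (P A : set T) := measurable A /\
  forall e : R, 0 < e -> exists h U, saturated h U /\
    (mu (P `&` (A `\` U)) <= e%:E)%E /\ (mu (P `&` (U `\` A)) <= e%:E)%E.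

Lemma ball_approxU (P A B : set T) : measurable P ->
  ball_approx P A -> ball_approx P B -> ball_approx P (A `|` B).
Proof.
move=> mP [mA HA] [mB HB]; split; first exact: measurableU.
move=> e e0; have e20 : 0 < e / 2 by rewrite divr_gt0.
have [h [U [sU [U1 U2]]]] := HA _ e20; have [k [V [sV [V1 V2]]]] := HB _ e20.
have mU := measurable_saturated sU; have mV := measurable_saturated sV.
have mX (W Z : set T) : measurable W -> measurable Z -> measurable (P `&` (W `\` Z)).
  by move=> mW mZ; apply: measurableI => //; exact: measurableD.
have EE : e%:E = ((e / 2)%:E + (e / 2)%:E)%E by rewrite -EFinD -splitr.
exists (Num.min h k), (U `|` V); split; [|split].
- by apply: saturatedU; [apply: saturated_le sU|apply: saturated_le sV]; rewrite ge_min lexx ?orbT.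
- rewrite EE; apply: (@le_trans _ _ (mu ((P `&` (A `\` U)) `|` (P `&` (B `\` V))))).
    apply: le_measure; rewrite ?inE; [exact: mX (measurableU _ _ _ _) (measurableU _ _ _ _)|exact: measurableU (mX _ _ _ _) (mX _ _ _ _)|].
    by move=> x [Px [[Ax|Bx] nUV]]; [left|right]; split=> //; split=> // ?; apply: nUV; [left|right].
  by apply: le_trans (measureU2 _ _ _) _; rewrite ?leeD//; exact: mX.
- rewrite EE; apply: (@le_trans _ _ (mu ((P `&` (U `\` A)) `|` (P `&` (V `\` B))))).
    apply: le_measure; rewrite ?inE; [exact: mX (measurableU _ _ _ _) (measurableU _ _ _ _)|exact: measurableU (mX _ _ _ _) (mX _ _ _ _)|].
    by move=> x [Px [[Ax|Bx] nUV]]; [left|right]; split=> //; split=> // ?; apply: nUV; [left|right].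
  by apply: le_trans (measureU2 _ _ _) _; rewrite ?leeD//; exact: mX.
Qed.

(** The approximable sets form a sigma-algebra that contains the balls. A complement exchanges the
    two errors; a countable union is first cut to finitely many sets, the tail being small because
    the fixed ball has finite measure. *)
Lemma ball_approx_all x0 g0 (A : set T) : measurable A -> ball_approx (qp_ball x0 g0) A.
Proof.
pose P : set T := qp_ball x0 g0; have mP : measurable P by exact: measurable_qp_ball.
rewrite -/P.
apply: (@smallest_sub _ (sigma_algebra setT) (@qp_balls p n) (ball_approx P)); last first.
  move=> _ [x [g ->]]; split; first exact: measurable_qp_ball.
  move=> e e0; exists g, (qp_ball x g); split; first exact: saturated_ball.
  by rewrite setDv setI0 measure0 lee_fin ltW.
have S0 : ball_approx P set0.
  split; first exact: measurable0.
  move=> e e0; exists 0, set0; split; first by move=> ?.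
  by rewrite setDv setI0 measure0 lee_fin ltW.
split=> //.
- move=> B [mB HB]; rewrite setTD; split; first exact: measurableC.
  move=> e /HB [h [U [sU [U1 U2]]]]; exists h, (~` U); split; first exact: saturatedC.
  rewrite (_ : ~` B `\` ~` U = U `\` B); last by rewrite !setDE setCK setIC.
  by rewrite (_ : ~` U `\` ~` B = B `\` U)//; rewrite !setDE setCK setIC.
- move=> F' SF; pose F : (set T)^nat := F'; rewrite -/F in SF *; have mF i : measurable (F i : set T) by have [] := SF i.
  split; first exact: bigcupT_measurable.
  move=> e e0; have e20 : 0 < e / 2 by rewrite divr_gt0.
  pose D m : set T := P `&` (\bigcup_i F i `\` \big[setU/set0]_(i < m) F i).
  have mD m : measurable (D m).
    apply: measurableI => //; apply: measurableD; first exact: bigcupT_measurable.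
    exact: bigsetU_measurable.
  have D0 : \bigcap_m D m = set0.
    apply/seteqP; split=> // x Dx; have [_ [[i _ Fi] _]] := Dx 0%N I.
    have [_ [_]] := Dx i.+1 I; apply; rewrite -bigcup_mkord; exists i => //=.
  have muD : (mu (D m) @[m --> \oo] --> mu (\bigcap_m D m))%E.
    apply: nonincreasing_cvg_mu => //.
    + apply: (@le_lt_trans _ _ (mu P)); last by rewrite mu_ball ltry.
      by apply: le_measure; rewrite ?inE//; move=> x [].
    + by rewrite D0; exact: measurable0.
    + move=> m k mk; apply/subsetPset => x [Px [Fx nx]]; split=> //; split=> // Fx'; apply: nx.
      move: Fx'; rewrite -!bigcup_mkord => -[i im Fi]; exists i => //=; exact: leq_trans im mk.
  have [m Dm] : exists m, (mu (D m) <= (e / 2)%:E)%E.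
    move: muD; rewrite D0 measure0 => /fine_cvgP [[N _ HN] /cvgr0Pnorm_lt].
    move=> /(_ _ e20) [M _ HM]; exists (N + M)%N.
    have fD := HN (N + M)%N (leq_addr _ _); rewrite -(fineK fD) lee_fin.
    by have := HM (N + M)%N (leq_addl _ _); move/ltW; apply: le_trans; rewrite ler_norm.
  have : ball_approx P (\big[setU/set0]_(i < m) F i).
    by elim/big_ind : _ => //; move=> ? ?; exact: ball_approxU.
  move=> [mFm /(_ _ e20) [h [U [sU [U1 U2]]]]]; have mU := measurable_saturated sU.
  exists h, U; split=> //; split.
    have -> : e%:E = ((e / 2)%:E + (e / 2)%:E)%E by rewrite -EFinD -splitr.
    apply: (@le_trans _ _ (mu (D m `|` (P `&` (\big[setU/set0]_(i < m) F i `\` U))))).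
      apply: le_measure; rewrite ?inE.
      * apply: measurableI => //; apply: measurableD => //; exact: bigcupT_measurable.
      * by apply: measurableU => //; apply: measurableI => //; exact: measurableD.
      * move=> x [Px [Fx nU]].
        have [Fmx|Fmx] := pselect ((\big[setU/set0]_(i < m) F i) x); [right|left]; split=> //.
    apply: le_trans (measureU2 _ _ _) _; rewrite ?leeD//.
    by apply: measurableI => //; exact: measurableD.
  apply: (@le_trans _ _ (mu (P `&` (U `\` \big[setU/set0]_(i < m) F i)))).
    apply: le_measure; rewrite ?inE.
    + apply: measurableI => //; apply: measurableD => //; exact: bigcupT_measurable.
    + by apply: measurableI => //; exact: measurableD.
    + move=> x [Px [Ux nF]]; split=> //; split=> // Fx; apply: nF.
      by move: Fx; rewrite -bigcup_mkord => -[i _ Fi]; exists i.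
  by apply: le_trans U2 _; rewrite lee_fin ler_pdivrMr// ler_peMr ?ltW// ltr1n.
Qed.

(** Approximate [D] by a union [U] of balls of radius at most [p ^ g0]. Each of them has density at
    most [t], hence [mu D <= t * (mu D + e) + e] for every [e > 0], which forces [mu D = 0] because
    [t < 1]. *)
Lemma density_null x0 g0 (D : set T) (t : R) : measurable D -> D `<=` qp_ball x0 g0 -> 0 <= t < 1 ->
  (forall x g, D x -> g <= g0 -> (Ex g (fun y => (\1_D y)%:E) x <= t%:E)%E) -> mu D = 0%E.
Proof.
move=> mD DP /andP[t0 t1] HD.
pose P : set T := qp_ball x0 g0; have mP : measurable P by exact: measurable_qp_ball.
have fD : (mu D < +oo)%E.
  apply: (@le_lt_trans _ _ (mu P)); last by rewrite mu_ball ltry.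
  by apply: le_measure; rewrite ?inE.
(* A ball that meets [D] has the average seen from a point of [D]; a ball that misses [D] has
   average 0. *)
have HD' x g : g <= g0 -> (Ex g (fun y => (\1_D y)%:E) x <= t%:E)%E.
  move=> gg; have [[y [xy Dy]]|nD] := pselect (exists y, qp_ball x g y /\ D y).
    by rewrite (Ex_inv _ xy); exact: HD.
  rewrite (@eq_Ex g _ (cst 0%E)); first by rewrite Ex_cst lee_fin.
  move=> y xy; rewrite indicE memNset// => Dy; apply: nD; by exists y.
have key h (U : set T) : saturated h U -> h <= g0 -> U `<=` P -> (mu (D `&` U) <= t%:E * mu U)%E.
  move=> sU hg UP; have mU := measurable_saturated sU.
  have -> : mu (D `&` U) = (\int[mu]_x ((\1_U x)%:E * (\1_D x)%:E))%E.
    by rewrite integral_indic_mul integral_indic.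
  rewrite (int_Ex (indic_inv sU))//; last by apply/measurable_EFinP; exact: measurable_indic.
  apply: (@le_trans _ _ (\int[mu]_x (t%:E * (\1_U x)%:E))%E).
    apply: ge0_integral_le => x _.
      by rewrite mule_ge0// Ex_ge0// => y _; rewrite lee_fin.
    by rewrite muleC lee_wpmul2r// HD'.
  rewrite ge0_integralZl// ?lee_fin//; last by apply/measurable_EFinP; exact: measurable_indic.
  by rewrite integral_indic// setIT.
have fD' : mu D \is a fin_num by rewrite ge0_fin_numE.
have : forall e, 0 < e -> (mu D <= (t * (fine (mu D) + e) + e)%:E)%E.
  move=> e e0; have [_ /(_ _ e0) [h [U0 [sU0 [U1 U2]]]]] := @ball_approx_all x0 g0 D mD.
  pose k := Num.min h g0; pose U := U0 `&` P.
  have kg : k <= g0 by rewrite ge_min lexx orbT.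
  have sU : saturated k U.
    apply: saturatedI; first by apply: saturated_le sU0; rewrite ge_min lexx.
    by apply: saturated_le kg _; exact: saturated_ball.
  have mU := measurable_saturated sU; have mU0 := measurable_saturated sU0.
  have UP : U `<=` P by move=> x [].
  have DE : D = (D `&` U) `|` (P `&` (D `\` U0)).
    apply/seteqP; split=> x.
      by move=> Dx; have [Ux|Ux] := pselect (U0 x); [left|right]; split=> //; [split=> //|]; exact: DP.
    by case=> [[]|[_ []]].
  have H1 : (mu U <= mu D + e%:E)%E.
    apply: (@le_trans _ _ (mu (D `|` (P `&` (U0 `\` D))))).
      apply: le_measure; rewrite ?inE//.
        by do ?[apply: measurableU|apply: measurableD|apply: measurableI].
      move=> x [Ux Px]; have [Dx|Dx] := pselect (D x); [by left|right]; split=> //.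
    apply: le_trans (measureU2 _ _ _) _ => //.
      by do ?[apply: measurableU|apply: measurableD|apply: measurableI].
    by rewrite leeD.
  rewrite [leLHS](_ : _ = mu ((D `&` U) `|` (P `&` (D `\` U0)))); last by congr (mu _).
  apply: le_trans (measureU2 _ _ _) _ => //.
  - exact: measurableI.
  - by do ?[apply: measurableU|apply: measurableD|apply: measurableI].
  rewrite EFinD leeD//; apply: le_trans (key _ _ sU kg UP) _.
  by rewrite EFinM EFinD fineK// lee_wpmul2l// lee_fin.
move=> H; apply/eqP; rewrite eq_le measure_ge0 andbT -(fineK fD') lee_fin.
rewrite leNgt; apply/negP => m0.
(* With this [e], [t * (m + e) + e <= t * m + 2 * e = m - (1 - t) * m / 2 < m]. *)
pose m := fine (mu D); pose e := (1 - t) * m / 4.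
have e0 : 0 < e by rewrite divr_gt0// mulr_gt0// subr_gt0.
have := H e e0; rewrite -[leLHS](fineK fD') lee_fin -/m.
have : e * 4 = (1 - t) * m by rewrite /e divfK.
rewrite -/m in m0; move: e0 t0 t1 m0; move: (e) (m) => e' m' e0 t0 t1 m0.
by move=> e1 e2; clear - e0 t0 t1 m0 e1 e2; nra.
Qed.

(** For rationals [a < b], let [E] be the set where all small averages are at most [a] but
    [phi > b]. There [b * 1_E <= phi] bounds the density of [E] by [a / b < 1], so [E] is null.
    Countably many pairs of rationals serve all [c]. *)
Lemma lebesgue_le N (phi : T -> \bar R) : mfun phi -> (forall x, 0 <= phi x)%E ->
  {ae mu, forall x, forall c : R, 0 <= c ->
    (forall g, g <= N -> (Ex g phi x <= c%:E)%E) -> (phi x <= c%:E)%E}.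
Proof.
move=> mphi phi0.
have H (ab : rat * rat) : {ae mu, forall x, 0 < ratr ab.1 :> R -> ratr ab.1 < ratr ab.2 :> R ->
    (forall g, g <= N -> (Ex g phi x <= (ratr ab.1)%:E)%E) -> (phi x <= (ratr ab.2)%:E)%E}.
  case: ab => a b /=; set a' : R := ratr a; set b' : R := ratr b.
  have [ab|ab] := boolP ((0 < a') && (a' < b')); last first.
    by apply: aeW => x a0 aab; rewrite a0 aab in ab.
  have /andP[a0 aab] := ab; have b0 := lt_trans a0 aab.
  suff: {ae mu, forall x, ~ ((forall g, g <= N -> (Ex g phi x <= a'%:E)%E) /\ (b'%:E < phi x)%E)}.
    apply: filterS => x K _ _ Hx; rewrite leNgt; apply/negP => Kx; exact: K.
  pose E : set T := [set x | (forall g, g <= N -> (Ex g phi x <= a'%:E)%E) /\ (b'%:E < phi x)%E].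
  have mE : measurable E.
    have -> : E = (\bigcap_(m : nat) [set x | (Ex (N - m%:Z) phi x <= a'%:E)%E]) `&` [set x | (b'%:E < phi x)%E].
      apply/seteqP; split=> x [Hx bx]; split=> //.
        by move=> m _; apply: Hx; rewrite lerBlDr lerDl.
      by move=> g gN; have := Hx `|N - g|%N I; rewrite /= gez0_abs ?subr_ge0// opprB addrC subrK.
    apply: measurableI.
      apply: bigcapT_measurable => m; rewrite -[X in measurable X]setTI.
      by apply: emeasurable_fun_infty_c => //; exact: measurable_Ex.
    by rewrite -[X in measurable X]setTI; exact: emeasurable_fun_o_infty.
  pose g0 := N.
  have [cl clP] := @qp_ball_class p n g0.
  have mB j : measurable (cl @^-1` [set j] : set T).
    by apply: (@ball_inv_set _ _ g0) => x y /clP /= <-.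
  suff H j : mu (E `&` cl @^-1` [set j]) = 0%E.
    exists E; split=> //; last first.
      move=> x /= nH; split=> [g gN|]; last first.
        rewrite ltNge; apply/negP => K; apply: nH => -[_]; by rewrite ltNge K.
      by rewrite leNgt; apply/negP => K; apply: nH => -[/(_ _ gN)]; rewrite leNgt K.
    apply/eqP; rewrite eq_le measure_ge0 andbT.
    have -> : E = \bigcup_j (E `&` cl @^-1` [set j]).
      by apply/seteqP; split=> x; [move=> Ex; exists (cl x)|case=> j _ []].
    apply: (le_trans (measure_sigma_subadditive _ _ _ _)); last 1 first.
    - by rewrite eseries0// => j _ _; exact: H.
    - by move=> j; exact: measurableI.
    - by apply: bigcupT_measurable => j; exact: measurableI.
    - by [].
  have [[x xj]|nx] := pselect (exists x, cl x = j); last first.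
    rewrite (_ : _ `&` _ = set0) ?measure0//.
    by apply/seteqP; split=> // x [_ xj]; apply: nx; exists x.
  have bE : cl @^-1` [set j] = qp_ball x g0.
    by apply/seteqP; split=> y /=; rewrite -xj; [move/esym/clP|move/clP].
  apply: (@density_null x g0 _ (a' / b')).
  - exact: measurableI.
  - by rewrite bE; move=> ? [].
  - by rewrite divr_ge0 ?ltW//= ltr_pdivrMr ?mul1r.
  move=> y g [[Ey1 Ey2] _] gg.
  rewrite -(@lee_pmul2l _ b'%:E) ?lte_fin// -EFinM [b' * _]mulrC divfK ?gt_eqF//.
  rewrite -ExZ//; last by rewrite lee_fin ltW.
  - apply: le_trans (Ey1 _ gg); apply: Ex_le => z _; first by rewrite mule_ge0// lee_fin ltW.
    rewrite indicE; have [|_] := boolP (z \in _); last by rewrite mule0.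
    by rewrite inE => -[[_ /ltW ?] _]; rewrite mule1.
  - apply/measurable_EFinP; apply: measurable_indic; exact: measurableI.
have := ae_forall_count H; apply: filterS => x Hx c c0 Hc; apply/lee_addgt0Pr => e e0.
have [a] : exists a : rat, ratr a \in `]c, c + e[ by apply: rat_in_itvoo; rewrite ltrDl.
rewrite in_itv /= => /andP[ca ae].
have [b] : exists b : rat, ratr b \in `]ratr a, c + e[ by exact: rat_in_itvoo.
rewrite in_itv /= => /andP[ab be].
apply: (@le_trans _ _ (ratr b)%:E); last by rewrite -EFinD lee_fin ltW.
apply: (Hx (a, b)) => //=; first exact: le_lt_trans ca.
by move=> g gN; apply: le_trans (Hc _ gN) _; rewrite lee_fin ltW.
Qed.

(** * Stopping at the largest selected ball *)

Lemma seqDU_inv N (C : nat -> set T) : (forall i, saturated (N - i%:Z) (C i)) ->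
  forall i, saturated (N - i%:Z) (seqDU C i).
Proof.
move=> sC i x y xy [Cx nCx]; split; first exact: sC xy Cx.
apply: contra_not nCx; rewrite -!bigcup_mkord => -[j /= ji Cj]; exists j => //.
(* An earlier [C j] consists of larger balls, so it is also a union of balls of radius
   [p ^ (N - i)]. *)
by apply: sC Cj; apply: qp_ball_sym; apply: qp_ball_le xy; rewrite lerD2l lerN2 lez_nat ltnW.
Qed.

Lemma integral_Ex g (S : set T) (phi : T -> \bar R) : saturated g S ->
  mfun phi -> (forall x, 0 <= phi x)%E ->
  (\int[mu]_(x in S) phi x = \int[mu]_(x in S) Ex g phi x)%E.
Proof.
move=> sS mphi phi0; rewrite -integral_indic_mul (int_Ex (indic_inv sS))//.
by rewrite integral_indic_mul.
Qed.

(* [seqDU C i] is the region stopped at scale [N - i]; being a union of balls of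
   that radius, it allows [phi i] and [psi] to be replaced by their averages. *)
Lemma stopping_le N (C : nat -> set T) (F psi : T -> \bar R) (phi : nat -> T -> \bar R) :
  (forall i, saturated (N - i%:Z) (C i)) ->
  mfun F -> (forall x, 0 <= F x)%E ->
  mfun psi -> (forall x, 0 <= psi x)%E ->
  (forall i, mfun (phi i)) -> (forall i x, 0 <= phi i x)%E ->
  (forall i, {ae mu, forall x, seqDU C i x -> (F x <= phi i x)%E}) ->
  (forall i x, seqDU C i x -> (Ex (N - i%:Z) (phi i) x <= Ex (N - i%:Z) psi x)%E) ->
  (\int[mu]_(x in \bigcup_i C i) F x <= \int[mu]_(x in \bigcup_i C i) psi x)%E.
Proof.
move=> sC mF F0 mpsi psi0 mphi phi0 Fphi phipsi.
have sS := seqDU_inv sC; have mS i := measurable_saturated (sS i).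
rewrite seqDU_bigcup_eq !ge0_integral_bigcup//; [|exact: measurable_funTS..].
apply: lee_nneseries => i _; first by move=> _; apply: integral_ge0 => x _.
apply: (@le_trans _ _ (\int[mu]_(x in seqDU C i) phi i x)%E).
  by apply: ae_ge0_le_integral => //; exact: measurable_funTS.
rewrite (integral_Ex (sS i))// [leRHS](integral_Ex (sS i))//.
by apply: ge0_integral_le => x Sx; [exact: Ex_ge0|exact: phipsi].
Qed.

(** * The Hardy-Littlewood maximal function *)

Definition maxf (v : T -> \bar R) x : \bar R := ereal_sup (range (fun g => Ex g v x)).

Lemma Ex_maxf g v x : (Ex g v x <= maxf v x)%E.
Proof. by apply: ereal_sup_ubound; exists g. Qed.

Lemma maxf_gt v x c : (c < maxf v x)%E -> exists g, (c < Ex g v x)%E.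
Proof.
move=> h; apply: contrapT => nh; move: h; rewrite ltNge => /negP; apply.
apply: ge_ereal_sup => _ [g _ <-]; rewrite leNgt; apply/negP => h; apply: nh; by exists g.
Qed.

(** Stopping needs a largest ball, so the radii are capped by [p ^ N] and the cap is varied. *)
Lemma maxf_gtE v (c : \bar R) : [set x | (c < maxf v x)%E] =
  \bigcup_(N : nat) \bigcup_i [set x | (c < Ex (N%:Z - i%:Z) v x)%E].
Proof.
apply/seteqP; split=> x.
  move=> /maxf_gt[g cg]; exists `|g|%N => //; exists `|(`|g|%:Z - g)|%N => //=.
  rewrite [X in Ex X _ _](_ : _ = g)//; lia.
by move=> [N _ [i _ /= h]]; apply: lt_le_trans h _; exact: Ex_maxf.
Qed.

Lemma saturated_Ex g (c : \bar R) v : saturated g [set x | (c < Ex g v x)%E].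
Proof. by move=> x y xy /=; rewrite (Ex_inv _ xy). Qed.

Lemma measurable_maxf v : mfun (maxf v).
Proof. by apply: measurable_ereal_sup => g; exact: measurable_Ex. Qed.

(** Doob's inequality, with constant 1: the stopped balls are disjoint and on each of them [c] is
    below the average of [v]. *)
Lemma maxf_weak (v : T -> \bar R) (c : R) : 0 < c -> mfun v -> (forall x, 0 <= v x)%E ->
  (c%:E * mu [set x | (c%:E < maxf v x)%E] <= \int[mu]_x v x)%E.
Proof.
move=> c0 mv v0; rewrite maxf_gtE.
pose A (N : nat) : set T := \bigcup_i [set x | (c%:E < Ex (N%:Z - i%:Z) v x)%E].
have mA N : measurable (A N).
  apply: bigcupT_measurable => i; apply: (@measurable_saturated (N%:Z - i%:Z)); exact: saturated_Ex.
have AN N : (c%:E * mu (A N) <= \int[mu]_x v x)%E.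
  rewrite -integral_cst//; apply: (@le_trans _ _ (\int[mu]_(x in A N) v x)%E); last first.
    by apply: ge0_subset_integral => //.
  apply: (@stopping_le N%:Z _ _ _ (fun=> cst c%:E)) => //.
  - by move=> i; exact: saturated_Ex.
  - by move=> x; rewrite lee_fin ltW.
  - by move=> i x; rewrite lee_fin ltW.
  - by move=> i; apply: aeW.
  - by move=> i x [/= h _]; rewrite Ex_cst ltW.
have nA : {homo A : i j / (i <= j)%N >-> (i <= j)%O}.
  move=> i j ij; apply/subsetPset => x [k _ h]; exists (k + (j - i))%N => //=.
  by rewrite [X in Ex X _ _](_ : _ = (i%:Z - k%:Z))//; lia.
have cA : (mu (A N) @[N --> \oo] --> mu (\bigcup_N A N))%E.
  by apply: nondecreasing_cvg_mu => //; exact: bigcupT_measurable.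
have cA' : ((c%:E * mu (A N)) @[N --> \oo] --> (c%:E * mu (\bigcup_N A N)))%E.
  exact: cvgeZl.
rewrite -(cvg_lim _ cA')//; apply: lime_le; last exact: nearW.
by apply/cvg_ex; exists (c%:E * mu (\bigcup_N A N))%E.
Qed.

(** The values of [v] up to [c / 2] add at most [c / 2] to any average, so the maximal function of
    the remaining part still exceeds [c / 2]. *)
Lemma maxf_weak_trunc (v : T -> R) (c : R) : 0 < c -> mfun v -> (forall x, 0 <= v x) ->
  (c%:E * mu [set x | (c%:E < maxf (EFin \o v) x)%E] <=
   2%:E * \int[mu]_x (if (c < 2 * v x)%R then v x else 0)%:E)%E.
Proof.
move=> c0 mv v0; pose v1 x : \bar R := (if c < 2 * v x then v x else 0)%:E.
have mv1 : mfun v1.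
  apply/measurable_EFinP; apply: measurable_fun_ifT => //.
  by apply: measurable_fun_ltr => //; exact: measurable_funM.
have v10 x : (0 <= v1 x)%E by rewrite lee_fin; case: ifP.
have c20 : 0 < c / 2 by rewrite divr_gt0.
have H := maxf_weak c20 mv1 v10.
apply: (@le_trans _ _ (2%:E * ((c / 2)%:E * mu [set x | ((c / 2)%:E < maxf v1 x)%E]))%E); last first.
  by rewrite lee_wpmul2l// lee_fin.
rewrite muleA -EFinM mulrC divfK// lee_wpmul2l ?lee_fin ?(ltW c0)//.
apply: le_measure; rewrite ?inE.
- rewrite -[X in measurable X]setTI; apply: emeasurable_fun_o_infty => //; exact: measurable_maxf.
- rewrite -[X in measurable X]setTI; apply: emeasurable_fun_o_infty => //; exact: measurable_maxf.
move=> x /= /maxf_gt [g cg]; apply: lt_le_trans (Ex_maxf g _ _).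
have : (Ex g (EFin \o v) x <= Ex g v1 x + (c / 2)%:E)%E.
  rewrite -(Ex_cst g (c / 2)%:E x) -ExD//; last by move=> y _; rewrite lee_fin ltW.
  apply: Ex_le => y _; first by rewrite lee_fin.
  rewrite /= /v1 -EFinD lee_fin.
  case: ifPn; first by rewrite lerDl ltW.
  by rewrite -leNgt add0r ler_pdivlMr// mulrC.
move=> /(lt_le_trans cg); rewrite -lteBlDr//.
by rewrite -EFinB [X in X%:E](_ : _ = c / 2)//; lra.
Qed.

(** Marcinkiewicz interpolation on dyadic levels: the weak bound at level [c] involves only the
    points with [c < 2 * v x], and the sum of [c ^ (t - 1)] over these levels is geometric because
    [t > 1]. *)
Lemma maximal_theorem (t : R) : 1 < t -> exists C : R, 0 <= C /\ forall v : T -> R,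
  mfun v -> (forall x, 0 <= v x) ->
  (\int[mu]_x poweR (maxf (EFin \o v) x) t <= C%:E * \int[mu]_x (v x `^ t)%:E)%E.
Proof.
move=> t1; have t0 : 0 < t by rewrite (lt_trans _ t1).
have t10 : 0 < t - 1 by rewrite subr_gt0.
have [K [K0 HK]] : exists K : R, 0 <= K /\ forall e a : R, 0 < e -> 0 <= a ->
    (\sum_(j <oo) (if (e * 2 ^+ j < a)%R then (e * 2 ^+ j) `^ (t - 1) else 0)%:E <= (K * a `^ (t - 1))%:E)%E.
  exists (2 `^ (t - 1) / (2 `^ (t - 1) - 1)); split; last by move=> e a e0 a0; exact: dyadic_series_le.
  by rewrite divr_ge0 ?powR_ge0// subr_ge0 powR2_ge1// ltW.
(* The factors are 2 from the weak bound, [2 ^ t] from rounding up to a dyadic level, [K] from the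
   geometric sum and [2 ^ (t - 1)] from the cutoff at [2 * v]. *)
exists (2 * 2 `^ t * K * 2 `^ (t - 1)); split; first by rewrite !mulr_ge0 ?powR_ge0.
move=> v mv v0; set u := maxf (EFin \o v).
have mu_ : mfun u by exact: measurable_maxf.
have u0 x : (0 <= u x)%E.
  by apply: le_trans (Ex_maxf 0 _ _); apply: Ex_ge0 => y _; rewrite lee_fin.
pose A (c : R) : set T := [set x | (c%:E < u x)%E].
have mset c : measurable (A c).
  by rewrite -[X in measurable X]setTI; exact: emeasurable_fun_o_infty.
(* The lowest level; as it tends to 0, the sets [A (e N)] exhaust the points with [u > 0]. *)
pose e N : R := 2 ^- N.
have e0 N : 0 < e N by rewrite invr_gt0 exprn_gt0.
pose h N x : \bar R := ((\1_(A (e N)) x)%:E * poweR (u x) t)%E.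
apply: (@ge0_integral_sup_le _ _ _ mu _ h).
- move=> N; apply: emeasurable_funM.
    by apply/measurable_EFinP; exact: measurable_indic.
  exact: measurable_poweR2.
- by move=> N x; rewrite mule_ge0 ?lee_fin ?poweR_ge0.
- move=> x i j ij; rewrite lee_wpmul2r ?poweR_ge0// lee_fin !indicE.
  have [|//] := boolP (x \in A _); rewrite inE /= => ei.
  rewrite mem_set//=; apply: le_lt_trans ei; rewrite lee_fin.
  by rewrite lef_pV2 ?posrE ?exprn_gt0// ler_weXn2l// ler1n.
- move=> N; rewrite /h integral_indic_mul.
  pose c j : R := e N * 2 ^+ j; have c0 j : 0 < c j by rewrite mulr_gt0 ?exprn_gt0.
  pose tm j x : \bar R := (if ((c j)%:E < u x)%E then (2 * c j) `^ t else 0)%:E.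
  have tmE j x : tm j x = (((2 * c j) `^ t)%:E * (\1_(A (c j)) x)%:E)%E.
    rewrite /tm indicE -EFinM; congr _%:E; case: ifPn => h1; first by rewrite mem_set ?mulr1.
    by rewrite memNset ?mulr0//; apply/negP.
  have mtm j : mfun (tm j).
    rewrite (funext (tmE j)); apply: emeasurable_funM => //.
    by apply/measurable_EFinP; exact: measurable_indic.
  have tm0 j x : (0 <= tm j x)%E by rewrite lee_fin; case: ifP => _; rewrite ?powR_ge0.
  pose ph j x : \bar R := (2 * 2 `^ t * v x * (if c j < 2 * v x then c j `^ (t - 1) else 0))%:E.
  have ph0 j x : (0 <= ph j x)%E.
    by rewrite lee_fin !mulr_ge0 ?powR_ge0//; case: ifP => _; rewrite ?powR_ge0.
  have mif j (d : R) : mfun (fun x => if c j < 2 * v x then d else 0).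
    apply: measurable_fun_ifT => //.
    by apply: measurable_fun_ltr => //; exact: measurable_funM.
  have mph j : mfun (ph j).
    apply/measurable_EFinP; apply: measurable_funM => //; exact: measurable_funM.
  apply: (@le_trans _ _ (\int[mu]_x \sum_(j <oo) tm j x)%E).
    rewrite -integral_indic_mul; apply: ge0_integral_le => x _.
      by rewrite mule_ge0 ?lee_fin ?poweR_ge0.
    rewrite indicE; have [|_] := boolP (x \in A _); last first.
      by rewrite mul0e; apply: nneseries_ge0 => j _ _; exact: tm0.
    by rewrite inE mul1e /= => ex; exact: dyadic_series_ge.
  apply: (@le_trans _ _ (\int[mu]_x \sum_(j <oo) ph j x)%E).
    apply: integral_eseries_le => // j.
    under eq_integral do rewrite tmE.
    rewrite ge0_integralZl//; last 2 first.
    + by apply/measurable_EFinP; exact: measurable_indic.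
    + by rewrite lee_fin powR_ge0.
    rewrite integral_indic// setIT.
    have -> : ((2 * c j) `^ t)%:E = ((2 `^ t * c j `^ (t - 1))%:E * (c j)%:E)%E.
      rewrite -EFinM powRM// ?(ltW (c0 j))// -mulrA; congr (_ * _)%:E.
      by rewrite mulrC mulr_powRB1// ltW.
    rewrite -muleA; apply: (@le_trans _ _ (((2 `^ t * c j `^ (t - 1))%:E * (2%:E * \int[mu]_x (if (c j < 2 * v x)%R then v x else 0)%:E)))%E).
      by rewrite lee_wpmul2l ?lee_fin ?mulr_ge0 ?powR_ge0//; exact: maxf_weak_trunc.
    rewrite muleA -EFinM -ge0_integralZl//; last 3 first.
    + apply/measurable_EFinP; apply: measurable_fun_ifT => //.
      by apply: measurable_fun_ltr => //; exact: measurable_funM.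
    + by move=> x _; rewrite lee_fin; case: ifP.
    + by rewrite lee_fin !mulr_ge0 ?powR_ge0.
    apply: ge0_integral_le => x _.
      by rewrite lee_fin !mulr_ge0 ?powR_ge0//; case: ifP.
    rewrite lee_fin le_eqVlt; apply/orP; left; apply/eqP.
    by case: ifP => _; ring.
  rewrite -ge0_integralZl//; last 3 first.
  + by apply/measurable_EFinP; exact: measurable_powR2.
  + by move=> x _; rewrite lee_fin powR_ge0.
  + by rewrite lee_fin !mulr_ge0 ?powR_ge0.
  apply: ge0_integral_le => x _; first by apply: nneseries_ge0 => j _ _; exact: ph0.
  rewrite /ph; under eq_eseriesr do rewrite EFinM.
  rewrite nneseriesZl; last by move=> j _; rewrite lee_fin; case: ifP => _; rewrite ?powR_ge0.
  have := HK (e N) (2 * v x) (e0 N); rewrite mulr_ge0// => /(_ isT) H.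
  apply: (@le_trans _ _ ((2 * 2 `^ t * v x)%:E * (K * (2 * v x) `^ (t - 1))%:E)%E).
    by rewrite lee_wpmul2l// lee_fin !mulr_ge0 ?powR_ge0.
  rewrite -EFinM lee_fin powRM// le_eqVlt; apply/orP; left; apply/eqP.
  by rewrite -(mulr_powRB1 (v0 x) t0); ring.
- by move=> x; exact: poweR_ge0.
- move=> x; have [|ux] := leP (u x) 0%E.
    move=> ux; have -> : u x = 0%E by apply/eqP; rewrite eq_le ux u0.
    rewrite poweR0r ?gt_eqF//; apply: le_trans (ereal_sup_ubound _); last by exists 0%N.
    by rewrite mule_ge0 ?lee_fin ?poweR_ge0.
  have [N HN] : exists N, ((e N)%:E < u x)%E.
    have [r [r0 ru]] : exists r : R, 0 < r /\ (r%:E < u x)%E.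
      case: (u x) ux => [a| |] //.
      - by rewrite lte_fin => a0; exists (a / 2); rewrite lte_fin; split; lra.
      - by move=> _; exists 1; split=> //; exact: ltry.
    exists (Num.truncn r^-1).+1; apply: le_lt_trans ru; rewrite lee_fin /e.
    rewrite invf_ple ?posrE ?exprn_gt0//; apply: ltW; apply: lt_le_trans (truncnS_gt _) _.
    by rewrite -natrX ler_nat ltnW// ltn_expl.
  apply: le_trans (ereal_sup_ubound _); last by exists N.
  by rewrite /h indicE mem_set// mul1e.
Qed.

(** * Jensen's inequality and fractional averages *)

Lemma Ex_affine g (c d : R) (phi : T -> R) x : 0 <= c -> 0 <= d -> mfun phi ->
  (forall y, 0 <= phi y) ->
  (Ex g (fun y => (c + d * phi y)%:E) x = c%:E + d%:E * Ex g (EFin \o phi) x)%E.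
Proof.
move=> c0 d0 mphi phi0.
have mE : mfun (EFin \o phi) by exact/measurable_EFinP.
transitivity (Ex g (fun y => cst c%:E y + (d%:E * (EFin \o phi) y))%E x); first by [].
rewrite ExD//.
- by rewrite Ex_cst ExZ//= => y _; rewrite lee_fin.
- exact: emeasurable_funM.
- by move=> y _; rewrite lee_fin mulr_ge0.
Qed.

(** Integrating [young1] for [v / d] gives the bound [d] once the moment is at most [d ^ a]. The
    division asks for [d > 0], while [c] may vanish; hence the limit through [c + e]. *)
Lemma Ex_jensen g (v : T -> R) x (a c : R) : mfun v -> (forall y, 0 <= v y) -> 1 <= a -> 0 <= c ->
  (Ex g (fun y => (v y `^ a)%:E) x <= (c `^ a)%:E)%E -> (Ex g (EFin \o v) x <= c%:E)%E.
Proof.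
move=> mv v0; rewrite le_eqVlt => /predU1P[<-|a1] c0 H.
  rewrite -(powRr1 c0); apply: le_trans H; apply: Ex_le => y _; rewrite /= lee_fin//.
  by rewrite powRr1.
have a0 : 0 < a by rewrite (lt_trans _ a1).
have key d : 0 < d -> c <= d -> (Ex g (EFin \o v) x <= d%:E)%E.
  move=> d0 cd.
  have H' : (Ex g (fun y => (v y `^ a)%:E) x <= (d `^ a)%:E)%E.
    by apply: le_trans H _; rewrite lee_fin ge0_ler_powR ?nnegrE ?(ltW a0) ?(ltW d0).
  have da0 : 0 < d `^ a by rewrite powR_gt0.
  apply: (@le_trans _ _ (Ex g (fun y => (d * (1 - a^-1) + d / a / d `^ a * (v y `^ a))%:E) x)).
    apply: Ex_le => y _; rewrite /= lee_fin//.
    have := @young1 R (v y / d) a; rewrite divr_ge0 ?(ltW d0)// => /(_ isT a1).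
    rewrite ler_pdivrMr//; move/le_trans; apply; rewrite le_eqVlt; apply/orP; left; apply/eqP.
    have dE : d^-1 `^ a = (d `^ a)^-1 by rewrite -[d^-1]powR_inv1 ?(ltW d0)// -powRrM mulN1r powRN.
    rewrite powRM ?invr_ge0 ?(ltW d0)// dE.
    by field; rewrite !gt_eqF.
  rewrite Ex_affine//.
  - apply: (@le_trans _ _ ((d * (1 - a^-1))%:E + (d / a / d `^ a)%:E * (d `^ a)%:E)%E).
      by rewrite leeD2l// lee_wpmul2l// lee_fin !divr_ge0 ?(ltW da0) ?(ltW d0) ?(ltW a0).
    rewrite -EFinM -EFinD lee_fin divfK ?gt_eqF// le_eqVlt; apply/orP; left; apply/eqP.
    by rewrite mulrBr mulr1 subrK.
  - by rewrite mulr_ge0 ?(ltW d0)// subr_ge0 invf_le1 ?ltW.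
  - by rewrite !divr_ge0 ?(ltW da0) ?(ltW d0) ?(ltW a0).
  - exact: measurable_powR2.
  - by move=> y; exact: powR_ge0.
apply/lee_addgt0Pr => e e0; rewrite -EFinD; apply: key; first by rewrite ltr_wpDl.
by rewrite lerDl ltW.
Qed.

(** The moment itself; its root is taken in [fracavg]. [fine] sends an infinite moment to 0, so
    upper bounds through [gmean] rely on a proof of finiteness. *)
Definition gmean (s : R) (f : T -> R) g x : R := fine (Ex g (fun y => (`|f y| `^ s)%:E) x).

Lemma gmean_ge0 s f g x : 0 <= gmean s f g x.
Proof. by rewrite fine_ge0// Ex_ge0// => y _; rewrite lee_fin powR_ge0. Qed.

Definition fracavg (be s : R) (f : T -> R) g x : R := vol g `^ be * gmean s f g x `^ s^-1.

Lemma fracavg_ge0 be s f g x : 0 <= fracavg be s f g x.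
Proof. by rewrite mulr_ge0 ?powR_ge0. Qed.

Lemma fracavg_inv be s f g : ball_inv g (fracavg be s f g).
Proof. by move=> x y xy; rewrite /fracavg /gmean (Ex_inv _ xy). Qed.

Definition fracmax (be s : R) (f : T -> R) x : \bar R :=
  ereal_sup (range (fun g : int => (fracavg be s f g x)%:E)).

Lemma fracmax_ge0 be s f x : (0 <= fracmax be s f x)%E.
Proof. by apply: le_trans (ereal_sup_ubound _); last (by exists 0); rewrite lee_fin fracavg_ge0. Qed.

Lemma Ex_powR_fin (s rho k : R) (f : T -> R) : 0 < s -> s <= rho -> mfun f ->
  (\int[mu]_x (`|f x| `^ rho)%:E <= k%:E)%E ->
  forall g x, (Ex g (fun y => (`|f y| `^ s)%:E) x)%E \is a fin_num.
Proof.
move=> s0 srho mf Hf g x.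
have maf : mfun (fun y => `|f y|) by exact: measurableT_comp.
rewrite ge0_fin_numE; last by apply: Ex_ge0 => y _; rewrite lee_fin powR_ge0.
pose u : \bar R := (1%:E + 1%:E * Ex g (EFin \o (fun y => (`|f y| `^ rho)%R)) x)%E.
apply: (@le_lt_trans _ _ u); rewrite /u.
  rewrite -Ex_affine//.
  - apply: Ex_le => y _; rewrite ?lee_fin ?powR_ge0// mul1r.
    have := @poweR_le_add1 R `|f y|%:E s rho; rewrite (ltW s0) srho lee_fin normr_ge0.
    by move=> /(_ isT isT isT).
  - exact: measurable_powR2.
rewrite mul1e lte_add_pinfty ?ltry// /Ex lte_mul_pinfty ?volV_ge0//.
apply: le_lt_trans (ltry k); apply: le_trans Hf.
rewrite -integral_indic_mul; apply: ge0_integral_le => y _; rewrite /= -EFinM lee_fin.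
  by rewrite mulr_ge0 ?powR_ge0.
by rewrite indicE; case: (y \in _); rewrite ?mul1r ?mul0r ?powR_ge0.
Qed.

(** Jensen's inequality multiplied by the volume; [c] is the average for which the conclusion would
    be an equality. *)
Lemma Ex_pow_vol (v : T -> R) (t k : R) g x : mfun v -> (forall y, 0 <= v y) -> 1 <= t ->
  (\int[mu]_y (v y `^ t)%:E <= k%:E)%E -> Ex g (EFin \o v) x \is a fin_num ->
  vol g * fine (Ex g (EFin \o v) x) `^ t <= k.
Proof.
move=> mv v0 t1 Hv fE; have t0 : 0 < t by rewrite (lt_le_trans _ t1).
have F0 : 0 <= fine (Ex g (EFin \o v) x) by rewrite fine_ge0// Ex_ge0// => y _; rewrite lee_fin.
rewrite leNgt; apply/negP => h.
have k0 : 0 <= k.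
  by rewrite -lee_fin; apply: le_trans Hv; apply: integral_ge0 => y _; rewrite lee_fin powR_ge0.
pose c := (k / vol g) `^ t^-1.
have ct : c `^ t = k / vol g.
  by rewrite /c -powRrM mulVf ?gt_eqF// powRr1// divr_ge0// ltW// vol_gt0.
have : (Ex g (EFin \o v) x <= c%:E)%E.
  apply: (@Ex_jensen _ _ _ t) => //; first exact: powR_ge0.
  rewrite ct -(@lee_pmul2l _ (vol g)%:E) ?lte_fin ?vol_gt0// -int_ball -EFinM mulrCA divff ?vol_neq0// mulr1.
  apply: le_trans Hv; rewrite -integral_indic_mul; apply: ge0_integral_le => y _; rewrite /= -EFinM lee_fin.
    by rewrite mulr_ge0 ?powR_ge0.
  by rewrite indicE; case: (y \in _); rewrite ?mul1r ?mul0r ?powR_ge0.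
rewrite -(fineK fE) lee_fin => Fc; move: h; rewrite ltNge => /negP; apply.
rewrite mulrC -ler_pdivlMr ?vol_gt0// -ct.
by apply: ge0_ler_powR; rewrite ?nnegrE ?powR_ge0 ?(ltW t0).
Qed.

(** With [v = |f| ^ s] and [t = rho / s], the average of [v] serves as both [E] and [F] in
    [hedberg], which leaves a power of [maxf v]. The maximal theorem applies since [s < rho] means
    [t > 1]. *)
Lemma fracmax_const (s rho theta be k : R) : 0 < s -> s < rho -> 0 < theta -> 0 <= be ->
  theta^-1 = rho^-1 - be -> 0 <= k -> exists C : R, 0 <= C /\ forall f : T -> R,
  mfun f -> (\int[mu]_x (`|f x| `^ rho)%:E <= k%:E)%E ->
  (\int[mu]_x poweR (fracmax be s f x) theta <= C%:E)%E.
Proof.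
move=> s0 srho th0 be0 thE k0; have rho0 : 0 < rho by exact: lt_trans srho.
pose t := rho / s; have t1 : 1 < t by rewrite /t ltr_pdivlMr// mul1r.
have t0 : 0 < t by rewrite (lt_trans _ t1).
have [C [C0 HC]] := maximal_theorem t1.
exists (k `^ (be * theta) * (C * k)); split; first by rewrite !mulr_ge0 ?powR_ge0.
move=> f mf Hf.
have maf : mfun (fun y => `|f y|) by exact: measurableT_comp.
pose v y := `|f y| `^ s.
have mv : mfun v by exact: measurable_powR2.
have v0 y : 0 <= v y by exact: powR_ge0.
have fE g x : Ex g (EFin \o v) x \is a fin_num.
  exact: (@Ex_powR_fin s rho k f s0 (ltW srho) mf Hf g x).
have vt y : v y `^ t = `|f y| `^ rho by rewrite /v -powRrM /t mulrCA divff ?gt_eqF// mulr1.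
have Hv : (\int[mu]_y (v y `^ t)%:E <= k%:E)%E.
  by under eq_integral do rewrite vt.
apply: (@le_trans _ _ (\int[mu]_x ((k `^ (be * theta))%:E * poweR (maxf (EFin \o v) x) t))%E); last first.
  rewrite ge0_integralZl ?lee_fin ?powR_ge0//; last 2 first.
  - by apply: measurable_poweR2 => //; exact: measurable_maxf.
  - by move=> x _; exact: poweR_ge0.
  rewrite EFinM lee_wpmul2l ?lee_fin ?powR_ge0//; apply: le_trans (HC v mv v0) _.
  by rewrite EFinM lee_wpmul2l ?lee_fin.
apply: ge0_integral_le => x _; first exact: poweR_ge0.
have ke : (0 <= (k `^ (be * theta))%:E :> \bar R)%E by rewrite lee_fin powR_ge0.
apply: poweR_sup_le => //.
- by rewrite mule_ge0 ?poweR_ge0.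
- by move=> g; rewrite lee_fin fracavg_ge0.
- move=> g; have F0 : 0 <= fine (Ex g (EFin \o v) x).
    by rewrite fine_ge0// Ex_ge0// => y _; rewrite lee_fin.
  apply: (@le_trans _ _ ((k `^ (be * theta))%:E * (fine (Ex g (EFin \o v) x) `^ t)%:E)%E); last first.
    apply: lee_wpmul2l => //; rewrite -poweR_EFin (fineK (fE g x)).
    apply: poweR_le; [exact: ltW|by apply: Ex_ge0 => y _; rewrite lee_fin|exact: Ex_maxf].
  rewrite poweR_EFin -EFinM lee_fin.
  apply: (@hedberg R theta rho be s t (vol g) (gmean s f g x)) => //.
  + exact: vol_gt0.
  + by rewrite /t divfK ?gt_eqF// divff ?gt_eqF// powRr1.
  + by apply: Ex_pow_vol => //; exact: ltW.
- exact: fracmax_ge0.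
Qed.

(** * Comparison of nearby exponents *)

Definition origin : T := fun _ => Qp0 p.

(** Comparable to [max(1, |y|) ^ -(n+1)]. Written with ball indicators, its integral is the
    geometric series of [p ^ -i]. *)
Definition decay y : \bar R :=
  (\sum_(i <oo) (((p%:R ^+ n.+1) ^- i)%:E * (\1_(qp_ball origin i%:Z : set T) y)%:E))%E.

Lemma decay_term_ge0 i y :
  (0 <= ((p%:R ^+ n.+1) ^- i)%:E * (\1_(qp_ball origin i%:Z : set T) y)%:E :> \bar R)%E.
Proof. by rewrite mule_ge0 ?lee_fin ?invr_ge0 ?exprn_ge0. Qed.

Lemma decay_ge0 y : (0 <= decay y)%E.
Proof. by apply: nneseries_ge0 => i _ _; exact: decay_term_ge0. Qed.

Lemma measurable_decay_term i : mfun (fun y : T =>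
  ((p%:R ^+ n.+1) ^- i)%:E * (\1_(qp_ball origin i%:Z : set T) y)%:E : \bar R)%E.
Proof.
apply: emeasurable_funM => //; apply/measurable_EFinP; apply: measurable_indic.
exact: measurable_qp_ball.
Qed.

Lemma measurable_decay : mfun decay.
Proof.
apply: ge0_emeasurable_sum; first by move=> i x _ _; exact: decay_term_ge0.
by move=> i _; exact: measurable_decay_term.
Qed.

Lemma integral_decay : (\int[mu]_y decay y <= 2%:E)%E.
Proof.
rewrite integral_nneseries//; last by move=> i; exact: measurable_decay_term.
have I i : (\int[mu]_y (((p%:R ^+ n.+1) ^- i)%:E * (\1_(qp_ball origin i%:Z : set T) y)%:E) = (p%:R ^- i)%:E)%E.
  have mB : measurable (qp_ball origin i%:Z : set T) by exact: measurable_qp_ball.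
  rewrite ge0_integralZl//; last by apply/measurable_EFinP; exact: measurable_indic.
  rewrite integral_indic// setIT mu_ball -EFinM; congr _%:E.
  rewrite /vol -PoszM -exprnP -exprM mulSn exprD invfM -mulrA mulVf ?mulr1//.
  by rewrite expf_neq0// gt_eqF// p_gt0R.
apply: nneseries_le => [i|m]; first by rewrite I lee_fin invr_ge0 exprn_ge0.
under eq_bigr do rewrite I; rewrite sumEFin lee_fin.
have H : \sum_(i < m) (p%:R ^- i : R) <= 2 - 2 ^- m * 2.
  elim: m => [|m IH]; first by rewrite big_ord0 expr0 invr1 mul1r subrr.
  rewrite big_ord_recr /=; apply: le_trans (lerD IH (_ : _ <= 2 ^- m)) _.
    by rewrite lef_pV2 ?posrE ?exprn_gt0 ?p_gt0R//; apply: lerXn2r; rewrite ?nnegrE ?ler0n ?ler_nat.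
  rewrite exprS invfM mulrAC mulVf// mul1r; move: (2 ^- m) => e; lra.
by apply: le_trans H _; rewrite gerBl mulr_ge0// invr_ge0 exprn_ge0.
Qed.

(* An exponent that deviates from [w] by at most [C2 / (1 + log_p |y|)] may be
   replaced by [w]: either [a] is below the decay rate [|y|^-(n+1)], or
   [a ^ (u - w)] is bounded. *)
Lemma pow_decay (y : T) (u w C2 a : R) : 1 <= u -> 1 <= w -> 0 <= C2 ->
  (forall i : nat, ~ qp_ball origin i%:Z y -> `|u - w| * i.+1%:R <= C2) -> 0 <= a <= 1 ->
  ((a `^ u)%:E <= ((p%:R `^ (n.+1%:R * C2)) * a `^ w)%:E + decay y)%E.
Proof.
move=> u1 w1 C20 H /andP[a0 a1].
have pR1 : 1 <= p%:R :> R by rewrite ltW// p_gt1R.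
set k := p%:R `^ _.
have K1 : 1 <= k by rewrite -[leLHS](powRr0 p%:R); apply: ler_powR => //; rewrite mulr_ge0.
have k0 : 0 < k by exact: lt_le_trans K1.
pose Pm i := `[< qp_ball origin i%:Z y >].
have exP : exists i, Pm i by have [i Bi] := qp_ball_exit origin y; exists i; apply/asboolP.
case: (ex_minnP exP) => m /asboolP Bm minm.
have dm : (((p%:R ^+ n.+1) ^- m)%:E <= decay y)%E.
  apply: (le_trans _ (nneseries_ge m _)) => [|j]; last exact: decay_term_ge0.
  by rewrite indicE mem_set// mule1.
have u0 : 0 < u by exact: lt_le_trans u1.
have [am|am] := leP a ((p%:R ^+ n.+1) ^- m).
  have aua : a `^ u <= a.
    have [->|an0] := eqVneq a 0; first by rewrite powR0 ?gt_eqF.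
    by apply: ge1r_powR => //; rewrite a1 andbT lt_neqAle eq_sym an0.
  apply: (@le_trans _ _ (decay y)).
    by apply: le_trans dm; rewrite lee_fin (le_trans aua).
  by rewrite leeDr// lee_fin mulr_ge0 ?powR_ge0 ?(ltW k0).
have a_gt0 : 0 < a by apply: le_lt_trans am; rewrite invr_ge0 exprn_ge0.
apply: (@le_trans _ _ (k * a `^ w)%:E); last by rewrite leeDl// decay_ge0.
rewrite lee_fin; have [wu|uw] := leP w u.
  apply: (@le_trans _ _ (a `^ w)); first by apply: ger_powR => //; rewrite a_gt0.
  by rewrite ler_peMl ?powR_ge0.
(* For [m = 0] the threshold is 1, which [a] does not exceed. Otherwise minimality puts [y] outside
   the ball of index [m - 1], where [H] applies with weight [m]. *)
case: m Bm minm dm am => [|m] Bm minm dm am; first by move: am; rewrite expr0 invr1 ltNge a1.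
have nB : ~ qp_ball origin m%:Z y by move=> /asboolP /minm; rewrite ltnn.
have := H m nB; rewrite distrC gtr0_norm ?subr_gt0// => Hm.
have -> : w = (w - u) + u by rewrite subrK.
rewrite powRD; last by rewrite (gt_eqF a_gt0) implybT.
rewrite mulrA ler_peMl ?powR_ge0//.
rewrite -ler_pdivrMl// mulr1.
apply: (@le_trans _ _ (((p%:R ^+ n.+1) ^- m.+1) `^ (w - u))); last first.
  by apply: ge0_ler_powR; rewrite ?nnegrE ?invr_ge0 ?exprn_ge0 ?subr_ge0 ?(ltW uw) ?(ltW a_gt0) ?(ltW am).
rewrite -exprM -powR_invn// -powRrM /k -powRN; apply: ler_powR => //.
rewrite mulNr lerN2 natrM -mulrA ler_wpM2l//.
by rewrite mulrC.
Qed.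

(** As [(vol g)^-1 = p ^ (- n * g)], an oscillation of order [1 / (- g)] in the exponent costs a
    bounded factor. *)
Lemma vol_pow_osc g (m M C1 : R) : g < 0 -> m <= M -> (M - m) * (- g)%:~R <= C1 ->
  (vol g)^-1 `^ (M - m) <= p%:R `^ (n%:R * C1).
Proof.
move=> g0 mM h; rewrite volE -powRN -powRrM; apply: ler_powR; first exact/ltW/p_gt1R.
rewrite -mulrN -mulrA ler_wpM2l//; apply: le_trans h.
by rewrite mulrC intrN.
Qed.

Lemma maxcomm_ge0 (al : R) (b f : T -> R) x : (0 <= qp_maxcomm mu al b f x)%E.
Proof.
apply: le_trans (ereal_sup_ubound _); last by exists 0.
rewrite mule_ge0 ?lee_fin ?powR_ge0//; apply: integral_ge0 => y _.
by rewrite lee_fin mulr_ge0.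
Qed.

(** * The John-Nirenberg inequality *)

Section BMO.
Variable b : T -> R.
Hypothesis bloc : qp_locally_integrable mu b.

Lemma measurable_loc : mfun b.
Proof.
apply/measurable_EFinP; rewrite -(qp_ball_cover (fun _ => Qp0 p : Qp p)).
apply/measurable_fun_bigcup; first by move=> i; exact: measurable_qp_ball.
by move=> i; exact: (measurable_int _ (bloc _ _)).
Qed.

Definition avg g x : R := qp_avg mu b (qp_ball x g).

Lemma avg_inv g : ball_inv g (avg g).
Proof. by move=> x y xy; rewrite /avg (qp_ball_eq xy). Qed.

Lemma measurable_avg g : mfun (avg g).
Proof. exact: ball_inv_measurable (@avg_inv g). Qed.

Definition dev (m : R) y : \bar R := (`|b y - m|)%:E.

Lemma measurable_dev m : mfun (dev m).
Proof.
by apply/measurable_EFinP; apply: measurableT_comp => //; apply: measurable_funB => //; exact: measurable_loc.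
Qed.

Lemma dev_ge0 m y : (0 <= dev m y)%E. Proof. by rewrite lee_fin. Qed.

Lemma avg_dist g x m : ((`|avg g x - m|)%:E <= Ex g (dev m) x)%E.
Proof.
set B := qp_ball x g; have mB : measurable (B : set T) by exact: measurable_qp_ball.
have iB := bloc x g.
have im : mu.-integrable B (cst m%:E).
  apply/integrableP; split; first exact: measurable_cst.
  by rewrite integral_cst// mu_ball /= -EFinM ltry.
have fI : (\int[mu]_(y in B) (b y)%:E)%E \is a fin_num by exact: integrable_fin_num.
have E : (\int[mu]_(y in B) ((b y - m)%:E) = (vol g * (avg g x - m))%:E)%E.
  transitivity (\int[mu]_(y in B) ((EFin \o b) y - (cst m%:E) y))%E; first by [].
  rewrite integralB// integral_cst// mu_ball.
  rewrite /avg /qp_avg mu_ball -/B -[X in (X - _)%E](fineK fI) /=.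
  by rewrite -EFinD; congr _%:E; field; exact: vol_neq0.
rewrite -(@lee_pmul2l _ (vol g)%:E) ?lte_fin ?vol_gt0// -int_ball.
have -> : ((vol g)%:E * (`|avg g x - m|)%:E = `|\int[mu]_(y in B) ((b y - m)%:E)|)%E.
  by rewrite E -EFinM /= normrM (gtr0_norm (vol_gt0 g)).
apply: le_trans (le_abse_integral _ _ _) _ => //.
by apply: measurable_funTS; apply/measurable_EFinP; apply: measurable_funB => //; exact: measurable_loc.
Qed.

(* The supremum over the smaller balls makes [osc] survive stopping: the truncated
   moments of [osc] satisfy [D <= a + D / 2]. *)
Definition osc N y : \bar R := maxe (dev (avg N y) y)
  (ereal_sup (range (fun i : nat => (`|avg (N - i%:Z) y - avg N y|)%:E))).

Lemma osc_ge0 N y : (0 <= osc N y)%E.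
Proof. by rewrite le_max dev_ge0. Qed.

Lemma measurable_osc N : mfun (osc N).
Proof.
have ma := measurable_avg.
apply: measurable_maxe.
  apply/measurable_EFinP; apply: measurableT_comp => //; apply: measurable_funB => //.
  exact: measurable_loc.
apply: measurable_ereal_sup => i; apply/measurable_EFinP.
by apply: measurableT_comp => //; exact: measurable_funB.
Qed.

Lemma osc_dev N y : (dev (avg N y) y <= osc N y)%E.
Proof. by rewrite le_max lexx. Qed.

Lemma osc_avg N y g : g <= N -> ((`|avg g y - avg N y|)%:E <= osc N y)%E.
Proof.
move=> gN; rewrite le_max; apply/orP; right; apply: ereal_sup_ubound.
exists `|N - g|%N => //; by rewrite intdistK.
Qed.

Lemma osc_le N y c : (dev (avg N y) y <= c)%E ->
  (forall i : nat, (`|avg (N - i%:Z) y - avg N y|)%:E <= c)%E -> (osc N y <= c)%E.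
Proof.
by move=> h1 h2; rewrite ge_max h1; apply: ge_ereal_sup => _ [i _ <-].
Qed.

Variable K : R.
Hypothesis bmoK : forall x g, (Ex g (dev (avg g x)) x <= K%:E)%E.

(** Truncation at [L] makes the supremum [D] of all moments finite, so that it can be absorbed. Stop
    at the largest balls where [|b - m|] has average above [lam]: almost everywhere outside them
    [osc] is at most [lam]; inside, it exceeds the oscillation on the stopped ball by at most [del];
    and their total measure is a small fraction of the ball. *)
Lemma john_nirenberg_trunc (s : R) : 0 < s -> exists C : R, 0 <= C /\ forall (L : nat) N x,
  (Ex N (fun y => poweR (mine (osc N y) L%:R%:E) s) x <= C%:E)%E.
Proof.
(* This [lam] makes [2 ^ s * mu U] at most half the volume of the ball; [del] is [lam] times the
   doubling constant. *)
move=> s0; pose lam : R := 2 * 2 `^ s * (`|K| + 1); pose del : R := p%:R ^+ n * lam.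
have r0 : 0 < 2 `^ s :> R by rewrite powR_gt0.
have K1 : 0 < `|K| + 1 :> R by rewrite ltr_wpDl.
have lam0 : 0 < lam by rewrite /lam !mulr_gt0.
have pn1 : 1 <= p%:R ^+ n :> R by rewrite exprn_ege1// ltW// p_gt1R.
have lamdel : lam <= del by rewrite /del ler_peMl// ltW.
have del0 : 0 < del by apply: lt_le_trans lamdel.
have Klam : K <= lam.
  apply: (@le_trans _ _ (`|K| + 1)); first by rewrite (le_trans (ler_norm _))// lerDl.
  rewrite /lam ler_peMl ?(ltW K1)// mulr_ege1 ?ler1n//.
  by rewrite powR2_ge1// ltW.
(* The solution of [D <= lam ^ s + (D + del ^ s) / 2]. *)
pose C := 2 * lam `^ s + del `^ s.
exists C; split; first by rewrite addr_ge0 ?mulr_ge0 ?powR_ge0.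
move=> L.
pose F N y : \bar R := poweR (mine (osc N y) L%:R%:E) s.
have F0 N y : (0 <= F N y)%E by exact: poweR_ge0.
have mF N : mfun (F N).
  by apply: measurable_poweR2 => //; apply: measurable_mine => //; exact: measurable_osc.
pose S := [set Ex w.1 (F w.1) w.2 | w in [set: int * T]].
pose D := ereal_sup S.
have SD N x : (Ex N (F N) x <= D)%E by apply: ereal_sup_ubound; exists (N, x).
have DL : (D <= (L%:R `^ s)%:E)%E.
  apply: ge_ereal_sup => _ [[N x] _ <-] /=.
  rewrite -[leRHS](Ex_cst N _ x); apply: Ex_le => y _ //=.
  rewrite -poweR_EFin; apply: poweR_le; rewrite ?(ltW s0)//.
    by rewrite le_min osc_ge0 lee_fin ?ler0n ?(ltW lam0).
  by rewrite ge_min lexx orbT.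
have D0 : (0 <= D)%E.
  by apply: le_trans (SD 0 (fun _ => Qp0 p : Qp p)); exact: Ex_ge0.
have fD : D \is a fin_num by rewrite ge0_fin_numE// (le_lt_trans DL)// ltry.
suff H N x : (Ex N (F N) x <= (lam `^ s + (fine D + del `^ s) / 2)%:E)%E.
  have : (D <= (lam `^ s + (fine D + del `^ s) / 2)%:E)%E.
    by apply: ge_ereal_sup => _ [[N x] _ <-]; exact: H.
  rewrite -[leLHS](fineK fD) lee_fin => HD N x; apply: le_trans (SD N x) _.
  by rewrite -(fineK fD) lee_fin /C; move: HD; clear; lra.
pose P : set T := qp_ball x N; have mP : measurable P by exact: measurable_qp_ball.
pose m := avg N x.
have mE y : P y -> avg N y = m by move=> Py; rewrite /m (avg_inv Py).
pose Cs (i : nat) : set T := P `&` [set y | (lam%:E < Ex (N - i%:Z) (dev m) y)%E].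
have sC i : saturated (N - i%:Z) (Cs i).
  apply: saturatedI; last exact: saturated_Ex.
  by apply: (@saturated_le _ N); [exact: subz_le|exact: saturated_ball].
have mC i := measurable_saturated (sC i).
pose U := \bigcup_i Cs i; have mU : measurable U by exact: bigcupT_measurable.
have UP : U `<=` P by move=> y [i _ []].
have volN : mu P = (vol N)%:E by rewrite mu_ball.
pose A := (2 `^ s * (fine D + del `^ s))%R.
have A0 : 0 <= A by rewrite mulr_ge0 ?powR_ge0 ?addr_ge0 ?powR_ge0 ?fine_ge0.
have E1 : (\int[mu]_(y in P `\` U) F N y <= (lam `^ s * vol N)%:E)%E.
  apply: (@le_trans _ _ (\int[mu]_(y in P `\` U) cst (lam `^ s)%:E y)%E).
    apply: ae_ge0_le_integral => //.
    - exact: measurableD.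
    - exact: measurable_funTS.
    - by move=> y _; rewrite lee_fin powR_ge0.
    have := @lebesgue_le N (dev m) (measurable_dev m) (dev_ge0 m).
    apply: filterS => y Hy [Py nU].
    have Hg g : g <= N -> (Ex g (dev m) y <= lam%:E)%E.
      move=> gN; rewrite leNgt; apply/negP => K'; apply: nU; exists `|N - g|%N => //; split=> //=.
      by rewrite intdistK.
    rewrite /F -poweR_EFin; apply: poweR_le; rewrite ?(ltW s0)//.
      by rewrite le_min osc_ge0 lee_fin ?ler0n ?(ltW lam0).
    rewrite ge_min; apply/orP; left; apply: osc_le; rewrite mE//.
      by apply: Hy; rewrite ?(ltW lam0).
    by move=> i; apply: le_trans (avg_dist _ _ _) _; apply: Hg; exact: subz_le.
  rewrite integral_cst; last exact: measurableD.
  rewrite EFinM lee_wpmul2l ?lee_fin ?powR_ge0// -volN; apply: le_measure; rewrite ?inE//.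
  exact: measurableD.
have E2 : (\int[mu]_(y in U) F N y <= A%:E * mu U)%E.
  rewrite -integral_cst//.
  apply: (@stopping_le N Cs _ _ (fun i y => (2 `^ s)%:E * (F (N - i%:Z)%R y + (del `^ s)%:E))%E) => //.
  - by move=> i; apply: emeasurable_funM => //; exact: emeasurable_funD.
  - by move=> i y; rewrite mule_ge0 ?adde_ge0 ?lee_fin ?powR_ge0.
  - move=> i; apply: aeW => y [[Py /= iy] nCy].
    have Hj (j : nat) : (j < i)%N -> (Ex (N - j%:Z) (dev m) y <= lam%:E)%E.
      move=> ji; rewrite leNgt; apply/negP => K'; apply: nCy.
      by rewrite -bigcup_mkord; exists j.
    (* At scale [N] the average of [|b - m|] is at most [K <= lam], so the whole ball is never
       selected and a stopped ball has a parent that was not. *)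
    case: i iy nCy Hj => [|i] iy nCy Hj.
      exfalso; move: iy; rewrite subr0 -(mE _ Py) ltNge => /negP; apply.
      by apply: le_trans (bmoK _ _) _; rewrite lee_fin.
    have di : (Ex (N - i.+1%:Z) (dev m) y <= del%:E)%E.
      apply: le_trans (ExS _ _ _ _) _; [exact: measurable_dev|exact: dev_ge0|].
      rewrite /del EFinM lee_wpmul2l ?lee_fin ?exprn_ge0//.
      by rewrite subzS; exact: Hj.
    have ai : `|avg (N - i.+1%:Z) y - m| <= del.
      by rewrite -lee_fin; exact: le_trans (avg_dist _ _ _) di.
    apply: (@le_trans _ _ (poweR (mine (osc (N - i.+1%:Z) y) L%:R%:E + del%:E)%E s)); last first.
      rewrite -poweR_EFin; apply: poweR_add_le; rewrite ?lee_fin ?(ltW s0) ?(ltW del0)//.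
      by rewrite le_min osc_ge0 lee_fin ?ler0n ?(ltW lam0).
    apply: poweR_le; rewrite ?(ltW s0)//; first by rewrite le_min osc_ge0 lee_fin ?ler0n ?(ltW lam0).
    have oscdel : (osc N y <= osc (N - i.+1%:Z) y + del%:E)%E.
      apply: osc_le; rewrite mE//.
        apply: (@le_trans _ _ (dev (avg (N - i.+1%:Z) y) y + del%:E)%E); last by rewrite leeD2r// osc_dev.
        rewrite -EFinD lee_fin; apply: le_trans (lerD (lexx _) ai).
        exact: ler_distD.
      (* Larger balls than the stopped one have average at most [lam]; the others are seen by the
         oscillation on the stopped ball. *)
      move=> j; have [ji|ij] := ltnP j i.+1.
        apply: le_trans (avg_dist _ _ _) _; apply: (le_trans (Hj _ ji)).
        by apply: (@le_trans _ _ del%:E); rewrite ?lee_fin// leeDr// osc_ge0.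
      apply: (@le_trans _ _ ((`|avg (N - j%:Z) y - avg (N - i.+1%:Z) y|)%:E + del%:E)%E).
        rewrite -EFinD lee_fin; apply: le_trans (lerD (lexx _) ai).
        exact: ler_distD.
      by rewrite leeD2r//; apply: osc_avg; exact: subz_le2.
    case: (leP (osc (N - i.+1%:Z) y) L%:R%:E) => h.
      by rewrite ge_min oscdel.
    by rewrite ge_min; apply/orP; right; rewrite -EFinD lee_fin lerDl ltW.
  - move=> i y _; rewrite Ex_cst.
    have s0e : (0 <= (2 `^ s)%:E :> \bar R)%E by rewrite lee_fin powR_ge0.
    have d0e : (0 <= (del `^ s)%:E :> \bar R)%E by rewrite lee_fin powR_ge0.
    rewrite ExZ//; last 2 first.
      exact: emeasurable_funD.
      by move=> z _; exact: adde_ge0.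
    rewrite ExD// (Ex_cst _ (del `^ s)%:E) /A EFinM EFinD (fineK fD).
    by apply: lee_wpmul2l => //; rewrite leeD2r.
have E3 : (lam%:E * mu U <= (`|K| * vol N)%:E)%E.
  rewrite -integral_cst//.
  apply: (@le_trans _ _ (\int[mu]_(y in U) dev m y)%E).
    apply: (@stopping_le N Cs _ _ (fun=> cst lam%:E)) => //.
    - by move=> y; rewrite lee_fin ltW.
    - exact: measurable_dev.
    - exact: dev_ge0.
    - by move=> i y; rewrite lee_fin ltW.
    - by move=> i; exact: aeW.
    - by move=> i y [[_ /= h] _]; rewrite Ex_cst ltW.
  apply: (@le_trans _ _ (\int[mu]_(y in P) dev m y)%E).
    apply: ge0_subset_integral => //; first by apply: measurable_funTS; exact: measurable_dev.
    by move=> y _; exact: dev_ge0.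
  rewrite int_ball muleC EFinM lee_wpmul2r ?lee_fin ?(ltW (vol_gt0 _))//.
  by apply: le_trans (bmoK _ _) _; rewrite lee_fin ler_norm.
have E4 : (A%:E * mu U <= ((fine D + del `^ s) / 2 * vol N)%:E)%E.
  have -> : A%:E = ((A / lam)%:E * lam%:E)%E by rewrite -EFinM divfK// gt_eqF.
  rewrite -muleA; apply: (@le_trans _ _ ((A / lam)%:E * (`|K| * vol N)%:E)%E).
    by rewrite lee_wpmul2l// lee_fin divr_ge0// ltW.
  rewrite -EFinM lee_fin mulrA ler_pM2r ?vol_gt0//.
  have fD0 : 0 <= fine D + del `^ s by rewrite addr_ge0 ?powR_ge0 ?fine_ge0.
  have -> : A / lam = (fine D + del `^ s) / 2 / (`|K| + 1).
    by rewrite /A /lam; field; rewrite !gt_eqF.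
  by rewrite mulrAC ler_pdivrMr// ler_wpM2l ?divr_ge0// lerDl.
have : (\int[mu]_(y in P) F N y <= (vol N)%:E * (lam `^ s + (fine D + del `^ s) / 2)%:E)%E.
  rewrite -(setDUK UP) ge0_integral_setU//; last 3 first.
  - exact: measurableD.
  - exact: measurable_funTS.
  - by rewrite disj_set2E setDIK.
  rewrite addeC -EFinM mulrDr EFinD; apply: leeD; first by rewrite mulrC.
  by apply: le_trans E2 _; rewrite [X in (_ <= X%:E)%E]mulrC.
by rewrite int_ball lee_pmul2l// lte_fin vol_gt0.
Qed.

(** The truncated bound is uniform in [L], and [L] tends to infinity by monotone convergence. *)
Lemma john_nirenberg (s : R) : 0 < s -> exists C : R, 0 <= C /\ forall N x,
  (Ex N (fun y => poweR (osc N y) s) x <= C%:E)%E.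
Proof.
move=> s0; have [C [C0 HC]] := john_nirenberg_trunc s0; exists C; split=> // N x.
rewrite -(@lee_pmul2l _ (vol N)%:E) ?lte_fin ?vol_gt0// -int_ball.
rewrite -integral_indic_mul.
apply: (@ge0_integral_sup_le _ _ _ mu _
  (fun L y => (\1_(qp_ball x N : set T) y)%:E * poweR (mine (osc N y) L%:R%:E) s))%E.
- move=> L; apply: emeasurable_funM.
    by apply/measurable_EFinP; apply: measurable_indic; exact: measurable_qp_ball.
  by apply: measurable_poweR2 => //; apply: measurable_mine => //; exact: measurable_osc.
- by move=> L y; rewrite mule_ge0 ?poweR_ge0 ?lee_fin.
- move=> y i j ij; rewrite lee_wpmul2l ?lee_fin//; apply: poweR_le; rewrite ?(ltW s0)//.
    by rewrite le_min osc_ge0 lee_fin ler0n.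
  by rewrite le_min !ge_min lexx /= lee_fin ler_nat ij orbT.
- by move=> L; rewrite integral_indic_mul int_ball lee_pmul2l ?lte_fin ?vol_gt0.
- by move=> y; rewrite mule_ge0 ?poweR_ge0 ?lee_fin.
- move=> y; rewrite indicE; case: (y \in _); last first.
    by rewrite mul0e; apply: le_trans (ereal_sup_ubound _); last (by exists 0%N); rewrite mul0e.
  rewrite mul1e; have := osc_ge0 N y; case oE : (osc N y) => [r| |] // r0.
    apply: le_trans (ereal_sup_ubound _); last (exists (Num.truncn r).+1 => //); rewrite mul1e.
    by rewrite min_l// lee_fin ltW// truncnS_gt.
  rewrite poweRyr ?gt_eqF// leye_eq; apply/eqP/eqyP => A A0.
  have [i Ai] := powR_unbounded s0 A0.
  apply: le_trans (ereal_sup_ubound _); last by exists i.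
  by rewrite mul1e min_r ?leey// poweR_EFin lee_fin.
Qed.

(** * The weights of the commutator and their level sets *)

Lemma Ex_mulinv g (w phi : T -> \bar R) x : ball_inv g w -> (forall y, 0 <= w y)%E ->
  mfun phi -> (forall y, 0 <= phi y)%E ->
  (Ex g (fun y => w y * phi y) x = w x * Ex g phi x)%E.
Proof.
move=> iw w0 mphi phi0; rewrite -ExZ//.
by apply: eq_Ex => y xy; rewrite (iw _ _ xy).
Qed.

Definition wt (C0 : R) g x : R := `|b x - avg g x| + C0.

(** Moving from the average at scale [g] to one over a smaller ball costs one more [osc g x], so a
    single [osc] bounds the weights of all smaller balls. *)
Lemma wt_osc C0 g h x : h <= g -> ((wt C0 h x)%:E <= 2%:E * osc g x + C0%:E)%E.
Proof.
move=> hg; rewrite /wt EFinD leeD2r//.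
apply: (@le_trans _ _ ((`|b x - avg g x|)%:E + (`|avg h x - avg g x|)%:E)%E).
  by rewrite -EFinD lee_fin [`|avg h x - _|]distrC; exact: ler_distD.
rewrite -[2]/(1 + 1) EFinD ge0_muleDl// !mul1e; apply: leeD; first exact: osc_dev.
exact: osc_avg.
Qed.

Lemma measurable_wt C0 g : mfun (wt C0 g).
Proof.
have ma := @measurable_avg g.
apply: measurable_funD => //; apply: measurableT_comp => //.
by apply: measurable_funB => //; exact: measurable_loc.
Qed.

Lemma wt_ge0 C0 g x : 0 <= C0 -> 0 <= wt C0 g x.
Proof. by move=> C00; rewrite addr_ge0. Qed.

(* The hypothesis on [q] says that [c ^ q] is comparable to its average on the
   balls where [G > c]; this is how a variable exponent is admitted. *)
Lemma commutator_level (C0 q0 q1 k : R) : 0 <= C0 -> 0 < q0 -> 0 <= k ->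
  exists C : R, 0 <= C /\ forall N (G : nat -> T -> R) (q : T -> R) (e : R), 0 < e ->
  mfun q -> (forall x, q0 <= q x <= q1) ->
  (forall i : nat, ball_inv (N - i%:Z) (G i)) -> (forall i x, 0 <= G i x) ->
  (forall i j : nat, {ae mu, forall y, e * 2 ^+ j < G i y ->
     (((e * 2 ^+ j) `^ q y)%:E <= k%:E * Ex (N - i%:Z) (fun z => ((e * 2 ^+ j) `^ q z)%:E) y)%E}) ->
  (\int[mu]_x poweR (ereal_sup (range (fun i : nat =>
       (if (e < G i x)%R then wt C0 (N - i%:Z)%R x * G i x else 0)%:E))) (q x) <=
   C%:E * \int[mu]_x poweR (ereal_sup (range (fun i => (G i x)%:E))) (q x))%E.
Proof.
move=> C00 q00 k0.
have [q01|q10] := leP q0 q1; last first.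
  exists 0; split=> // N G q e _ _ /(_ (fun _ => Qp0 p : Qp p)) /andP[h1 h2].
  by move: (le_trans h1 h2); rewrite leNgt q10.
have q1_0 : 0 < q1 by exact: lt_le_trans q01.
have [CJ [CJ0 HJ]] := john_nirenberg q1_0.
(* A bound for the average of [1 + (2 * osc + C0) ^ q1], which dominates [(2 * osc + C0) ^ q x] for
   all exponents [q x <= q1]. *)
pose CH : R := 1 + 2 `^ q1 * (2 `^ q1 * CJ + C0 `^ q1).
have CH0 : 0 <= CH by rewrite addr_ge0 ?mulr_ge0 ?addr_ge0 ?mulr_ge0 ?powR_ge0.
have [K0 [K00 HK0]] : exists K0 : R, 0 <= K0 /\ forall (e : R) (u : \bar R) t', 0 < e -> (0 <= u)%E -> q0 <= t' ->
  (\sum_(j <oo) (if ((e * 2 ^+ j)%:E < u)%E then (e * 2 ^+ j) `^ t' else 0)%R%:E <= K0%:E * poweR u t')%E.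
  exists (2 `^ q0 / (2 `^ q0 - 1)); split; first exact/ltW/dyadic_const_gt0.
  by move=> e u t' e0 u0 qt; exact: dyadic_eseries_le.
exists (2 `^ q1 * (k * CH) * K0); split; first by rewrite !mulr_ge0 ?powR_ge0.
move=> N G q e e0 mq hq iG G0 hG.
have q0x x : 0 < q x by have /andP[h _] := hq x; exact: lt_le_trans h.
have mG i : mfun (G i) by exact: ball_inv_measurable (iG i).
pose c j : R := e * 2 ^+ j; have c0 j : 0 < c j by rewrite mulr_gt0 ?exprn_gt0.
pose V i x := wt C0 (N - i%:Z) x.
have V0 i x : 0 <= V i x by exact: wt_ge0.
have mV i : mfun (V i) by exact: measurable_wt.
pose W i x : \bar R := (2%:E * osc (N - i%:Z)%R x + C0%:E)%E.
have W0 i x : (0 <= W i x)%E by rewrite adde_ge0 ?mule_ge0 ?osc_ge0 ?lee_fin.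
have mW i : mfun (W i).
  by apply: emeasurable_funD => //; apply: emeasurable_funM => //; exact: measurable_osc.
pose Gs x : \bar R := ereal_sup (range (fun i => (G i x)%:E)).
have mGs : mfun Gs.
  by apply: measurable_ereal_sup => i; apply/measurable_EFinP.
have Gs0 x : (0 <= Gs x)%E.
  by apply: le_trans (ereal_sup_ubound _); last (by exists 0%N); rewrite lee_fin.
(* All weights selected at level [c j], not only the one of the largest ball. *)
pose S j x : \bar R := ereal_sup (range (fun i => (if c j < G i x then V i x else 0)%:E)).
have S0 j x : (0 <= S j x)%E.
  by apply: le_trans (ereal_sup_ubound _); last (by exists 0%N); rewrite lee_fin; case: ifP.
have mS j : mfun (S j).
  apply: measurable_ereal_sup => i; apply/measurable_EFinP; apply: measurable_fun_ifT => //.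
  exact: measurable_fun_ltr.
have mcq j : mfun (fun x => (c j `^ q x)%:E).
  by apply/measurable_EFinP; exact: measurable_powR2.
have cq0 j x : (0 <= (c j `^ q x)%:E)%E by rewrite lee_fin powR_ge0.
pose F j x : \bar R := ((c j `^ q x)%:E * poweR (S j x) (q x))%E.
have F0 j x : (0 <= F j x)%E by rewrite mule_ge0 ?poweR_ge0.
have mF j : mfun (F j) by apply: emeasurable_funM => //; exact: measurable_poweR2.
pose A j : set T := [set x | ((c j)%:E < Gs x)%E].
have mA j : measurable (A j).
  by rewrite -[X in measurable X]setTI; exact: emeasurable_fun_o_infty.
pose Cs j i : set T := [set x | c j < G i x].
have AE j : A j = \bigcup_i Cs j i.
  apply/seteqP; split=> x.
    by move/ereal_sup_gt => [_ [i _ <-]]; rewrite lte_fin => h; exists i.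
  by move=> [i _ h]; apply: (@lt_le_trans _ _ (G i x)%:E); [rewrite lte_fin|apply: ereal_sup_ubound; exists i].
have sC j i : saturated (N - i%:Z) (Cs j i) by move=> x y xy; rewrite /Cs /= (iG i _ _ xy).
(* On a stopped ball every selected radius is at most the stopped one, so [S j <= W i]. The factor
   [c j ^ q] is replaced there by its average [w i], which is constant on the ball and factors out
   of the moment of [W i]. *)
have E1 j : (\int[mu]_(x in A j) F j x <= \int[mu]_(x in A j) ((k * CH * c j `^ q x)%:E))%E.
  pose H i x : \bar R := (1 + poweR (W i x) q1)%E.
  have H0 i x : (0 <= H i x)%E by rewrite adde_ge0 ?poweR_ge0.
  have mH i : mfun (H i) by apply: emeasurable_funD => //; exact: measurable_poweR2.
  have EH i x : (Ex (N - i%:Z) (H i) x <= CH%:E)%E.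
    rewrite /H ExD//; last 2 first.
    - exact: measurable_poweR2.
    - by move=> *; exact: poweR_ge0.
    rewrite (Ex_cst _ 1%E) /CH EFinD leeD2l//.
    have mo : mfun (fun y => poweR (osc (N - i%:Z) y) q1).
      by apply: measurable_poweR2 => //; exact: measurable_osc.
    apply: (@le_trans _ _ (Ex (N - i%:Z) (fun y => (2 `^ q1)%:E * ((2 `^ q1)%:E * poweR (osc (N - i%:Z)%R y) q1 + (C0 `^ q1)%:E))%E x)).
      apply: Ex_le => y _; first exact: poweR_ge0.
      apply: le_trans (poweR_add_le _ _ _) _; rewrite ?(ltW q1_0) ?mule_ge0 ?osc_ge0 ?lee_fin//.
      by rewrite poweRM ?osc_ge0.
    have pe (r : R) : (0 <= (r `^ q1)%:E :> \bar R)%E by rewrite lee_fin powR_ge0.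
    have m1 : mfun (fun y => (2 `^ q1)%:E * poweR (osc (N - i%:Z)%R y) q1)%E.
      exact: emeasurable_funM.
    rewrite ExZ//; last 2 first.
      exact: emeasurable_funD.
      by move=> y _; rewrite adde_ge0 ?mule_ge0 ?poweR_ge0.
    rewrite ExD//; last by move=> y _; rewrite mule_ge0 ?poweR_ge0.
    rewrite (Ex_cst _ (C0 `^ q1)%:E) ExZ//; last by move=> y _; exact: poweR_ge0.
    rewrite EFinM EFinD EFinM; apply: lee_wpmul2l => //; rewrite leeD2r//.
    by apply: lee_wpmul2l => //; exact: HJ.
  pose w i := Ex (N - i%:Z) (fun z => (c j `^ q z)%:E).
  have w0 i x : (0 <= w i x)%E by exact: Ex_ge0.
  have ke : (0 <= k%:E :> \bar R)%E by rewrite lee_fin.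
  rewrite AE; apply: (@stopping_le N (Cs j) _ _ (fun i x => k%:E * (w i x * H i x))%E) => //.
  - apply/measurable_EFinP; apply: measurable_funM => //; exact: measurable_powR2.
  - by move=> x; rewrite lee_fin !mulr_ge0 ?powR_ge0.
  - move=> i; apply: emeasurable_funM => //; apply: emeasurable_funM => //; exact: measurable_Ex.
  - by move=> i x; rewrite mule_ge0// mule_ge0.
  - move=> i; apply: filterS (hG i j) => x hx [/= cG nC].
    rewrite muleA; apply: lee_pmul; rewrite ?poweR_ge0//; first exact: hx.
    have /andP[_ qx1] := hq x.
    apply: le_trans (poweR_le_add1 (ltW (q0x x)) qx1 (S0 _ _)) _.
    rewrite leeD2l//; apply: poweR_le; rewrite ?(ltW q1_0)//.
    apply: ge_ereal_sup => _ [i' _ <-]; case: ifPn => [ci'|_]; last exact: W0.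
    apply: wt_osc; apply: subz_le2; rewrite leqNgt; apply/negP => ii'; apply: nC.
    by rewrite -bigcup_mkord; exists i'.
  - move=> i x _; rewrite ExZ//; last 2 first.
      by apply: emeasurable_funM => //; exact: measurable_Ex.
      by move=> y _; rewrite mule_ge0.
    rewrite Ex_mulinv//; last exact: Ex_inv.
    rewrite (_ : (fun x0 => _) = (fun x0 => (k * CH)%:E * (c j `^ q x0)%:E)%E); last first.
      by apply/funext => y; rewrite -EFinM.
    rewrite ExZ//; last by rewrite lee_fin mulr_ge0.
    rewrite [leRHS](_ : _ = (k%:E * (CH%:E * w i x))%E); last first.
      by rewrite (muleA k%:E CH%:E (w i x)) -EFinM.
    apply: lee_wpmul2l => //.
    by rewrite muleC; apply: lee_wpmul2r.
have E2 j : (\int[mu]_x F j x = \int[mu]_(x in A j) F j x)%E.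
  rewrite -[RHS]integral_indic_mul; apply: eq_integral => x _; rewrite indicE.
  have [_|nA] := boolP (x \in A j); first by rewrite mul1e.
  rewrite mul0e /F (_ : S j x = 0%E) ?poweR0r ?mule0 ?gt_eqF//.
  apply/eqP; rewrite eq_le S0 andbT; apply: ge_ereal_sup => _ [i _ <-].
  rewrite ifF//; apply/negP => h; move/negP: nA; apply; rewrite inE AE; by exists i.
have q21 : (0 <= (2 `^ q1)%:E :> \bar R)%E by rewrite lee_fin powR_ge0.
have mFs : mfun (fun x => \sum_(j <oo) F j x)%E.
  by apply: ge0_emeasurable_sum => //.
apply: (@le_trans _ _ (\int[mu]_x ((2 `^ q1)%:E * \sum_(j <oo) F j x))%E).
  apply: ge0_integral_le => x _; first exact: poweR_ge0.
  have f0 : (0 <= \sum_(j <oo) F j x)%E by apply: nneseries_ge0 => j _ _; exact: F0.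
  have a0 i : (0 <= (if e < G i x then V i x * G i x else 0)%:E)%E.
    by rewrite lee_fin; case: ifP => // _; rewrite mulr_ge0.
  apply: poweR_sup_le => //; first by rewrite mule_ge0.
    move=> i; case: ifPn => [eG|_]; last by rewrite poweR0r ?gt_eqF// mule_ge0.
    (* At the dyadic level just below [G i x], the product of weight and average is at most
       [2 * c j * S j x]. *)
    have [j [jG Gj]] := dyadic_level e0 eG.
    apply: (@le_trans _ _ ((2 `^ q1)%:E * F j x)%E); last first.
      by apply: lee_wpmul2l => //; apply: nneseries_ge.
    have VS : ((V i x)%:E <= S j x)%E by apply: ereal_sup_ubound; exists i => //; rewrite jG.
    have /andP[_ qx1] := hq x.
    apply: (@le_trans _ _ ((2 `^ q1)%:E * ((c j `^ q x)%:E * (V i x `^ q x)%:E))%E); last first.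
      apply: lee_wpmul2l => //; apply: lee_wpmul2l => //.
      by rewrite -poweR_EFin; apply: poweR_le; rewrite ?(ltW (q0x x)) ?lee_fin.
    have cV : 0 <= c j * V i x by apply: mulr_ge0 => //; exact: ltW.
    have VG : 0 <= V i x * G i x by exact: mulr_ge0.
    rewrite poweR_EFin -!EFinM lee_fin.
    apply: (@le_trans _ _ ((2 * (c j * V i x)) `^ q x)).
      apply: ge0_ler_powR; [exact: ltW|by rewrite nnegrE|by rewrite nnegrE mulr_ge0|].
      rewrite mulrA [leLHS]mulrC; apply: ler_wpM2r; first exact: (V0 i x).
      by apply: le_trans Gj _; rewrite /c mulrCA -exprS.
    rewrite (powRM _ _ cV)// (powRM _ (ltW (c0 j)))//.
    apply: ler_wpM2r; first by apply: mulr_ge0; exact: powR_ge0.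
    by apply: ler_powR => //; rewrite ler1n.
  by apply: le_trans (a0 0%N) _; apply: ereal_sup_ubound; exists 0%N.
rewrite ge0_integralZl//; last by move=> x _; apply: nneseries_ge0 => j _ _; exact: F0.
rewrite -mulrA EFinM -muleA; apply: lee_wpmul2l => //.
rewrite integral_nneseries//.
apply: (@le_trans _ _ (\sum_(j <oo) \int[mu]_x ((k * CH)%:E * (if ((c j)%:E < Gs x)%E then c j `^ q x else 0)%:E))%E).
  apply: lee_nneseries => j _; first by move=> _; apply: integral_ge0 => x _; exact: F0.
  rewrite E2; apply: le_trans (E1 j) _.
  rewrite -integral_indic_mul; apply: ge0_integral_le => x _.
    by rewrite mule_ge0 ?lee_fin// !mulr_ge0 ?powR_ge0.
  rewrite indicE; case: ifPn => h; first by rewrite mem_set// mul1e -EFinM.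
  by rewrite memNset ?mul0e ?mule0//; apply/negP.
have mif j : mfun (fun x => (if ((c j)%:E < Gs x)%E then c j `^ q x else 0)%:E).
  apply/measurable_EFinP; apply: measurable_fun_ifT => //.
    apply: (measurable_fun_bool true); rewrite setTI.
    by rewrite (_ : _ @^-1` _ = A j).
  exact: measurable_powR2.
have if0 j x : (0 <= (if ((c j)%:E < Gs x)%E then c j `^ q x else 0)%:E)%E.
  by rewrite lee_fin; case: ifP => _; rewrite ?powR_ge0.
have kCH : (0 <= (k * CH)%:E :> \bar R)%E by rewrite lee_fin mulr_ge0.
rewrite -integral_nneseries//; last 2 first.
- by move=> j; exact: emeasurable_funM.
- by move=> j x _; rewrite mule_ge0.
rewrite [(k * CH * K0)%:E]EFinM -[leRHS]muleA -ge0_integralZl//; last 2 first.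
- exact: measurable_poweR2.
- by move=> x _; exact: poweR_ge0.
rewrite -ge0_integralZl//; last 2 first.
- by apply: emeasurable_funM => //; exact: measurable_poweR2.
- by move=> x _; rewrite mule_ge0 ?poweR_ge0 ?lee_fin.
apply: ge0_integral_le => x _; first by apply: nneseries_ge0 => j _ _; rewrite mule_ge0.
rewrite nneseriesZl//; apply: lee_wpmul2l => //.
by apply: HK0 => //; have /andP[] := hq x.
Qed.

Definition commsup (C0 : R) (G : int -> T -> R) x : \bar R :=
  ereal_sup (range (fun g : int => (wt C0 g x * G g x)%:E)).

Lemma measurable_commsup C0 (G : int -> T -> R) : (forall g, ball_inv g (G g)) ->
  mfun (commsup C0 G).
Proof.
move=> iG; apply: measurable_ereal_sup => g; apply/measurable_EFinP; apply: measurable_funM.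
  exact: measurable_wt.
exact: ball_inv_measurable (iG g).
Qed.

Lemma commsup_ge0 C0 G x : 0 <= C0 -> (forall g x, 0 <= G g x) -> (0 <= commsup C0 G x)%E.
Proof.
move=> C00 G0; apply: le_trans (ereal_sup_ubound _); last by exists 0.
by rewrite lee_fin mulr_ge0// wt_ge0.
Qed.

(** For a constant exponent the averaging hypothesis holds with [k = 1]. The lowest level [2 ^ -N]
    and the largest radius [p ^ N] are released together. *)
Lemma commutator_const (C0 t : R) : 0 <= C0 -> 0 < t -> exists C : R, 0 <= C /\
  forall G : int -> T -> R, (forall g, ball_inv g (G g)) -> (forall g x, 0 <= G g x) ->
  (\int[mu]_x poweR (commsup C0 G x) t <=
   C%:E * \int[mu]_x poweR (ereal_sup (range (fun g : int => (G g x)%:E))) t)%E.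
Proof.
move=> C00 t0; have [C [C0' HC]] := @commutator_level C0 t t 1 C00 t0 ler01.
exists C; split=> // G iG G0.
pose e N : R := 2 ^- N.
have e0 N : 0 < e N by rewrite invr_gt0 exprn_gt0.
pose u (N : nat) i x := if e N < G (N%:Z - i%:Z) x then wt C0 (N%:Z - i%:Z) x * G (N%:Z - i%:Z) x else 0.
have u0 N i x : (0 <= (u N i x)%:E)%E.
  by rewrite lee_fin /u; case: ifP => // _; rewrite mulr_ge0// wt_ge0.
have us0 N x : (0 <= ereal_sup (range (fun i => (u N i x)%:E)))%E.
  by apply: le_trans (u0 N 0%N x) _; apply: ereal_sup_ubound; exists 0%N.
have mG g : mfun (G g) by exact: ball_inv_measurable (iG g).
apply: (@ge0_integral_sup_le _ _ _ mu _ (fun N x => poweR (ereal_sup (range (fun i => (u N i x)%:E))) t)).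
- move=> N; apply: measurable_poweR2 => //; apply: measurable_ereal_sup => i.
  apply/measurable_EFinP; apply: measurable_fun_ifT => //; first exact: measurable_fun_ltr.
  by apply: measurable_funM => //; exact: measurable_wt.
- by move=> N x; exact: poweR_ge0.
- move=> x i j ij; apply: poweR_le => //; first exact: ltW.
  apply: ge_ereal_sup => _ [k _ <-]; apply: le_trans (ereal_sup_ubound _); last first.
    by exists (k + (j - i))%N.
  have -> : u i k x = if e i < G (i%:Z - k%:Z) x then wt C0 (i%:Z - k%:Z) x * G (i%:Z - k%:Z) x else 0 by [].
  rewrite /u (_ : j%:Z - (k + (j - i))%:Z = i%:Z - k%:Z); last by lia.
  case: ifPn => [eG|_]; last by rewrite lee_fin; case: ifP => // _; rewrite mulr_ge0// wt_ge0.
  rewrite ifT//; apply: le_lt_trans eG.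
  by rewrite lef_pV2 ?posrE ?exprn_gt0// ler_weXn2l// ler1n.
- move=> N; have := HC N%:Z (fun i => G (N%:Z - i%:Z)) (cst t) (e N) (e0 N).
  have tt (x : T) : t <= cst t x <= t by rewrite lexx.
  move=> /(_ (measurable_cst _) tt (fun i => iG _) (fun i => G0 _)) H.
  apply: le_trans (H _) _.
    move=> i j; apply: aeW => y _.
    by rewrite mul1e (Ex_cst _ ((e N * 2 ^+ j) `^ t)%:E).
  rewrite lee_wpmul2l ?lee_fin//; apply: ge0_integral_le => x _; first exact: poweR_ge0.
  apply: poweR_le; rewrite ?(ltW t0)//.
    by apply: le_trans (ereal_sup_ubound _); last (by exists 0%N); rewrite lee_fin.
  by apply: ge_ereal_sup => _ [i _ <-]; apply: ereal_sup_ubound; exists (N%:Z - i%:Z).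
- by move=> x; exact: poweR_ge0.
- move=> x; apply: poweR_sup_le => //.
  + by apply: le_trans (ereal_sup_ubound _); last (by exists 0%N); exact: poweR_ge0.
  + by move=> g; rewrite lee_fin mulr_ge0// wt_ge0.
  + move=> g; have [Gg|] := ltP 0 (G g x); last first.
      move=> Gg; have -> : G g x = 0 by apply/eqP; rewrite eq_le Gg G0.
      rewrite mulr0 poweR0r ?gt_eqF//.
      by apply: le_trans (ereal_sup_ubound _); last (by exists 0%N); exact: poweR_ge0.
    (* [N >= |g|] admits the radius, and [2 ^ -N] lies below [G g x]. *)
    pose N := (`|g| + (Num.truncn (G g x)^-1).+1)%N.
    have eN : e N < G g x.
      rewrite /e invf_plt ?posrE ?exprn_gt0//; apply: lt_le_trans (truncnS_gt _) _.
      rewrite -natrX ler_nat ltnW//; apply: leq_ltn_trans (ltn_expl N (isT : (1 < 2)%N)).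
      by rewrite /N leq_addl.
    apply: le_trans (ereal_sup_ubound _); last by exists N.
    apply: poweR_le; rewrite ?(ltW t0) ?lee_fin ?mulr_ge0 ?wt_ge0//.
    apply: ereal_sup_ubound; exists `|(N%:Z - g)%R|%N => //.
    by rewrite /u intdistK ?eN// /N; lia.
  + exact: commsup_ge0.
Qed.

(** Use [|b x - b y| <= |b x - m| + |b y - m|] and divide [|f|] by [A], a bound for its [s]-average.
    The sharp inequality [young1] keeps coefficient 1 on [|b x - m|]; [young_le] splits the other
    product into a moment of the oscillation and a moment of [f], whence [CJ + 1]. *)
Lemma maxcomm_le (s al : R) : 1 < s -> (0 < n)%N -> exists C0 : R, 0 <= C0 /\ forall f : T -> R,
  mfun f ->
  (forall g x, (Ex g (fun y => (`|f y| `^ s)%:E) x)%E \is a fin_num) ->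
  forall x, (qp_maxcomm mu al b f x <= commsup C0 (fracavg (al / n%:R) s f) x)%E.
Proof.
move=> s1 n0; have s0 : 0 < s by rewrite (lt_trans _ s1).
pose s' := (1 - s^-1)^-1.
have si1 : s^-1 < 1 by rewrite invf_lt1.
have s'0 : 0 < s' by rewrite invr_gt0 subr_gt0.
have ss : s^-1 + s'^-1 = 1 by rewrite /s' invrK addrC subrK.
have [CJ [CJ0 HJ]] := john_nirenberg s'0.
exists (CJ + 1); split; first by rewrite addr_ge0.
move=> f mf fE x; apply: ge_ereal_sup => _ [g _ <-].
apply: (@le_trans _ _ (wt (CJ + 1) g x * fracavg (al / n%:R) s f g x)%:E); last first.
  by apply: ereal_sup_ubound; exists g.
have maf : mfun (fun y => `|f y|) by exact: measurableT_comp.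
set m := avg g x; set d := `|b x - m|; set A0 := gmean s f g x `^ s^-1.
have A00 : 0 <= A0 by exact: powR_ge0.
have d0 : 0 <= d by exact: normr_ge0.
have mdv : mfun (fun y => `|b y - m| `^ s').
  apply: measurable_powR2 => //; apply: measurableT_comp => //; apply: measurable_funB => //.
  exact: measurable_loc.
(* The proof divides by [A], but [A0] may vanish; [A] tends to [A0] at the end. *)
have key A : 0 < A -> A0 <= A ->
    (Ex g (fun y => (`|b x - b y| * `|f y|)%:E) x <= (wt (CJ + 1) g x * A)%:E)%E.
  move=> A_gt0 A0A.
  have Es : (Ex g (fun y => (`|f y| `^ s)%:E) x <= (A `^ s)%:E)%E.
    rewrite -(fineK (fE g x)) lee_fin -/(gmean s f g x).
    rewrite -[leLHS](powRr1 (gmean_ge0 _ _ _ _)) -(mulVf (lt0r_neq0 s0)) powRrM.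
    by apply: ge0_ler_powR; rewrite ?nnegrE ?(ltW s0) ?(ltW A_gt0).
  have As0 : 0 < A `^ s by rewrite powR_gt0.
  pose c1 := A * d * (1 - s^-1); pose c2 := A * (d / s + 1) / A `^ s.
  have c10 : 0 <= c1 by rewrite mulr_ge0 ?mulr_ge0 ?(ltW A_gt0)// subr_ge0 ltW.
  have c20 : 0 <= c2 by rewrite !mulr_ge0 ?invr_ge0 ?(ltW A_gt0) ?(ltW As0)// addr_ge0// divr_ge0// ltW.
  apply: (@le_trans _ _ (Ex g (fun y => (c1 + c2 * (`|f y| `^ s))%:E + (A%:E * (`|b y - m| `^ s')%:E))%E x)).
    apply: Ex_le => y _; first by rewrite lee_fin mulr_ge0.
    rewrite -EFinM -EFinD lee_fin.
    pose w := `|f y| / A; have w0 : 0 <= w by rewrite divr_ge0// ltW.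
    have fw : `|f y| = A * w by rewrite /w mulrCA divff ?gt_eqF// mulr1.
    have fws : `|f y| `^ s = A `^ s * w `^ s by rewrite fw powRM// ltW.
    rewrite fws (_ : c2 * (A `^ s * w `^ s) = A * (d / s + 1) * w `^ s); last first.
      by rewrite /c2; field; rewrite gt_eqF//= gt_eqF.
    have t1 : `|b x - b y| <= d + `|b y - m| by rewrite /d [`|b y - m|]distrC; exact: ler_distD.
    apply: (@le_trans _ _ ((d + `|b y - m|) * `|f y|)); first by rewrite ler_wpM2r.
    rewrite fw.
    have y1 := @young1 R w s w0 s1.
    have y2 := @young_le R `|b y - m| w s s' (normr_ge0 _) w0 s1 ss.
    have -> : (d + `|b y - m|) * (A * w) = A * (d * w + `|b y - m| * w) by ring.
    have -> : c1 + A * (d / s + 1) * w `^ s + A * `|b y - m| `^ s' =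
              A * (d * (w `^ s / s + (1 - s^-1)) + (`|b y - m| `^ s' + w `^ s)) by rewrite /c1; ring.
    by rewrite ler_pM2l//; apply: lerD => //; apply: ler_wpM2l.
  have m1 : mfun (fun y => (c1 + c2 * (`|f y| `^ s))%:E).
    apply/measurable_EFinP; apply: measurable_funD => //; apply: measurable_funM => //.
    exact: measurable_powR2.
  rewrite ExD//; last 3 first.
  - by apply: emeasurable_funM => //; exact/measurable_EFinP.
  - by move=> y _; rewrite lee_fin addr_ge0// mulr_ge0// powR_ge0.
  - by move=> y _; rewrite mule_ge0 ?lee_fin ?powR_ge0// ltW.
  rewrite Ex_affine//; last exact: measurable_powR2.
  rewrite ExZ//; last 2 first.
  - exact/measurable_EFinP.
  - by rewrite lee_fin ltW.
  have EJ : (Ex g (fun y => (`|b y - m| `^ s')%:E) x <= CJ%:E)%E.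
    apply: le_trans (HJ g x); apply: Ex_le => y xy; first by rewrite lee_fin powR_ge0.
    rewrite -poweR_EFin; apply: poweR_le; rewrite ?(ltW s'0) ?lee_fin//.
    by rewrite /m (avg_inv xy); exact: osc_dev.
  apply: (@le_trans _ _ (c1%:E + c2%:E * (A `^ s)%:E + A%:E * CJ%:E)%E).
    apply: leeD.
      by rewrite leeD2l// lee_wpmul2l// lee_fin.
    by rewrite lee_wpmul2l// lee_fin ltW.
  rewrite -!EFinM -!EFinD lee_fin le_eqVlt; apply/orP; left; apply/eqP.
  by rewrite /wt -/m -/d /c1 /c2; field; rewrite gt_eqF//= gt_eqF.
have -> : (((p%:R : R) ^ (n%:Z * g)) `^ (al / n%:R - 1))%:E = ((vol g `^ (al / n%:R))%:E * ((vol g)^-1)%:E)%E.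
  rewrite -EFinM -/(vol g) powRD; first by rewrite powRN powRr1// ltW// vol_gt0.
  by rewrite vol_neq0 implybT.
rewrite -muleA -/(Ex g _ x) /fracavg mulrCA EFinM lee_wpmul2l ?lee_fin ?powR_ge0//.
rewrite -/A0; apply/lee_addgt0Pr => e e0.
pose c := wt (CJ + 1) g x; have c0 : 0 < c by rewrite /c /wt ltr_wpDl// ltr_wpDl.
have -> : ((c * A0)%:E + e%:E = (c * (A0 + e / c))%:E)%E.
  by rewrite -EFinD mulrDr mulrCA divff ?gt_eqF// mulr1.
apply: key; first by rewrite ltr_wpDl// divr_gt0.
by rewrite lerDl divr_ge0// ltW.
Qed.

(** * Variable exponents: the part of f with values at most 1 *)

Section Exponents.
Variables (be r0 r1 s C0 : R) (r q : T -> R).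
Hypothesis be0 : 0 < be.
Hypothesis s1 : 1 < s.
Hypothesis sr0 : s < r0.
Hypothesis r1be : r1 * be < 1.
Hypothesis rb : forall x, r0 <= r x <= r1.
Hypothesis mr : mfun r.
Hypothesis qE : forall x, q x = ((r x)^-1 - be)^-1.
Hypothesis C00 : 0 <= C0.
Let q0 := (r0^-1 - be)^-1.
Let q1 := (r1^-1 - be)^-1.

Lemma sobolev_le (u w : R) : 0 < u -> u <= w -> w * be < 1 ->
  0 < (u^-1 - be)^-1 /\ (u^-1 - be)^-1 <= (w^-1 - be)^-1 /\ u <= (u^-1 - be)^-1.
Proof.
move=> u0 uw wbe; have w0 : 0 < w by exact: lt_le_trans uw.
have wi : be < w^-1 by rewrite -[w^-1]mul1r ltr_pdivlMr// mulrC.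
have uwi : w^-1 <= u^-1 by rewrite lef_pV2.
have a0 : 0 < w^-1 - be by rewrite subr_gt0.
have b0 : 0 < u^-1 - be by rewrite (lt_le_trans a0)// lerD2r.
rewrite invr_gt0 b0; split=> //; split; first by rewrite lef_pV2// lerD2r.
by rewrite -[leLHS]invrK lef_pV2 ?posrE ?invr_gt0// lerBlDr lerDl ltW.
Qed.

Lemma s_gt0 : 0 < s. Proof. exact: lt_trans s1. Qed.
Lemma r0_gt0 : 0 < r0. Proof. by apply: lt_trans sr0; exact: s_gt0. Qed.
Lemma r0_gt1 : 1 < r0. Proof. exact: lt_trans sr0. Qed.
Lemma r0_le_r1 : r0 <= r1. Proof. by have /andP[h1 h2] := rb origin; exact: le_trans h2. Qed.
Lemma r_gt0 x : 0 < r x. Proof. by have /andP[h _] := rb x; apply: lt_le_trans h; exact: r0_gt0. Qed.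
Lemma rx_be x : r x * be < 1.
Proof. by have /andP[_ h] := rb x; apply: le_lt_trans r1be; rewrite ler_pM2r. Qed.
Lemma r0_be : r0 * be < 1.
Proof. by apply: le_lt_trans r1be; rewrite ler_pM2r// r0_le_r1. Qed.

Lemma q_bounds x : q0 <= q x <= q1.
Proof.
have /andP[h1 h2] := rb x; rewrite qE; apply/andP; split.
  by have [_ []] := sobolev_le r0_gt0 h1 (rx_be x).
by have [_ []] := sobolev_le (r_gt0 x) h2 r1be.
Qed.

Lemma q0_gt1 : 1 < q0.
Proof. by have [_ [_ h]] := sobolev_le r0_gt0 (lexx _) r0_be; apply: lt_le_trans h; exact: r0_gt1. Qed.
Lemma q0_gt0 : 0 < q0. Proof. exact: lt_trans q0_gt1. Qed.
Lemma q0_le_q1 : q0 <= q1. Proof. by have /andP[h1 h2] := q_bounds origin; exact: le_trans h2. Qed.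
Lemma q1_gt0 : 0 < q1. Proof. exact: lt_le_trans q0_gt0 q0_le_q1. Qed.
Lemma q_gt0 x : 0 < q x. Proof. by have /andP[h _] := q_bounds x; apply: lt_le_trans h; exact: q0_gt0. Qed.
Lemma q_gt1 x : 1 < q x. Proof. by have /andP[h _] := q_bounds x; apply: lt_le_trans h; exact: q0_gt1. Qed.
Lemma r_gt1 x : 1 < r x. Proof. by have /andP[h _] := rb x; apply: lt_le_trans h; exact: r0_gt1. Qed.

Lemma measurable_q : mfun q.
Proof.
have minv (u : T -> R) : mfun u -> (forall x, 0 < u x) -> mfun (fun x : T => (u x)^-1).
  move=> mu_ u0; rewrite (_ : (fun x => _) = (fun x => u x `^ (-1))); last first.
    by apply/funext => x; rewrite powR_inv1// ltW.
  exact: measurable_powR2.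
rewrite (funext qE); apply: (minv).
  have mi : mfun (fun x => (r x)^-1) by exact: minv mr r_gt0.
  exact: measurable_funB.
move=> x; rewrite -invr_gt0 -qE; exact: q_gt0.
Qed.

(** Here [m] is the Sobolev conjugate of [rho]: freezing [q] at [m] on a ball freezes [r] at
    [rho]. *)
Lemma dual_bounds (m : R) : q0 <= m -> let rho := (m^-1 + be)^-1 in
  [/\ r0 <= rho, 0 < rho & m^-1 = rho^-1 - be].
Proof.
move=> qm rho; have m0 : 0 < m by apply: lt_le_trans qm; exact: q0_gt0.
have rho0 : 0 < rho by rewrite invr_gt0 addr_gt0// invr_gt0.
split=> //; last by rewrite /rho invrK addrK.
rewrite -[r0]invrK /rho lef_pV2 ?posrE ?invr_gt0 ?r0_gt0 ?addr_gt0 ?invr_gt0//.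
rewrite -lerBrDr -[leRHS]invrK lef_pV2 ?posrE ?invr_gt0//.
by rewrite -invr_gt0 q0_gt0.
Qed.

Lemma dual_le_r (m : R) x : q0 <= m -> m <= q x -> (m^-1 + be)^-1 <= r x.
Proof.
move=> qm mq; have m0 : 0 < m by apply: lt_le_trans qm; exact: q0_gt0.
rewrite -[r x]invrK lef_pV2 ?posrE ?invr_gt0 ?r_gt0 ?addr_gt0 ?invr_gt0//.
rewrite -lerBlDr -[leLHS]invrK -qE lef_pV2 ?posrE//; exact: q_gt0.
Qed.

Variables (qinf C2 : R).
Hypothesis C20 : 0 <= C2.
Hypothesis qinfb : q0 <= qinf <= q1.
Hypothesis qdec : {ae mu, forall y, forall i : nat, ~ qp_ball origin i%:Z y -> `|q y - qinf| * i.+1%:R <= C2}.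
Let rinf := (qinf^-1 + be)^-1.

(** Passing from [q] to [r] does not increase distances: [r - rinf = (q - qinf) * (r / q) * (rinf /
    qinf)], where both quotients are at most 1. *)
Lemma rdec : {ae mu, forall y, forall i : nat, ~ qp_ball origin i%:Z y -> `|r y - rinf| * i.+1%:R <= C2}.
Proof.
apply: filterS qdec => y H i /H; apply: le_trans; rewrite ler_wpM2r//.
have /andP[qi0 qi1] := qinfb.
have qi_gt0 : 0 < qinf by apply: lt_le_trans qi0; exact: q0_gt0.
have ri0 : 0 < rinf by rewrite invr_gt0 addr_gt0// invr_gt0.
have rE : r y = ((q y)^-1 + be)^-1 by rewrite qE invrK subrK invrK.
have ry := r_gt0 y; have qy := q_gt0 y.
have -> : r y - rinf = (q y - qinf) * ((r y / q y) * (rinf / qinf)).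
  have e1 : (r y)^-1 = (q y)^-1 + be by rewrite rE invrK.
  have e2 : rinf^-1 = qinf^-1 + be by rewrite /rinf invrK.
  have : (r y)^-1 - rinf^-1 = (q y)^-1 - qinf^-1 by rewrite e1 e2; ring.
  move=> e3; have -> : r y - rinf = - (r y * rinf * ((r y)^-1 - rinf^-1)).
    by field; rewrite !gt_eqF.
  by rewrite e3; field; rewrite !gt_eqF.
have A0 : 0 <= r y / q y by exact: divr_ge0 (ltW ry) (ltW qy).
have B0 : 0 <= rinf / qinf by exact: divr_ge0 (ltW ri0) (ltW qi_gt0).
rewrite normrM ler_piMr// ger0_norm; last exact: mulr_ge0.
apply: mulr_ile1 => //.
- rewrite ler_pdivrMr// mul1r rE -[leRHS]invrK lef_pV2 ?posrE ?addr_gt0 ?invr_gt0//.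
  by rewrite lerDl ltW.
- rewrite ler_pdivrMr// mul1r /rinf -[leRHS]invrK lef_pV2 ?posrE ?addr_gt0 ?invr_gt0//.
  by rewrite lerDl ltW.
Qed.

(** Two constant exponents suffice. Where the supremum [S] exceeds 1, [S ^ q <= S ^ q1]; elsewhere
    [pow_decay] replaces [q] by [qinf]. On the input side, [|f| <= 1] gives [|f| ^ r1 <= |f| ^ r],
    and [pow_decay] handles [|f| ^ rinf]. *)
Lemma small_part : exists M : R, 0 <= M /\ forall f : T -> R, mfun f ->
  (forall x, `|f x| <= 1) -> (\int[mu]_x (`|f x| `^ r x)%:E <= 1)%E ->
  (\int[mu]_x poweR (commsup C0 (fracavg be s f) x) (q x) <= M%:E)%E.
Proof.
have /andP[qi0 qi1] := qinfb.
have qi_gt0 : 0 < qinf by apply: lt_le_trans qi0; exact: q0_gt0.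
have qi_ge1 : 1 <= qinf by apply: le_trans qi0; apply: ltW; exact: q0_gt1.
have [ri0 ri_gt0 riE] := dual_bounds qi0.
have ri_ge1 : 1 <= rinf by apply: le_trans ri0; apply: ltW; exact: r0_gt1.
pose k := p%:R `^ (n.+1%:R * C2) : R; have k0 : 0 <= k by exact: powR_ge0.
have ke : (0 <= k%:E :> \bar R)%E by rewrite lee_fin.
have r1_gt0 : 0 < r1 by apply: lt_le_trans r0_le_r1; exact: r0_gt0.
have sr1 : s < r1 by apply: lt_le_trans r0_le_r1.
have q1V : q1^-1 = r1^-1 - be by rewrite invrK.
have [C1 [C10 H1]] := commutator_const C00 q1_gt0.
have [F1 [F10 HF1]] := fracmax_const s_gt0 sr1 q1_gt0 (ltW be0) q1V ler01.
have [Ci [Ci0 Hi]] := commutator_const C00 qi_gt0.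
(* [k + 2] bounds the integral of [|f| ^ rinf]: [k] from the modular, 2 from [decay]. *)
have k20 : 0 <= k + 2 by rewrite addr_ge0.
have [Fi [Fi0 HFi]] := fracmax_const s_gt0 (lt_le_trans sr0 ri0) qi_gt0 (ltW be0) riE k20.
exists (C1 * F1 + (k * (Ci * Fi) + 2)); split.
  by rewrite addr_ge0 ?mulr_ge0// addr_ge0// !mulr_ge0.
move=> f mf f1 Hf; set S := commsup C0 _.
have iG g : ball_inv g (fracavg be s f g) by exact: fracavg_inv.
have G0 g x : 0 <= fracavg be s f g x by exact: fracavg_ge0.
have mS : mfun S by exact: measurable_commsup.
have S0 x : (0 <= S x)%E by exact: commsup_ge0.
have maf : mfun (fun y => `|f y|) by exact: measurableT_comp.
have B1 : (\int[mu]_x poweR (S x) q1 <= (C1 * F1)%:E)%E.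
  apply: le_trans (H1 _ iG G0) _; rewrite EFinM lee_wpmul2l ?lee_fin//; apply: HF1 => //.
  apply: le_trans Hf; apply: ge0_integral_le => x _; first by rewrite lee_fin powR_ge0.
  rewrite lee_fin; have [f0|f0] := eqVneq `|f x| 0.
    by rewrite f0 powR0 ?powR_ge0// gt_eqF.
  apply: ger_powR; first by rewrite f1 andbT lt_neqAle eq_sym f0 normr_ge0.
  by have /andP[] := rb x.
have B2 : (\int[mu]_x poweR (S x) qinf <= (Ci * Fi)%:E)%E.
  apply: le_trans (Hi _ iG G0) _; rewrite EFinM lee_wpmul2l ?lee_fin//; apply: HFi => //.
  apply: (@le_trans _ _ (\int[mu]_x (k%:E * (`|f x| `^ r x)%:E + decay x))%E).
    apply: ae_ge0_le_integral => //.
    - by apply/measurable_EFinP; exact: measurable_powR2.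
    - by move=> x _; rewrite adde_ge0 ?decay_ge0// mule_ge0 ?lee_fin ?powR_ge0.
    - apply: emeasurable_funD; last exact: measurable_decay.
      by apply: emeasurable_funM => //; apply/measurable_EFinP; exact: measurable_powR2.
    - apply: filterS rdec => x Hx _; rewrite -EFinM; apply: pow_decay => //.
      + exact/ltW/r_gt1.
      + by move=> i /Hx; rewrite distrC.
      + by rewrite normr_ge0 f1.
  have mp : mfun (fun x => (`|f x| `^ r x)%:E).
    by apply/measurable_EFinP; exact: measurable_powR2.
  rewrite ge0_integralD//; last 4 first.
  - by move=> x _; rewrite mule_ge0 ?lee_fin ?powR_ge0.
  - exact: emeasurable_funM.
  - by move=> x _; exact: decay_ge0.
  - exact: measurable_decay.
  rewrite EFinD; apply: leeD; last exact: integral_decay.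
  rewrite ge0_integralZl//.
  by rewrite -[leRHS]mule1; apply: lee_wpmul2l.
apply: (@le_trans _ _ (\int[mu]_x (poweR (S x) q1 + (k%:E * poweR (S x) qinf + decay x)))%E).
  apply: ae_ge0_le_integral => //.
  - by move=> x _; exact: poweR_ge0.
  - by apply: measurable_poweR2 => //; exact: measurable_q.
  - by move=> x _; rewrite adde_ge0 ?poweR_ge0// adde_ge0 ?decay_ge0// mule_ge0 ?poweR_ge0.
  - apply: emeasurable_funD; first exact: measurable_poweR2.
    apply: emeasurable_funD; last exact: measurable_decay.
    by apply: emeasurable_funM => //; exact: measurable_poweR2.
  - apply: filterS qdec => x Hx _; have [S1|S1] := leP (S x) 1%E; last first.
      apply: (@le_trans _ _ (poweR (S x) q1)); last first.
        by rewrite leeDl// adde_ge0 ?decay_ge0// mule_ge0 ?poweR_ge0.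
      have /andP[_ qx1] := q_bounds x.
      by apply: poweR_le_ge1 => //; exact: q1_gt0.
    apply: (@le_trans _ _ (k%:E * poweR (S x) qinf + decay x)%E); last by rewrite leeDr ?poweR_ge0.
    have fS : S x \is a fin_num by rewrite ge0_fin_numE// (le_lt_trans S1) ?ltry.
    move: (S0 x) S1; rewrite -(fineK fS) !lee_fin !poweR_EFin -EFinM => a0 a1.
    by apply: pow_decay => //; [exact/ltW/q_gt1|rewrite a0].
have mSq1 : mfun (fun x => poweR (S x) q1) by exact: measurable_poweR2.
have mSqi : mfun (fun x => poweR (S x) qinf) by exact: measurable_poweR2.
have mkS : mfun (fun x => k%:E * poweR (S x) qinf)%E by exact: emeasurable_funM.
rewrite ge0_integralD//; last 3 first.
- by move=> x _; exact: poweR_ge0.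
- by move=> x _; rewrite adde_ge0 ?decay_ge0// mule_ge0 ?poweR_ge0.
- by apply: emeasurable_funD => //; exact: measurable_decay.
rewrite EFinD; apply: leeD => //.
rewrite ge0_integralD//; last 3 first.
- by move=> x _; rewrite mule_ge0 ?poweR_ge0.
- by move=> x _; exact: decay_ge0.
- exact: measurable_decay.
rewrite EFinD; apply: leeD; last exact: integral_decay.
rewrite ge0_integralZl//; last by move=> x _; exact: poweR_ge0.
by rewrite EFinM; apply: lee_wpmul2l.
Qed.

(** * The part of f with values above 1 *)

Variable C1 : R.
Hypothesis qloc : forall x g, g < 0 -> exists m M, [/\ q0 <= m, m <= M, (M - m) * (- g)%:~R <= C1 &
  {ae mu, forall y, qp_ball x g y -> m <= q y <= M}].

Lemma ae_ballg g (Q : T -> Prop) : (forall x, {ae mu, forall y, qp_ball x g y -> Q y}) ->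
  {ae mu, forall y, Q y}.
Proof.
move=> H; have : {ae mu, forall y, forall h, h = g -> Q y}.
  apply: ae_balls => x h; have [->|hg] := eqVneq h g.
    by apply: filterS (H x) => y Hy xy _; exact: Hy.
  by apply: aeW => y _ e; move: hg; rewrite e eqxx.
by apply: filterS => y; apply.
Qed.

Lemma Ex_ge_ae g (c : R) (phi : T -> R) x : 0 <= c -> mfun phi -> (forall y, 0 <= phi y) ->
  {ae mu, forall y, qp_ball x g y -> c <= phi y} -> (c%:E <= Ex g (EFin \o phi) x)%E.
Proof.
move=> c0 mphi phi0 H; rewrite -[leLHS](Ex_cst g _ x) lee_wpmul2l ?volV_ge0//.
apply: ae_ge0_le_integral => //.
- exact: measurable_qp_ball.
- by move=> y _; rewrite lee_fin.
- by apply: measurable_funTS; exact/measurable_EFinP.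
Qed.

Lemma Ex_le_ae g (phi psi : T -> R) x : mfun phi -> (forall y, 0 <= phi y) ->
  mfun psi -> (forall y, 0 <= psi y) ->
  {ae mu, forall y, qp_ball x g y -> phi y <= psi y} -> (Ex g (EFin \o phi) x <= Ex g (EFin \o psi) x)%E.
Proof.
move=> mphi phi0 mpsi psi0 H; rewrite lee_wpmul2l ?volV_ge0//.
apply: ae_ge0_le_integral => //.
- exact: measurable_qp_ball.
- by move=> y _; rewrite lee_fin.
- by apply: measurable_funTS; exact/measurable_EFinP.
- by move=> y _; rewrite lee_fin.
- by apply: measurable_funTS; exact/measurable_EFinP.
Qed.

(* For [`|f|] with no values in (0, 1], [G > 1] forces [g < 0], and then
   [1 < G <= (vol g)^-1] makes [G ^ q] and [G ^ m] comparable on the ball. *)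
Section BigValues.
Variable f : T -> R.
Hypothesis mf : mfun f.
Hypothesis f1 : forall x, f x = 0 \/ 1 < `|f x|.
Hypothesis Hf : (\int[mu]_x (`|f x| `^ r x)%:E <= 1)%E.
Let G g x := fracavg be s f g x.
Let maf : mfun (fun y => `|f y|). Proof. exact: measurableT_comp. Qed.

Lemma big_pow_le (u : R) : 0 < u -> u <= r0 -> (\int[mu]_x (`|f x| `^ u)%:E <= 1)%E.
Proof.
move=> u0 ur; apply: le_trans Hf; apply: ge0_integral_le => x _; rewrite lee_fin ?powR_ge0//.
have [->|fx1] := f1 x; first by rewrite normr0 powR0 ?powR_ge0// gt_eqF.
apply: ler_powR; first exact: ltW.
by have /andP[h _] := rb x; exact: le_trans h.
Qed.

Lemma big_fin g x : (Ex g (fun y => (`|f y| `^ s)%:E) x)%E \is a fin_num.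
Proof. exact: (Ex_powR_fin s_gt0 (lexx s) mf (big_pow_le s_gt0 (ltW sr0))). Qed.

Lemma big_gmean_le g x : gmean s f g x <= (vol g)^-1.
Proof.
have : (Ex g (fun y => (`|f y| `^ s)%:E) x <= ((vol g)^-1)%:E)%E.
  rewrite -[leRHS]mule1 lee_wpmul2l ?volV_ge0//; apply: le_trans (big_pow_le s_gt0 (ltW sr0)).
  apply: ge0_subset_integral => //; first exact: measurable_qp_ball.
  by apply/measurable_EFinP; exact: measurable_powR2.
by rewrite -{1}(fineK (big_fin g x)) lee_fin.
Qed.

Lemma big_fracavg_pow g x : G g x <= vol g `^ (be - s^-1).
Proof.
rewrite /G /fracavg powRD; last by rewrite vol_neq0 implybT.
apply: ler_wpM2l; first exact: powR_ge0.
have -> : vol g `^ (- s^-1) = (vol g)^-1 `^ s^-1.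
  by rewrite -[(vol g)^-1]powR_inv1 ?(ltW (vol_gt0 _))// -powRrM mulN1r.
apply: ge0_ler_powR; rewrite ?nnegrE ?gmean_ge0 ?invr_ge0 ?(ltW s_gt0) ?(ltW (vol_gt0 _))//.
exact: big_gmean_le.
Qed.

Lemma be_le_sV : be <= s^-1.
Proof.
rewrite -[s^-1]mul1r ler_pdivlMr ?s_gt0// mulrC; apply/ltW; apply: le_lt_trans r0_be.
by rewrite ler_pM2r// ltW.
Qed.

Lemma vol_ge1 g : 0 <= g -> 1 <= vol g.
Proof. by move=> g0; rewrite -vol0; exact: vol_le. Qed.

(** The exponent [be - s^-1] is not positive, as [s * be < r0 * be < 1], and these balls have volume
    at least 1. *)
Lemma big_fracavg_le1 g x : 0 <= g -> G g x <= 1.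
Proof.
move=> g0; apply: le_trans (big_fracavg_pow _ _) _.
rewrite -[leRHS](powRr0 (vol g)); apply: ler_powR; first exact: vol_ge1.
by rewrite subr_le0 be_le_sV.
Qed.

Lemma big_fracavg_vol g x : g <= 0 -> G g x <= (vol g)^-1.
Proof.
move=> g0; apply: le_trans (big_fracavg_pow _ _) _.
rewrite -[(vol g)^-1]powR_inv1 ?(ltW (vol_gt0 _))//; apply: ger_powR.
  by rewrite vol_gt0 -vol0 vol_le.
rewrite lerBrDr; apply: (@le_trans _ _ 0); last exact: ltW.
by rewrite addrC subr_le0 invf_le1 ?s_gt0// ltW.
Qed.

Let k1 := p%:R `^ (n%:R * C1) : R.
Let Gb (i : nat) x := if 1 < G (0 - i%:Z) x then G (0 - i%:Z) x else 0.

Lemma Gb_inv (i : nat) : ball_inv (0 - i%:Z) (Gb i).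
Proof. by move=> x y xy; rewrite /Gb /G (fracavg_inv _ _ _ xy). Qed.

Lemma Gb_ge0 i x : 0 <= Gb i x.
Proof. by rewrite /Gb; case: ifP => // _; exact: fracavg_ge0. Qed.

Lemma Gb_gt0 i x : 0 < Gb i x -> [/\ 0 - i%:Z < 0, 1 < G (0 - i%:Z) x & Gb i x = G (0 - i%:Z) x].
Proof.
rewrite /Gb; case: ifPn => [G1 _|_]; last by rewrite ltxx.
split=> //; rewrite ltNge; apply/negP => /big_fracavg_le1 - /(_ x).
by rewrite leNgt G1.
Qed.

(** A selected level has [1 <= c < G <= (vol g)^-1]. So the local log-Hoelder condition bounds
    [c ^ (M - m)], while [c ^ m] is below the average of [c ^ q]. *)
Lemma big_level (i j : nat) : {ae mu, forall y, 1 * 2 ^+ j < Gb i y ->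
  (((1 * 2 ^+ j) `^ q y)%:E <= k1%:E * Ex (0 - i%:Z) (fun z => ((1 * 2 ^+ j) `^ q z)%:E) y)%E}.
Proof.
set c : R := 1 * 2 ^+ j; have c1 : 1 <= c by rewrite /c mul1r exprn_ege1// ler1n.
have c0 : 0 < c by exact: lt_le_trans c1.
apply: (@ae_ballg (0 - i%:Z)) => x.
have [g0|g0] := ltP (0 - i%:Z) 0; last first.
  apply: aeW => y _ cG; have [] := Gb_gt0 (lt_trans c0 cG).
  by rewrite ltNge g0.
have [m [M [qm mM osc_ Hq]]] := qloc x g0.
apply: filterS (Hq) => y Hy xy cG; have /andP[my yM] := Hy xy.
have [_ G1 GE] := Gb_gt0 (lt_trans c0 cG).
have EG : ((c `^ m)%:E <= Ex (0 - i%:Z) (fun z => (c `^ q z)%:E) y)%E.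
  rewrite -(Ex_inv _ xy); apply: (@Ex_ge_ae _ _ (fun z => c `^ q z)).
  - exact: powR_ge0.
  - by apply: measurable_powR2 => //; exact: measurable_q.
  - by move=> z; exact: powR_ge0.
  - by apply: filterS Hq => z Hz xz; apply: ler_powR => //; have /andP[] := Hz xz.
apply: (@le_trans _ _ (k1%:E * (c `^ m)%:E)%E); last by rewrite lee_wpmul2l// lee_fin powR_ge0.
rewrite -EFinM lee_fin; apply: (@le_trans _ _ (c `^ M)); first exact: ler_powR.
have -> : M = (M - m) + m by rewrite subrK.
rewrite powRD; last by rewrite (gt_eqF c0) implybT.
rewrite ler_wpM2r ?powR_ge0//.
apply: le_trans (vol_pow_osc g0 mM osc_).
apply: ge0_ler_powR; rewrite ?nnegrE ?subr_ge0 ?(ltW c0) ?invr_ge0 ?(ltW (vol_gt0 _))//.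
apply: (le_trans (ltW cG)); rewrite GE; apply: big_fracavg_vol; exact: ltW.
Qed.

Let t := r0 / s.
(** Chosen so that [v ^ t = |f| ^ r]: the modular of [f] becomes a power integral with constant
    exponent, ready for the maximal theorem. *)
Let v y := `|f y| `^ (r y * s / r0).

Lemma t_gt1 : 1 < t. Proof. by rewrite /t ltr_pdivlMr ?s_gt0// mul1r. Qed.

Lemma measurable_v : mfun v.
Proof. by apply: measurable_powR2 => //; apply: measurable_funM => //; exact: measurable_funM. Qed.

Lemma v_ge0 y : 0 <= v y. Proof. exact: powR_ge0. Qed.

Lemma v_pow y : v y `^ t = `|f y| `^ r y.
Proof.
rewrite /v /t -powRrM; congr (_ `^ _); field.
by rewrite !gt_eqF ?s_gt0 ?r0_gt0.
Qed.

Lemma v_int : (\int[mu]_y (v y `^ t)%:E <= 1)%E.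
Proof. by under eq_integral do rewrite v_pow. Qed.

Lemma v_fin g x : Ex g (EFin \o v) x \is a fin_num.
Proof.
have H : (\int[mu]_y (`|v y| `^ t)%:E <= 1%:E)%E.
  by under eq_integral do rewrite (ger0_norm (v_ge0 _)); exact: v_int.
have := @Ex_powR_fin 1 t 1 v ltr01 (ltW t_gt1) measurable_v H g x.
rewrite (@eq_Ex g _ (EFin \o v))// => y _; congr _%:E.
by rewrite powRr1// ger0_norm// v_ge0.
Qed.

(** Freeze [q] at its lower bound [m] on the ball, with [rho <= r] the matching exponent. Since
    [|f|] is 0 or above 1, [|f| ^ s <= v ^ a] for [a = r0 / rho <= 1]. Jensen and [hedberg] then
    give [G ^ m <= F ^ t], and [G ^ (M - m) <= k1] because [G <= (vol g)^-1]. *)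
Lemma big_max : {ae mu, forall x, forall i : nat,
  ((Gb i x `^ q x)%:E <= k1%:E * poweR (maxf (EFin \o v) x) t)%E}.
Proof.
have t0 : 0 < t by exact: lt_trans t_gt1.
apply: ae_forall_count => i; apply: (@ae_ballg (0 - i%:Z)) => x.
have pos y : (0 <= k1%:E * poweR (maxf (EFin \o v) y) t :> \bar R)%E.
  by rewrite mule_ge0 ?poweR_ge0// lee_fin powR_ge0.
have [g0|g0] := ltP (0 - i%:Z) 0; last first.
  apply: aeW => y _; have [G0|] := ltP 0 (Gb i y).
    by have [] := Gb_gt0 G0; rewrite ltNge g0.
  move=> G0; have -> : Gb i y = 0 by apply/eqP; rewrite eq_le G0 Gb_ge0.
  by rewrite powR0 ?gt_eqF ?q_gt0//; exact: pos.
have [m [M [qm mM osc_ Hq]]] := qloc x g0.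
set g := 0 - i%:Z in g0 osc_ Hq *.
have m0 : 0 < m by apply: lt_le_trans qm; exact: q0_gt0.
have [rho_ge rho0 mE] := dual_bounds qm; set rho := (m^-1 + be)^-1 in rho_ge rho0 mE.
pose a := r0 / rho; have a0 : 0 < a by rewrite divr_gt0// r0_gt0.
have a1 : a <= 1 by rewrite ler_pdivrMr// mul1r.
pose F := fine (Ex g (EFin \o v) x).
have F0 : 0 <= F by rewrite fine_ge0// Ex_ge0// => y _; rewrite lee_fin v_ge0.
have E1 : (Ex g (fun y => (`|f y| `^ s)%:E) x <= (F `^ a)%:E)%E.
  apply: (@le_trans _ _ (Ex g (EFin \o (fun y => (v y `^ a)%R)) x)).
    apply: (@Ex_le_ae g (fun y => `|f y| `^ s) (fun y => v y `^ a)).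
    - exact: measurable_powR2.
    - by move=> y; exact: powR_ge0.
    - by apply: measurable_powR2 => //; exact: measurable_v.
    - by move=> y; exact: powR_ge0.
    - apply: filterS Hq => y Hy xy; have /andP[my _] := Hy xy.
      have [->|fy1] := f1 y; first by rewrite normr0 powR0 ?powR_ge0// gt_eqF// s_gt0.
      rewrite /v -powRrM; apply: ler_powR; first exact: ltW.
      have -> : r y * s / r0 * a = s * (r y / rho).
        by rewrite /a; field; rewrite !gt_eqF// r0_gt0.
      rewrite ler_peMr ?(ltW s_gt0)// ler_pdivlMr// mul1r.
      exact: dual_le_r.
  apply: (@Ex_jensen g (fun y => v y `^ a) x a^-1).
  - by apply: measurable_powR2 => //; exact: measurable_v.
  - by move=> y; exact: powR_ge0.
  - by rewrite invf_ge1.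
  - exact: powR_ge0.
  - rewrite -powRrM mulfV ?gt_eqF// powRr1// /F (fineK (v_fin _ _)) le_eqVlt.
    apply/orP; left; apply/eqP; apply: eq_Ex => y _.
    by rewrite -powRrM mulfV ?gt_eqF//= powRr1// v_ge0.
have VF : vol g * F `^ t <= 1.
  apply: Ex_pow_vol => //; [exact: measurable_v|exact: v_ge0|exact/ltW/t_gt1|exact: v_int|exact: v_fin].
have H := @hedberg R m rho be s t (vol g) (gmean s f g x) F 1 m0 rho0 (ltW be0) mE s_gt0 t0
  (vol_gt0 g) (gmean_ge0 _ _ _ _) F0 _ VF ler01.
apply: filterS Hq => y Hy xy; have /andP[my yM] := Hy xy.
have [G0|] := ltP 0 (Gb i y); last first.
  move=> G0; have -> : Gb i y = 0 by apply/eqP; rewrite eq_le G0 Gb_ge0.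
  by rewrite powR0 ?gt_eqF ?q_gt0//; exact: pos.
have [_ G1 GE] := Gb_gt0 G0; rewrite GE -/g in G1 *.
have Gm : G g y `^ m <= F `^ t.
  rewrite /G -(fracavg_inv be s f xy); have := H _; rewrite powR1 mul1r; apply.
  rewrite -lee_fin /gmean (fineK (big_fin g x)); apply: le_trans E1 _.
  by rewrite lee_fin /a (_ : t * s = r0) // /t divfK// gt_eqF// s_gt0.
have G_gt0 : 0 < G g y by exact: lt_trans G1.
apply: (@le_trans _ _ (k1 * F `^ t)%:E).
  rewrite lee_fin; apply: (@le_trans _ _ (G g y `^ M)); first by apply: ler_powR => //; exact: ltW.
  have -> : M = (M - m) + m by rewrite subrK.
  rewrite powRD; last by rewrite (gt_eqF G_gt0) implybT.
  apply: ler_pM => //; rewrite ?powR_ge0//.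
  apply: le_trans (vol_pow_osc g0 mM osc_).
  apply: ge0_ler_powR; rewrite ?nnegrE ?subr_ge0 ?(ltW G_gt0) ?invr_ge0 ?(ltW (vol_gt0 _))//.
  apply: big_fracavg_vol; exact: ltW.
rewrite EFinM lee_wpmul2l ?lee_fin ?powR_ge0// -poweR_EFin /F (fineK (v_fin _ _)).
rewrite (Ex_inv _ xy); apply: poweR_le; [exact: ltW| |exact: Ex_maxf].
by apply: Ex_ge0 => z _; rewrite lee_fin v_ge0.
Qed.

Lemma big_max_int (CM : R) :
  (\int[mu]_x poweR (maxf (EFin \o v) x) t <= CM%:E * \int[mu]_x (v x `^ t)%:E)%E -> 0 <= CM ->
  (\int[mu]_x poweR (ereal_sup (range (fun i => (Gb i x)%:E))) (q x) <= (k1 * CM)%:E)%E.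
Proof.
move=> HCM CM0; have t0 : 0 < t by exact: lt_trans t_gt1.
have k1e : (0 <= k1%:E :> \bar R)%E by rewrite lee_fin powR_ge0.
have sup0 x : (0 <= ereal_sup (range (fun i => (Gb i x)%:E)))%E.
  by apply: le_trans (ereal_sup_ubound _); last (by exists 0%N); rewrite lee_fin Gb_ge0.
have mm : mfun (fun x => poweR (maxf (EFin \o v) x) t).
  by apply: measurable_poweR2 => //; exact: measurable_maxf.
apply: (@le_trans _ _ (\int[mu]_x (k1%:E * poweR (maxf (EFin \o v) x) t))%E).
  apply: ae_ge0_le_integral => //.
  - by move=> x _; exact: poweR_ge0.
  - apply: measurable_poweR2; last exact: measurable_q.
    apply: measurable_ereal_sup => i; apply/measurable_EFinP; exact: ball_inv_measurable (@Gb_inv i).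
  - by move=> x _; rewrite mule_ge0 ?poweR_ge0.
  - exact: emeasurable_funM.
  - apply: filterS big_max => x Hx _; apply: poweR_sup_le => //.
    + exact: q_gt0.
    + by rewrite mule_ge0 ?poweR_ge0.
    + by move=> i; rewrite lee_fin Gb_ge0.
rewrite ge0_integralZl//; last by move=> x _; exact: poweR_ge0.
rewrite EFinM; apply: lee_wpmul2l => //; apply: le_trans HCM _.
rewrite -[leRHS]mule1; apply: lee_wpmul2l; first by rewrite lee_fin.
exact: v_int.
Qed.

(** A ball with [G > 1] has [g <= 0], so it is found counting down from radius 1; any other is
    unchanged by the truncation at 1. *)
Lemma big_split x : (commsup C0 (fracavg be s f) x <=
  commsup C0 (fun g x => Num.min (fracavg be s f g x) 1%R) x +
  ereal_sup (range (fun i : nat => (if (1 < Gb i x)%R then wt C0 (0 - i%:Z)%R x * Gb i x else 0)%:E)))%E.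
Proof.
have A0 : (0 <= commsup C0 (fun g x => Num.min (fracavg be s f g x) 1%R) x)%E.
  by apply: commsup_ge0 => // g y; rewrite le_min fracavg_ge0 ler01.
have B0 : (0 <= ereal_sup (range (fun i : nat => (if (1 < Gb i x)%R then wt C0 (0 - i%:Z)%R x * Gb i x else 0)%:E)))%E.
  apply: le_trans (ereal_sup_ubound _); last (by exists 0%N).
  by rewrite lee_fin; case: ifP => // _; rewrite mulr_ge0 ?Gb_ge0 ?wt_ge0.
apply: ge_ereal_sup => _ [g _ <-]; have [G1|G1] := leP (G g x) 1.
  apply: (@le_trans _ _ (commsup C0 (fun g x => Num.min (fracavg be s f g x) 1%R) x)); last by rewrite leeDl.
  by apply: ereal_sup_ubound; exists g => //; rewrite min_l.
apply: (@le_trans _ _ (ereal_sup (range (fun i : nat => (if (1 < Gb i x)%R then wt C0 (0 - i%:Z)%R x * Gb i x else 0)%:E)))); last by rewrite leeDr.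
have g0 : g <= 0.
  by rewrite leNgt; apply/negP => /ltW /big_fracavg_le1 -/(_ x); rewrite leNgt G1.
have GbE : Gb `|(0 - g)%R|%N x = G g x by rewrite /Gb intdistK// G1.
by apply: ereal_sup_ubound; exists `|(0 - g)%R|%N => //; rewrite GbE G1 intdistK.
Qed.

End BigValues.

(** For averages truncated at 1 the constant exponents [q0] and [q1] suffice, and both reduce to the
    [q0]-integral of [fracmax], since raising the exponent lowers powers of numbers up to 1.
    Averages above 1 go through [commutator_level], with no cap to remove. *)
Lemma big_part : exists M : R, 0 <= M /\ forall f : T -> R, mfun f ->
  (forall x, f x = 0 \/ 1 < `|f x|) -> (\int[mu]_x (`|f x| `^ r x)%:E <= 1)%E ->
  (\int[mu]_x poweR (commsup C0 (fracavg be s f) x) (q x) <= M%:E)%E.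
Proof.
pose k1 : R := p%:R `^ (n%:R * C1); have k10 : 0 <= k1 by exact: powR_ge0.
have [D0 [D00 HD0]] := commutator_const C00 q0_gt0.
have [D1 [D10 HD1]] := commutator_const C00 q1_gt0.
have q0V : q0^-1 = r0^-1 - be by rewrite invrK.
have [F0 [F00 HF0]] := fracmax_const s_gt0 sr0 q0_gt0 (ltW be0) q0V ler01.
have t1 : 1 < r0 / s by rewrite ltr_pdivlMr ?s_gt0// mul1r.
have [CM [CM0 HCM]] := maximal_theorem t1.
have [CL [CL0 HCL]] := commutator_level q1 C00 q0_gt0 k10.
exists (2 `^ q1 * ((D0 * F0 + D1 * F0) + CL * (k1 * CM))); split.
  by rewrite mulr_ge0 ?powR_ge0// !addr_ge0 ?mulr_ge0.
move=> f mf f1 Hf.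
pose Gm g x := Num.min (fracavg be s f g x) 1.
have iGm g : ball_inv g (Gm g) by move=> x y xy; rewrite /Gm (fracavg_inv _ _ _ xy).
have Gm0 g x : 0 <= Gm g x by rewrite le_min fracavg_ge0 ler01.
pose Gb (i : nat) x := if 1 < fracavg be s f (0 - i%:Z) x then fracavg be s f (0 - i%:Z) x else 0.
pose A := commsup C0 Gm.
pose B x : \bar R := ereal_sup (range (fun i : nat => (if 1 < Gb i x then wt C0 (0 - i%:Z) x * Gb i x else 0)%:E)).
have A0 x : (0 <= A x)%E by exact: commsup_ge0.
have Gb0 i x : 0 <= Gb i x by rewrite /Gb; case: ifP => // _; exact: fracavg_ge0.
have iGb i : ball_inv (0 - i%:Z) (Gb i) by move=> x y xy; rewrite /Gb (fracavg_inv _ _ _ xy).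
have mGb i : mfun (Gb i) by exact: ball_inv_measurable (iGb i).
have B0 x : (0 <= B x)%E.
  apply: le_trans (ereal_sup_ubound _); last (by exists 0%N).
  by rewrite lee_fin; case: ifP => // _; rewrite mulr_ge0 ?wt_ge0.
have mA : mfun A by exact: measurable_commsup.
have mB : mfun B.
  apply: measurable_ereal_sup => i; apply/measurable_EFinP; apply: measurable_fun_ifT => //.
    exact: measurable_fun_ltr.
  by apply: measurable_funM => //; exact: measurable_wt.
have mq := measurable_q.
have IB : (\int[mu]_x poweR (B x) (q x) <= (CL * (k1 * CM))%:E)%E.
  apply: le_trans (HCL 0 Gb q 1 ltr01 mq q_bounds iGb Gb0 _) _.
    by move=> i j; exact: big_level.
  rewrite EFinM; apply: lee_wpmul2l; first by rewrite lee_fin.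
  apply: big_max_int => //; apply: HCM => [|y]; [exact: measurable_v|exact: v_ge0].
have supGm1 x : (ereal_sup (range (fun g : int => (Gm g x)%:E)) <= 1)%E.
  by apply: ge_ereal_sup => _ [g _ <-]; rewrite lee_fin ge_min lexx orbT.
have supGm x : (ereal_sup (range (fun g : int => (Gm g x)%:E)) <= fracmax be s f x)%E.
  apply: ge_ereal_sup => _ [g _ <-]; apply: (@le_trans _ _ (fracavg be s f g x)%:E).
    by rewrite lee_fin ge_min lexx.
  by apply: ereal_sup_ubound; exists g.
have supGm0 x : (0 <= ereal_sup (range (fun g : int => (Gm g x)%:E)))%E.
  by apply: le_trans (ereal_sup_ubound _); last (by exists 0); rewrite lee_fin.
have Hf0 : (\int[mu]_x poweR (fracmax be s f x) q0 <= F0%:E)%E.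
  by apply: HF0 => //; apply: (big_pow_le f1 Hf); [exact: r0_gt0|exact: lexx].
have IA0 : (\int[mu]_x poweR (A x) q0 <= (D0 * F0)%:E)%E.
  apply: le_trans (HD0 Gm iGm Gm0) _; rewrite EFinM; apply: lee_wpmul2l; first by rewrite lee_fin.
  apply: le_trans Hf0; apply: ge0_integral_le => x _; first exact: poweR_ge0.
  by apply: poweR_le => //; exact/ltW/q0_gt0.
have IA1 : (\int[mu]_x poweR (A x) q1 <= (D1 * F0)%:E)%E.
  apply: le_trans (HD1 Gm iGm Gm0) _; rewrite EFinM; apply: lee_wpmul2l; first by rewrite lee_fin.
  apply: le_trans Hf0; apply: ge0_integral_le => x _; first exact: poweR_ge0.
  apply: (@le_trans _ _ (poweR (ereal_sup (range (fun g : int => (Gm g x)%:E))) q0)); last first.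
    by apply: poweR_le => //; exact/ltW/q0_gt0.
  by apply: poweR_ge_le1 => //; [exact: q0_gt0|exact: q0_le_q1].
have mAq0 : mfun (fun x => poweR (A x) q0) by exact: measurable_poweR2.
have mAq1 : mfun (fun x => poweR (A x) q1) by exact: measurable_poweR2.
have mBq : mfun (fun x => poweR (B x) (q x)) by exact: measurable_poweR2.
have mAA : mfun (fun x => poweR (A x) q0 + poweR (A x) q1)%E by exact: emeasurable_funD.
have q21 : (0 <= (2 `^ q1)%:E :> \bar R)%E by rewrite lee_fin powR_ge0.
apply: (@le_trans _ _ (\int[mu]_x ((2 `^ q1)%:E * ((poweR (A x) q0 + poweR (A x) q1) + poweR (B x) (q x))))%E).
  apply: ge0_integral_le => x _; first exact: poweR_ge0.
  have /andP[qx0 qx1] := q_bounds x; have qx := q_gt0 x.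
  apply: (@le_trans _ _ (poweR (A x + B x) (q x))).
    apply: poweR_le; [exact: ltW|by apply: commsup_ge0 => // g y; exact: fracavg_ge0|exact: big_split].
  apply: le_trans (poweR_add_le (ltW qx) (A0 x) (B0 x)) _.
  apply: lee_pmul => //.
  - by rewrite adde_ge0 ?poweR_ge0.
  - by rewrite lee_fin; apply: ler_powR => //; rewrite ler1n.
  - apply: leeD => //; have [Ax1|Ax1] := leP (A x) 1%E.
      apply: (@le_trans _ _ (poweR (A x) q0)); last by rewrite leeDl ?poweR_ge0.
      by apply: poweR_ge_le1 => //; exact: q0_gt0.
    apply: (@le_trans _ _ (poweR (A x) q1)); last by rewrite leeDr ?poweR_ge0.
    by apply: poweR_le_ge1 => //; exact: q1_gt0.
rewrite ge0_integralZl//; last 2 first.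
- exact: emeasurable_funD.
- by move=> x _; rewrite !adde_ge0 ?poweR_ge0.
rewrite EFinM; apply: lee_wpmul2l => //.
rewrite ge0_integralD//; last 2 first.
- by move=> x _; rewrite adde_ge0 ?poweR_ge0.
- by move=> x _; exact: poweR_ge0.
rewrite EFinD; apply: leeD => //.
rewrite ge0_integralD//; last 2 first.
- by move=> x _; exact: poweR_ge0.
- by move=> x _; exact: poweR_ge0.
by rewrite EFinD; apply: leeD.
Qed.

(** Split [f] at [|f| = 1]; the commutator is subadditive, and the power [q] of a sum costs
    [2 ^ q1]. *)
Lemma variable_modular (al : R) : (0 < n)%N -> be = al / n%:R ->
  (forall f : T -> R, mfun f ->
    (forall g x, (Ex g (fun y => (`|f y| `^ s)%:E) x)%E \is a fin_num) ->
    forall x, (qp_maxcomm mu al b f x <= commsup C0 (fracavg (al / n%:R) s f) x)%E) ->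
  exists M : R, 0 <= M /\ forall f : T -> R, mfun f ->
  (\int[mu]_x (`|f x| `^ r x)%:E <= 1)%E ->
  (\int[mu]_x poweR (qp_maxcomm mu al b f x) (q x) <= M%:E)%E.
Proof.
move=> n0 beE Hcomm.
have [M1 [M10 H1]] := small_part; have [M2 [M20 H2]] := big_part.
exists (2 `^ q1 * (M1 + M2)); split; first by rewrite mulr_ge0 ?powR_ge0// addr_ge0.
move=> f mf Hf.
pose A := [set x | 1 < `|f x|] : set T.
have maf : mfun (fun y => `|f y|) by exact: measurableT_comp.
have mA : measurable A.
  rewrite -[A]setTI; apply: (measurable_fun_ltr (f := cst 1) (g := fun x => `|f x|)) => //.
pose f2 x := if 1 < `|f x| then f x else 0; pose f1 x := if 1 < `|f x| then 0 else f x.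
have mb : mfun (fun x => 1 < `|f x|) by exact: measurable_fun_ltr.
have mf2 : mfun f2 by exact: measurable_fun_ifT.
have mf1 : mfun f1 by exact: measurable_fun_ifT.
have f1_le x : `|f1 x| <= `|f x| by rewrite /f1; case: ifP; rewrite ?normr0.
have f2_le x : `|f2 x| <= `|f x| by rewrite /f2; case: ifP; rewrite ?normr0.
have f12 x : `|f x| = `|f1 x| + `|f2 x| by rewrite /f1 /f2; case: ifP; rewrite normr0 ?addr0 ?add0r.
have f1_1 x : `|f1 x| <= 1 by rewrite /f1; case: ltP; rewrite ?normr0.
have f2_1 x : f2 x = 0 \/ 1 < `|f2 x| by rewrite /f2; case: ifPn => [h|_]; [right|left].
have mod_le (h : T -> R) : (forall x, `|h x| <= `|f x|) -> (\int[mu]_x (`|h x| `^ r x)%:E <= 1)%E.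
  move=> hf; apply: le_trans Hf; apply: ge0_integral_le => x _; rewrite lee_fin ?powR_ge0//.
  by apply: ge0_ler_powR; rewrite ?nnegrE// ltW// r_gt0.
have Hf1 := mod_le _ f1_le; have Hf2 := mod_le _ f2_le.
have fin2 := big_fin mf2 f2_1 Hf2.
have fin1 g x : (Ex g (fun y => (`|f1 y| `^ s)%:E) x)%E \is a fin_num.
  rewrite ge0_fin_numE; last by apply: Ex_ge0 => y _; rewrite lee_fin powR_ge0.
  apply: (@le_lt_trans _ _ 1%E); last exact: ltry.
  rewrite -[leRHS](Ex_cst g 1 x); apply: Ex_le => y _; rewrite lee_fin ?powR_ge0//.
  apply: (@le_trans _ _ (1 `^ s)); last by rewrite powR1.
  by apply: ge0_ler_powR; rewrite ?nnegrE ?(ltW s_gt0)// ler01.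
have C1f := Hcomm _ mf1 fin1; have C2f := Hcomm _ mf2 fin2.
have G0 (h : T -> R) g x : 0 <= fracavg be s h g x by exact: fracavg_ge0.
have cs0 (h : T -> R) x : (0 <= commsup C0 (fracavg be s h) x)%E by exact: commsup_ge0.
have mcs (h : T -> R) : mfun h -> mfun (commsup C0 (fracavg be s h)).
  by move=> mh; apply: measurable_commsup => // g; exact: fracavg_inv.
have le12 x : (qp_maxcomm mu al b f x <= commsup C0 (fracavg be s f1) x + commsup C0 (fracavg be s f2) x)%E.
  rewrite beE; apply: le_trans (leeD (C1f x) (C2f x)).
  apply: ge_ereal_sup => _ [g _ <-].
  apply: le_trans (leeD (ereal_sup_ubound _) (ereal_sup_ubound _)); last 2 first.
  - by exists g.
  - by exists g.
  rewrite -ge0_muleDr ?integral_ge0//.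
  apply: lee_wpmul2l; first by rewrite lee_fin powR_ge0.
  have mm (h : T -> R) : mfun h ->
    measurable_fun (qp_ball x g : set T) (fun y => (`|b x - b y| * `|h y|)%:E).
    move=> mh; apply: measurable_funTS; apply/measurable_EFinP; apply: measurable_funM.
      by apply: measurableT_comp => //; apply: measurable_funB => //; exact: measurable_loc.
    exact: measurableT_comp.
  rewrite -ge0_integralD//; [|exact: measurable_qp_ball|exact: mm|exact: mm].
  by apply: ge0_integral_le => y _; rewrite -?EFinD lee_fin ?mulr_ge0// f12 mulrDr.
pose S1 x := poweR (commsup C0 (fracavg be s f1) x) (q x).
pose S2 x := poweR (commsup C0 (fracavg be s f2) x) (q x).
have mS1 : mfun S1 by apply: measurable_poweR2; [exact: mcs|exact: measurable_q].
have mS2 : mfun S2 by apply: measurable_poweR2; [exact: mcs|exact: measurable_q].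
have q21 : (0 <= (2 `^ q1)%:E :> \bar R)%E by rewrite lee_fin powR_ge0.
have HS1 : (\int[mu]_x S1 x <= M1%:E)%E by exact: H1.
have HS2 : (\int[mu]_x S2 x <= M2%:E)%E by exact: H2.
have S10 x : (0 <= S1 x)%E by exact: poweR_ge0.
have S20 x : (0 <= S2 x)%E by exact: poweR_ge0.
have leS x : (poweR (qp_maxcomm mu al b f x) (q x) <= (2 `^ q1)%:E * (S1 x + S2 x))%E.
  have /andP[qx0 qx1] := q_bounds x; have qx := q_gt0 x.
  apply: (@le_trans _ _ (poweR (commsup C0 (fracavg be s f1) x + commsup C0 (fracavg be s f2) x) (q x))).
    by apply: poweR_le; [exact: ltW|exact: maxcomm_ge0|exact: le12].
  apply: le_trans (poweR_add_le (ltW qx) (cs0 f1 x) (cs0 f2 x)) _.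
  apply: lee_pmul => //.
  - by rewrite adde_ge0 ?poweR_ge0.
  - by rewrite lee_fin; apply: ler_powR => //; rewrite ler1n.
clearbody S1 S2; have S12 x : (0 <= S1 x + S2 x)%E by rewrite adde_ge0.
have mS12 : mfun (fun x => S1 x + S2 x)%E by exact: (emeasurable_funD mS1 mS2).
apply: (@le_trans _ _ (\int[mu]_x ((2 `^ q1)%:E * (S1 x + S2 x)))%E).
  by apply: ge0_integral_le => x _; [exact: poweR_ge0|exact: leS].
rewrite ge0_integralZl// EFinM; apply: lee_wpmul2l => //.
by rewrite ge0_integralD// EFinD; apply: leeD.
Qed.

End Exponents.

End BMO.

(** * Luxemburg norms *)

Lemma lux_ge0 (q : T -> R) (g : T -> \bar R) : (0 <= qp_lux mu q g)%E.
Proof. by apply: le_ereal_inf_tmp => _ [e [e0 _] <-]; rewrite lee_fin ltW. Qed.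

Lemma lux_le (q : T -> R) (g : T -> \bar R) (e : R) : 0 < e ->
  (\int[mu]_x poweR (`|g x| * (e^-1)%:E) (q x) <= 1)%E -> (qp_lux mu q g <= e%:E)%E.
Proof. by move=> e0 h; apply: ereal_inf_lbound; exists e. Qed.

Lemma lux_lt (q : T -> R) (g : T -> \bar R) (e : R) : (forall x, 0 <= q x) -> mfun q ->
  (qp_lux mu q g < e%:E)%E ->
  (\int[mu]_x poweR (`|g x| * (e^-1)%:E) (q x) <= 1)%E.
Proof.
move=> q0 mq /ereal_inf_lt[_ [d [d0 hd] <-]]; rewrite lte_fin => de.
apply: le_trans hd; apply: ge0_integral_le => x _; first exact: poweR_ge0.
apply: poweR_le => //; first by rewrite mule_ge0// lee_fin invr_ge0 (ltW (lt_trans d0 de)).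
by apply: lee_wpmul2l => //; rewrite lee_fin lef_pV2 ?posrE ?(lt_trans d0 de)// ltW.
Qed.

Lemma lux_mono (q : T -> R) (g h : T -> \bar R) : (forall x, 0 <= q x) ->
  (forall x, (`|g x| <= `|h x|)%E) -> (qp_lux mu q g <= qp_lux mu q h)%E.
Proof.
move=> q0 gh; apply: le_ereal_inf_tmp => _ [e [e0 he] <-]; apply: lux_le => //.
apply: le_trans he; apply: ge0_integral_le => x _; first exact: poweR_ge0.
apply: poweR_le => //; first by rewrite mule_ge0// lee_fin invr_ge0 ltW.
by apply: lee_wpmul2r => //; rewrite lee_fin invr_ge0 ltW.
Qed.

Lemma lux_le_mul (r q : T -> R) (g h : T -> \bar R) (c : R) : 0 < c ->
  (forall e, 0 < e -> (\int[mu]_x poweR (`|h x| * (e^-1)%:E) (r x) <= 1)%E ->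
    (qp_lux mu q g <= (c * e)%:E)%E) ->
  (qp_lux mu q g <= c%:E * qp_lux mu r h)%E.
Proof.
move=> c0 H; rewrite -lee_pdivrMl//; apply: le_ereal_inf_tmp => _ [e [e0 he] <-].
by rewrite lee_pdivrMl// -EFinM; exact: H.
Qed.

Lemma lux_scale (q : T -> R) (g : T -> \bar R) (c : R) : 0 < c ->
  (qp_lux mu q (fun x => c%:E * g x) <= c%:E * qp_lux mu q g)%E.
Proof.
move=> c0; apply: lux_le_mul => // e e0 he; apply: lux_le; first exact: mulr_gt0.
rewrite (_ : (fun x => _) = (fun x => poweR (`|g x| * (e^-1)%:E) (q x)))//.
apply/funext => x; congr poweR; rewrite abseM gee0_abs ?lee_fin ?(ltW c0)// muleC muleA -EFinM.
by rewrite invfM mulrAC mulVf ?gt_eqF// mul1r muleC.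
Qed.

Lemma lux_ae (q q' : T -> R) (g : T -> \bar R) : mfun q -> mfun q' ->
  mfun g -> {ae mu, forall x, q x = q' x} -> qp_lux mu q g = qp_lux mu q' g.
Proof.
move=> mq mq' mg H; congr ereal_inf; apply/seteqP.
have E (e : R) : 0 < e -> (\int[mu]_x poweR (`|g x| * (e^-1)%:E) (q x) = \int[mu]_x poweR (`|g x| * (e^-1)%:E) (q' x))%E.
  move=> e0; have mm : mfun (fun x => `|g x| * (e^-1)%:E)%E.
    by apply: emeasurable_funM => //; exact: measurableT_comp.
  apply: ge0_ae_eq_integral => //.
  - exact: measurable_poweR2.
  - exact: measurable_poweR2.
  - by move=> x _; exact: poweR_ge0.
  - by move=> x _; exact: poweR_ge0.
  - by apply: filterS H => x -> _.
by split=> _ [e [e0 he] <-]; exists e => //; split=> //; rewrite ?E// -E.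
Qed.

(** Since [q >= 1] and [M >= 1], dividing the function by [M] divides its modular by at least
    [M]. *)
Lemma lux_bounded_scale (q : T -> R) (g : T -> \bar R) (M e : R) : (forall x, 1 <= q x) ->
  mfun q -> mfun g -> 0 < e -> 1 <= M ->
  (\int[mu]_x poweR (`|g x| * (e^-1)%:E) (q x) <= M%:E)%E -> (qp_lux mu q g <= (M * e)%:E)%E.
Proof.
move=> q1 mq mg e0 M1 H; have M0 : 0 < M by exact: lt_le_trans M1.
apply: lux_le; first exact: mulr_gt0.
have mm : mfun (fun x => `|g x| * (e^-1)%:E)%E.
  by apply: emeasurable_funM => //; exact: measurableT_comp.
apply: (@le_trans _ _ (\int[mu]_x ((M^-1)%:E * poweR (`|g x| * (e^-1)%:E) (q x)))%E).
  apply: ge0_integral_le => x _; first exact: poweR_ge0.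
  have eV : 0 < e^-1 by rewrite invr_gt0.
  have q0 : 0 < q x by apply: lt_le_trans (q1 x).
  case: (g x) => [a| |] /=.
  - rewrite -!EFinM lee_fin invfM mulrCA powRM ?invr_ge0 ?(ltW M0)//; last by rewrite mulr_ge0// ltW.
    rewrite ler_wpM2r ?powR_ge0// -[leRHS]powRr1 ?invr_ge0 ?(ltW M0)//.
    by apply: ger_powR => //; rewrite invr_gt0 M0 invf_le1.
  - by rewrite !gt0_mulye ?lte_fin ?invr_gt0 ?mulr_gt0// poweRyr ?gt_eqF// gt0_muley ?lte_fin ?invr_gt0.
  - by rewrite !gt0_mulye ?lte_fin ?invr_gt0 ?mulr_gt0// poweRyr ?gt_eqF// gt0_muley ?lte_fin ?invr_gt0.
have MV : (0 <= (M^-1)%:E)%E by rewrite lee_fin invr_ge0 ltW.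
rewrite ge0_integralZl//; [|exact: measurable_poweR2|by move=> x _; exact: poweR_ge0].
apply: (@le_trans _ _ ((M^-1)%:E * M%:E)%E); last by rewrite -EFinM mulVf ?gt_eqF.
exact: lee_wpmul2l.
Qed.

(** * Essential bounds and the log-Hoelder conditions *)

Lemma essinf_ge (A : set T) (q : T -> R) (c : R) : {ae mu, forall x, A x -> c <= q x} ->
  (c%:E <= qp_essinf_on mu A q)%E.
Proof.
by move=> H; apply: ereal_sup_ubound; apply: filterS H => x Hx Ax; rewrite lee_fin Hx.
Qed.

Lemma esssup_le (A : set T) (q : T -> R) (c : R) : {ae mu, forall x, A x -> q x <= c} ->
  (qp_esssup_on mu A q <= c%:E)%E.
Proof.
by move=> H; apply: ereal_inf_lbound; apply: filterS H => x Hx Ax; rewrite lee_fin Hx.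
Qed.

Lemma essinf_le (A : set T) (q : T -> R) (c : R) : ~ mu.-negligible A ->
  {ae mu, forall x, A x -> q x <= c} -> (qp_essinf_on mu A q <= c%:E)%E.
Proof.
move=> nA H; apply: ge_ereal_sup => y Hy; rewrite leNgt; apply/negP => cy; apply: nA.
have : {ae mu, forall x, ~ A x}.
  apply: filterS2 H Hy => x Hx Hy Ax; have := le_trans (Hy Ax) _.
  move=> /(_ c%:E); rewrite lee_fin (Hx Ax) => /(_ isT); by rewrite leNgt cy.
by apply: negligibleS => x Ax; apply.
Qed.

Lemma esssup_ge (A : set T) (q : T -> R) (c : R) : ~ mu.-negligible A ->
  {ae mu, forall x, A x -> c <= q x} -> (c%:E <= qp_esssup_on mu A q)%E.
Proof.
move=> nA H; apply: le_ereal_inf_tmp => y Hy; rewrite leNgt; apply/negP => cy; apply: nA.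
have : {ae mu, forall x, ~ A x}.
  apply: filterS2 H Hy => x Hx Hy Ax.
  have : (c%:E <= y)%E by apply: le_trans (Hy Ax); rewrite lee_fin Hx.
  by rewrite leNgt cy.
by apply: negligibleS => x Ax; apply.
Qed.

Lemma setT_not_null : ~ mu.-negligible (setT : set T).
Proof. by move=> h; apply: (@ball_not_null origin 0); exact: negligibleS h. Qed.

(** Bounds within [1 / (- g)] of the essential infimum and supremum are good enough: multiplied by
    [- g] the two errors cost 2, hence [|C| + 2]. *)
Lemma Clog0_loc (q : T -> R) (q0 q1 : R) : {ae mu, forall x, q0 <= q x <= q1} -> qp_Clog0 mu q ->
  exists C1, 0 <= C1 /\ forall x g, g < 0 -> exists m M, [/\ q0 <= m, m <= M, (M - m) * (- g)%:~R <= C1 &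
    {ae mu, forall y, qp_ball x g y -> m <= q y <= M}].
Proof.
move=> qb [C HC]; exists (`|C| + 2); split; first by rewrite addr_ge0.
move=> x g g0; set B := (qp_ball x g : set T).
have nB : ~ mu.-negligible B by exact: ball_not_null.
have qb0 : {ae mu, forall y, B y -> q0 <= q y} by apply: filterS qb => y /andP[].
have qb1 : {ae mu, forall y, B y -> q y <= q1} by apply: filterS qb => y /andP[].
have fI : qp_essinf_on mu B q \is a fin_num.
  by rewrite fin_real// (lt_le_trans (ltNyr q0) (essinf_ge qb0)) (le_lt_trans (essinf_le nB qb1) (ltry _)).
have fS : qp_esssup_on mu B q \is a fin_num.
  by rewrite fin_real// (lt_le_trans (ltNyr q0) (esssup_ge nB qb0)) (le_lt_trans (esssup_le qb1) (ltry _)).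
have g0' : 0 < (- g)%:~R :> R by rewrite ltr0z oppr_gt0.
have e0 : 0 < ((- g)%:~R)^-1 :> R by rewrite invr_gt0.
have [y Hy Iy] := ub_ereal_sup_adherent e0 fI.
have [z Hz Sz] := lb_ereal_inf_adherent e0 fS.
have yI : (y <= qp_essinf_on mu B q)%E by exact: ereal_sup_ubound.
have zS : (qp_esssup_on mu B q <= z)%E by exact: ereal_inf_lbound.
have H := HC x g; move: fI fS Iy Sz yI zS H; rewrite -/(qp_essinf_on mu B q) -/(qp_esssup_on mu B q) -/B.
case: (qp_essinf_on mu B q) => [I| |]// _; case: (qp_esssup_on mu B q) => [S| |]// _.
case: y Hy => [y| |]// Hy; case: z Hz => [z| |]// Hz.
rewrite -EFinB -EFinD !lte_fin !lee_fin => Iy Sz yI zS H0.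
have H : g%:~R * (I - S) <= C by exact: H0.
exists (Num.max q0 y), (Num.min q1 z).
have HB : {ae mu, forall x, B x -> Num.max q0 y <= q x <= Num.min q1 z}.
  apply: filterS3 qb Hy Hz => w /andP[w0 w1] wy wz Bw.
  by rewrite ge_max le_min w0 w1 -2!lee_fin wy// wz.
split.
- by rewrite le_max lexx.
- by have [w _ /andP[h1 h2]] := ae_ball_ex HB; exact: le_trans h2.
- apply: (@le_trans _ _ ((z - y) * (- g)%:~R)).
    by rewrite ler_wpM2r ?(ltW g0')// lerB ?ge_min ?le_max ?lexx ?orbT.
  apply: (@le_trans _ _ ((S + (- g)%:~R^-1 - (I - (- g)%:~R^-1)) * (- g)%:~R)).
    by rewrite ler_wpM2r ?(ltW g0')// lerB// ltW.
  have -> : (S + (- g)%:~R^-1 - (I - (- g)%:~R^-1)) * (- g)%:~R = g%:~R * (I - S) + 2 :> R.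
    by rewrite intrN; field; rewrite -oppr_eq0 -intrN gt_eqF.
  by rewrite lerD2r (le_trans H)// ler_norm.
- exact: HB.
Qed.

Lemma pnorm_ge (i : nat) y : ~ qp_ball origin i%:Z y -> p%:R ^+ i.+1 <= qp_pnorm R y.
Proof.
move=> iy; apply: lb_le_inf.
  have [k ky] := qp_ball_exit origin y; exists (p%:R ^ k%:Z); exists k%:Z => // j l lk.
  by rewrite -(ky j l lk).
move=> _ [g gy <-]; rewrite exprnP; apply: ler_weXz2l; first exact/ltW/p_gt1R.
rewrite leNgt; apply/negP => gi; apply: iy => j l li.
by rewrite [RHS]gy// (lt_le_trans li)// lerN2; move: gi; clear; lia.
Qed.

(** A ball equal to the whole space would have the same volume as the next ball, which is [p ^ n]
    times larger. *)
Lemma far_point (i : nat) : (0 < n)%N -> exists y, ~ qp_ball origin i%:Z y.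
Proof.
move=> n0; apply/existsNP => H.
have B h : i%:Z <= h -> qp_ball origin h = setT.
  by move=> ih; apply/seteqP; split=> // y _; apply: (qp_ball_le ih); exact: H.
have : mu (qp_ball origin i%:Z) = mu (qp_ball origin (i%:Z + 1)) by rewrite !B// lerDl.
rewrite !mu_ball => -[]; rewrite volS => /esym/eqP.
rewrite -{2}[vol i%:Z]mul1r (inj_eq (mulIf (vol_neq0 _))) gt_eqF//.
by rewrite exprn_egt1 ?p_gt1R// -lt0n.
Qed.

Lemma Clog_inf_far (q : T -> R) (C : R) (k : nat) x y :
  (forall x y : T, `|q x - q y| <= C / (ln (p%:R + Order.min (qp_pnorm R x) (qp_pnorm R y)) / ln p%:R)) ->
  ~ qp_ball origin k%:Z x -> ~ qp_ball origin k%:Z y -> `|q x - q y| * k.+1%:R <= C.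
Proof.
move=> H /pnorm_ge kx /pnorm_ge ky.
have lp : 0 < ln p%:R :> R by rewrite ln_gt0// p_gt1R.
have pk : 0 < p%:R ^+ k.+1 :> R by rewrite exprn_gt0// p_gt0R.
pose L := ln (p%:R + Order.min (qp_pnorm R x) (qp_pnorm R y)) / ln p%:R.
have kL : k.+1%:R <= L.
  rewrite ler_pdivlMr// mulrC mulr_natr -lnXn ?p_gt0R//.
  have pm : p%:R ^+ k.+1 <= p%:R + Order.min (qp_pnorm R x) (qp_pnorm R y).
    by rewrite -[leLHS]add0r lerD// le_min kx.
  by rewrite ler_ln// posrE// (lt_le_trans pk).
have L0 : 0 < L by apply: lt_le_trans kL.
apply: (@le_trans _ _ (`|q x - q y| * L)); first by rewrite ler_wpM2l.
by rewrite -ler_pdivlMr.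
Qed.

(** The intervals [[q x - C / (m + 1), q x + C / (m + 1)]], for [x] outside the ball of radius
    [p ^ m], meet pairwise, so the supremum of their left ends lies in all of them. Clamping it to
    [[q0, q1]] moves it no farther from values of [q] in that range. *)
Lemma Clog_inf_dec (q : T -> R) (q0 q1 : R) : (0 < n)%N -> q0 <= q1 ->
  {ae mu, forall x, q0 <= q x <= q1} -> qp_Clog_inf q ->
  exists qinf C2, [/\ 0 <= C2, q0 <= qinf <= q1 &
    {ae mu, forall y, forall i : nat, ~ qp_ball origin i%:Z y -> `|q y - qinf| * i.+1%:R <= C2}].
Proof.
move=> n0 q01 qb [C HC].
have far := Clog_inf_far HC.
have C0 : 0 <= C.
  have [y0 hy0] := far_point 0 n0.
  by have := far 0%N _ _ hy0 hy0; rewrite subrr normr0 mul0r.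
pose S := [set v | exists (x : T) (m : nat), ~ qp_ball origin m%:Z x /\ v = q x - C / m.+1%:R].
have Sub y k : ~ qp_ball origin k%:Z y -> ubound S (q y + C / k.+1%:R).
  move=> ky _ [x [m [mx ->]]]; rewrite lerBlDr -addrA -lerBlDl.
  have Cm : 0 <= C / m.+1%:R by rewrite divr_ge0.
  have Ck : 0 <= C / k.+1%:R by rewrite divr_ge0.
  apply: le_trans (ler_norm _) _.
  (* Both points lie outside the smaller of the two balls, so [far] applies with the smaller
     index. *)
  have [mk|/ltnW km] := leqP m k.
    apply: (@le_trans _ _ (C / m.+1%:R)); last by rewrite lerDr.
    rewrite ler_pdivlMr//; apply: far => // h; apply: ky; apply: qp_ball_le h.
    by rewrite lez_nat.
  apply: (@le_trans _ _ (C / k.+1%:R)); last by rewrite lerDl.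
  rewrite ler_pdivlMr//; apply: far => // h; apply: mx; apply: qp_ball_le h.
  by rewrite lez_nat.
have [y0 hy0] := far_point 0 n0.
have hS : has_ubound S by exists (q y0 + C / 1); exact: Sub hy0.
have S0 : S !=set0 by exists (q y0 - C / 1); exists y0, 0%N.
pose t := sup S; exists (Num.max q0 (Num.min q1 t)), C; split=> //.
  by rewrite le_max lexx/= ge_max q01 ge_min lexx.
apply: filterS qb => y /andP[y0_ y1_] i iy.
have h1 : q y - C / i.+1%:R <= t by apply: ub_le_sup => //; exists y, i.
have h2 : t <= q y + C / i.+1%:R by apply: ge_sup => //; exact: Sub.
rewrite -ler_pdivlMr//; move: h1 h2; set c := C / _; clear -y0_ y1_ q01 => h1 h2.
by rewrite ler_norml; case: (leP q1 t) => h3; case: (leP q0) => h4; apply/andP; split; lra.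
Qed.

(* The exponent is clamped to [r0, r1] everywhere, changing it only on a null set. *)
Record exponent_data (be : R) (r : T -> R) (r0 r1 s qinf C1 C2 : R) : Prop := ExponentData {
  ed_s : 1 < s;
  ed_sr0 : s < r0;
  ed_r1 : r1 * be < 1;
  ed_rb : forall x, r0 <= r x <= r1;
  ed_mr : mfun r;
  ed_C1 : 0 <= C1;
  ed_C2 : 0 <= C2;
  ed_qinf : (r0^-1 - be)^-1 <= qinf <= (r1^-1 - be)^-1;
  ed_dec : {ae mu, forall y, forall i : nat, ~ qp_ball origin i%:Z y ->
    `|((r y)^-1 - be)^-1 - qinf| * i.+1%:R <= C2};
  ed_loc : forall x g, g < 0 -> exists m M, [/\ (r0^-1 - be)^-1 <= m, m <= M, (M - m) * (- g)%:~R <= C1 &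
    {ae mu, forall y, qp_ball x g y -> m <= ((r y)^-1 - be)^-1 <= M}] }.

Lemma admissible_data (alpha : R) (r q : T -> R) : 0 < alpha < n%:R -> qp_admissible mu alpha r q ->
  exists r' r0 r1 s qinf C1 C2, [/\ exponent_data (alpha / n%:R) r' r0 r1 s qinf C1 C2,
    {ae mu, forall x, r x = r' x}, {ae mu, forall x, q x = ((r' x)^-1 - alpha / n%:R)^-1},
    mfun r & mfun q].
Proof.
move=> /andP[a0 an] [_ [q0_ qi_] [mr [r0_ _]] r1_ qE].
have n0R : 0 < n%:R :> R by exact: lt_trans an.
have n0 : (0 < n)%N by rewrite -(ltr0n R).
set be := alpha / n%:R in qE *; have be0 : 0 < be by rewrite divr_gt0.
have qE' x : q x = ((r x)^-1 - be)^-1 by rewrite -qE invrK.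
have [y yS y1] := ereal_sup_gt r0_.
have [z zS z1] := ereal_inf_lt r1_.
(* If the witness is [+oo], its almost everywhere bound is contradictory and 2 is a mere default;
   likewise 0 for [-oo] below. *)
have [r0 r01 Hr0] : exists2 r0 : R, 1 < r0 & {ae mu, forall x, r0 <= r x}.
  case: y yS y1 => [y| |]// yS y1.
    by exists y; [rewrite -lte_fin|apply: filterS yS => x /(_ I); rewrite lee_fin].
  by exists 2; [rewrite ltr1n|apply: filterS yS => x /(_ I)].
have [r1 r1n Hr1] : exists2 r1 : R, r1 < n%:R / alpha & {ae mu, forall x, r x <= r1}.
  case: z zS z1 => [z| |]// zS z1.
    by exists z; [rewrite -lte_fin|apply: filterS zS => x /(_ I); rewrite lee_fin].
  by exists 0; [rewrite divr_gt0|apply: filterS zS => x /(_ I)].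
have rb : {ae mu, forall x, r0 <= r x <= r1} by apply: filterS2 Hr0 Hr1 => x -> ->.
have r0r1 : r0 <= r1.
  have [x _ /andP[h1 h2]] : exists2 x, qp_ball origin 0 x & r0 <= r x <= r1.
    by apply: ae_ball_ex; apply: filterS rb.
  exact: le_trans h2.
have r1be : r1 * be < 1.
  by rewrite /be mulrA ltr_pdivrMr// mul1r -ltr_pdivlMr.
have r0_gt0 : 0 < r0 by exact: lt_trans r01.
pose r' x := Num.max r0 (Num.min r1 (r x)).
have rr' : {ae mu, forall x, r x = r' x}.
  by apply: filterS rb => x /andP[h1 h2]; rewrite /r' min_r// max_r.
have qq' : {ae mu, forall x, q x = ((r' x)^-1 - be)^-1} by apply: filterS rr' => x <-.
have rb' x : r0 <= r' x <= r1 by rewrite /r' le_max lexx/= ge_max r0r1 ge_min lexx.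
have qb : {ae mu, forall x, (r0^-1 - be)^-1 <= q x <= (r1^-1 - be)^-1}.
  apply: filterS rb => x /andP[h1 h2]; rewrite qE'; apply/andP; split.
    have rxbe : r x * be < 1 by apply: le_lt_trans r1be; rewrite ler_pM2r.
    by have [_ []] := sobolev_le be0 r0_gt0 h1 rxbe.
  by have [_ []] := sobolev_le be0 (lt_le_trans r0_gt0 h1) h2 r1be.
have q01 : (r0^-1 - be)^-1 <= (r1^-1 - be)^-1 by have [_ []] := sobolev_le be0 r0_gt0 r0r1 r1be.
have [qinf [C2 [C20 qinfb dec]]] := Clog_inf_dec n0 q01 qb qi_.
have [C1 [C10 loc]] := Clog0_loc qb q0_.
(* [r] is positive only almost everywhere, so inversion is expressed by [powR] on each sign, with
   [0^-1 = 0]. *)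
have minv (u : T -> R) : mfun u -> mfun (fun x : T => (u x)^-1).
  move=> mu_; rewrite (_ : (fun x => _) = (fun x => if 0 < u x then u x `^ (-1) else - ((- u x) `^ (-1)))).
    apply: measurable_fun_ifT.
    - exact: measurable_fun_ltr.
    - exact: measurable_powR2.
    - apply: measurableT_comp => //; apply: measurable_powR2 => //; exact: measurableT_comp.
  apply/funext => x; case: ltgtP => [u0|u0|<-].
  - by rewrite powR_inv1// ltW.
  - by rewrite powR_inv1 ?oppr_ge0 ?ltW// invrN opprK.
  - by rewrite oppr0 powR0 ?oppr_eq0 ?oner_eq0// invr0 oppr0.
exists r', r0, r1, ((1 + r0) / 2), qinf, C1, C2; split=> //.
- split=> //.
  + by rewrite (midf_lt r01).
  + by rewrite (midf_lt r01).
  + apply: measurable_maxr => //; exact: measurable_minr.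
  + by apply: filterS2 dec qq' => w Hw <-.
  + move=> x g g0; have [m [M [h1 h2 h3 h4]]] := loc x g g0; exists m, M; split=> //.
    by apply: filterS2 h4 qq' => w Hw <-.
- by rewrite (funext qE'); apply: (minv); apply: measurable_funB => //; exact: minv.
Qed.

(** * Measurability and boundedness of the maximal commutator *)

Lemma sigma_finite_mu : sigma_finite setT mu.
Proof.
exists (fun i : nat => qp_ball origin i%:Z); first by rewrite qp_ball_cover.
by move=> i; split; [exact: measurable_qp_ball|rewrite mu_ball ltry].
Qed.

Lemma measurable_section (F : T * T -> \bar R) : mfun F -> (forall z : T * T, (0 <= F z)%E) ->
  mfun (fun x => \int[mu]_y F (x, y))%E.
Proof.
move=> mF F0.
pose H1 := isSFinite.Build _ _ _ (mu : set T -> \bar R) (sfinite_measure_sigma_finite sigma_finite_mu).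
pose H2 := isSigmaFinite.Build _ _ _ (mu : set T -> \bar R) sigma_finite_mu.
pose m : {sigma_finite_measure set T -> \bar R} := HB.pack (Measure.sort mu) H1 H2.
exact: (@measurable_fun_fubini_tonelli_F _ _ T T R m F mF F0).
Qed.

(** The domain of integration moves with [x]. Labels turn [y in qp_ball x g] into [c x = c y], a
    measurable condition on the product, so Tonelli's theorem applies; the supremum over [g] is
    countable. *)
Lemma measurable_maxcomm (al : R) (b f : T -> R) : mfun b -> mfun f ->
  mfun (qp_maxcomm mu al b f).
Proof.
move=> mb mf; apply: measurable_ereal_sup => g; apply: emeasurable_funM => //.
have [cl clP] := qp_ball_class p n g.
pose c x : R := (cl x)%:R.
have mc : mfun c.
  by apply: (@ball_inv_measurable _ _ _ _ g) => x y /clP; rewrite /c => ->.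
pose F (z : T * T) : \bar R := (if c z.1 == c z.2 then `|b z.1 - b z.2| * `|f z.2| else 0)%:E.
have mF : mfun F.
  apply/measurable_EFinP; apply: measurable_fun_ifT => //.
    by apply: measurable_fun_eqr; exact: measurableT_comp.
  apply: measurable_funM; apply: measurableT_comp => //.
    by apply: measurable_funB; exact: measurableT_comp.
  exact: measurableT_comp.
have F0 (z : T * T) : (0 <= F z)%E by rewrite lee_fin; case: ifP => // _; rewrite mulr_ge0.
have -> : (fun x => \int[mu]_(y in qp_ball x g) (`|b x - b y| * `|f y|)%:E)%E = (fun x => \int[mu]_y F (x, y))%E.
  apply/funext => x; rewrite -integral_indic_mul; apply: eq_integral => y _.
  rewrite /F /= indicE /c eqr_nat; case: eqP => [/clP xy|xy].
    by rewrite mem_set// mul1e.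
  by rewrite memNset ?mul0e// => /clP.
exact: measurable_section.
Qed.

Lemma maxcomm_scale (al : R) (b f : T -> R) (e : R) x : 0 < e ->
  mfun b -> mfun f ->
  (qp_maxcomm mu al b f x * (e^-1)%:E <= qp_maxcomm mu al b (fun y => f y * e^-1)%R x)%E.
Proof.
move=> e0 mb mf; rewrite muleC lee_pdivrMl//; apply: ge_ereal_sup => _ [g _ <-].
apply: (@le_trans _ _ (e%:E * ((((p%:R : R) ^ (n%:Z * g)) `^ (al / n%:R - 1))%:E *
  \int[mu]_(y in qp_ball x g) (`|b x - b y| * `|f y * e^-1|)%:E))%E); last first.
  apply: lee_wpmul2l; first by rewrite lee_fin ltW.
  by apply: ereal_sup_ubound; exists g.
rewrite muleCA; apply: lee_wpmul2l; first by rewrite lee_fin powR_ge0.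
have mi : measurable_fun (qp_ball x g : set T) (fun y => (`|b x - b y| * `|f y / e|)%:E).
  apply: measurable_funTS; apply/measurable_EFinP; apply: measurable_funM.
    by apply: measurableT_comp => //; exact: measurable_funB.
  by apply: measurableT_comp => //; exact: measurable_funM.
have ee : (0 <= e%:E)%E by rewrite lee_fin ltW.
rewrite -ge0_integralZl//; last exact: measurable_qp_ball.
apply: ge0_integral_le => y _; first by rewrite lee_fin mulr_ge0.
rewrite -EFinM lee_fin normrM [`|e^-1|]gtr0_norm ?invr_gt0//.
by rewrite [leRHS]mulrC -!mulrA mulVf ?mulr1// gt_eqF.
Qed.

Lemma Clog_bounds (be : R) (r : T -> R) (r0 r1 s qinf C1 C2 : R) : 0 < be ->
  exponent_data be r r0 r1 s qinf C1 C2 -> (forall x, 1 < ((r x)^-1 - be)^-1) /\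
  mfun (fun x => ((r x)^-1 - be)^-1).
Proof.
move=> be0 D; split.
  exact: (q_gt1 be0 (ed_s D) (ed_sr0 D) (ed_r1 D) (ed_rb D) (fun x => erefl)).
exact: (measurable_q be0 (ed_s D) (ed_sr0 D) (ed_r1 D) (ed_rb D) (ed_mr D) (fun x => erefl)).
Qed.

(** Homogeneity reduces to [f] with modular at most 1, and [q >= 1] turns the modular bound [M] into
    the norm bound [Num.max 1 M]. *)
Theorem BMO_bounded (alpha : R) (b r q : T -> R) : 0 < alpha < n%:R -> qp_locally_integrable mu b ->
  qp_BMO mu b -> qp_admissible mu alpha r q -> qp_bounded_op mu r q (qp_maxcomm mu alpha b).
Proof.
move=> an bloc [K HK] adm; have /andP[al0 aln] := an.
have n0R : 0 < n%:R :> R by exact: lt_trans aln.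
have n0 : (0 < n)%N by rewrite -(ltr0n R).
have [r' [r0 [r1 [s [qinf [C1 [C2 [D rr' qq' mr mq]]]]]]]] := admissible_data an adm.
have be0 : 0 < alpha / n%:R by rewrite divr_gt0.
have bmoK : forall x g, (Ex g (dev b (avg b g x)) x <= K%:E)%E by exact: HK.
have [C0 [C00 Hcomm]] := maxcomm_le bloc bmoK alpha (ed_s D) n0.
have [M [M0 HM]] := variable_modular bloc bmoK be0 (ed_s D) (ed_sr0 D) (ed_r1 D) (ed_rb D) (ed_mr D)
  (fun x => erefl) C00 (ed_C2 D) (ed_qinf D) (ed_dec D) (ed_loc D) n0 erefl Hcomm.
have [q1 mq'] := Clog_bounds be0 D.
set q' := fun x => _ in q1 mq'; have mb := measurable_loc bloc.
exists (Num.max 1 M) => f mf _; have mT := measurable_maxcomm alpha mb mf; split=> //.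
rewrite (lux_ae mr (ed_mr D) _ rr'); last exact/measurable_EFinP.
rewrite (lux_ae mq mq' mT qq').
have M1 : 1 <= Num.max 1 M by rewrite le_max lexx.
apply: lux_le_mul => [|e e0 he]; first exact: lt_le_trans M1.
apply: lux_bounded_scale => //; first by move=> x; exact/ltW/q1.
apply: (@le_trans _ _ M%:E); last by rewrite lee_fin le_max lexx orbT.
have mfe : mfun (fun y => f y * e^-1) by exact: measurable_funM.
apply: le_trans (HM _ mfe _); last first.
  apply: le_trans he; apply: ge0_integral_le => x _; first by rewrite lee_fin powR_ge0.
  by rewrite lee_fin normrM [`|e^-1|]gtr0_norm ?invr_gt0.
apply: ge0_integral_le => x _; first exact: poweR_ge0.
have T0 := maxcomm_ge0 alpha b f x.
apply: poweR_le; first exact/ltW/(lt_trans ltr01 (q1 x)).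
  by rewrite mule_ge0// lee_fin invr_ge0 ltW.
by rewrite gee0_abs//; exact: maxcomm_scale.
Qed.

(** * Indicators of balls and the converse implications *)

Section Converse.
Variables (be : R) (r : T -> R) (r0 r1 s qinf C1 C2 : R).
Hypothesis be0 : 0 < be.
Hypothesis D : exponent_data be r r0 r1 s qinf C1 C2.
Let q x := ((r x)^-1 - be)^-1.
Let q1 x : 1 < q x. Proof. exact: (Clog_bounds be0 D).1. Qed.
Let q0 x : 0 < q x. Proof. exact: lt_trans (q1 x). Qed.
Let mq : mfun q. Proof. exact: (Clog_bounds be0 D).2. Qed.
Let rgt0 x : 0 < r x.
Proof. exact: (r_gt0 (ed_s D) (ed_sr0 D) (ed_rb D)). Qed.
Let rge1 x : 1 <= r x.
Proof. exact/ltW/(r_gt1 (ed_s D) (ed_sr0 D) (ed_rb D)). Qed.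
Let chi x g : T -> R := \1_(qp_ball x g : set T).
Let mchi x g : mfun (chi x g).
Proof. by apply: measurable_indic; exact: measurable_qp_ball. Qed.
Let chi0 x g y : 0 <= chi x g y. Proof. by rewrite /chi indicE. Qed.
Let mchiE x g : mfun (fun y => (chi x g y)%:E).
Proof. exact/measurable_EFinP. Qed.
Let chiE0 x g y : setT y -> (0 <= (chi x g y)%:E)%E.
Proof. by rewrite lee_fin. Qed.
Let chiP x g y : chi x g y = 1 /\ qp_ball x g y \/ chi x g y = 0 /\ ~ qp_ball x g y.
Proof.
rewrite /chi indicE; have [xy|xy] := pselect (qp_ball x g y).
  by left; rewrite mem_set.
by right; rewrite memNset.
Qed.
Let int_chi x g : (\int[mu]_y (chi x g y)%:E = (vol g)%:E)%E.
Proof. by rewrite integral_indic ?setIT ?mu_ball//; exact: measurable_qp_ball. Qed.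

(** As [be * r = 1 - r / q], the left side is [(a ^ q) ^ u * (V^-1) ^ (1 - u)] with [u = r / q < 1]:
    Young's inequality for the exponents [u^-1] and [(1 - u)^-1]. *)
Lemma young_chi (a V : R) x : 0 < a -> 0 < V -> (a * V `^ (- be)) `^ r x <= a `^ q x + V^-1.
Proof.
move=> a0 V0; have rx := rgt0 x; have qx := q0 x.
have bee : be * r x = 1 - r x / q x by rewrite /q invrK mulrBr mulfV ?gt_eqF// opprB addrC subrK mulrC.
have r_lt_q : r x < q x.
  have : 0 < 1 - r x / q x by rewrite -bee mulr_gt0.
  by rewrite subr_gt0 ltr_pdivrMr// mul1r.
rewrite powRM ?(ltW a0) ?powR_ge0// -powRrM.
pose u := r x / q x; have u0 : 0 < u by rewrite divr_gt0.
have u1 : u < 1 by rewrite ltr_pdivrMr// mul1r.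
have -> : a `^ r x = (a `^ q x) `^ u by rewrite -powRrM /u mulrCA mulfV ?mulr1// gt_eqF.
have -> : V `^ (- be * r x) = V^-1 `^ (1 - u).
  by rewrite mulNr bee -/u -[V^-1]powR_inv1 ?(ltW V0)// -powRrM mulN1r.
have X0 : 0 <= a `^ q x by exact: powR_ge0.
have Y0 : 0 <= V^-1 by rewrite invr_ge0 ltW.
apply: le_trans (young_le (s := (1 - u)^-1) (s' := u^-1) _ _ _ _) _; rewrite ?powR_ge0//.
- by rewrite invf_gt1 ?subr_gt0// ltrBlDr ltrDl.
- by rewrite !invrK subrK.
- by rewrite -(powRrM (a `^ q x)) -(powRrM V^-1) !mulfV ?gt_eqF ?subr_gt0// !powRr1.
Qed.

Lemma lux_chi_fin (w : T -> R) x g : (forall y, 1 <= w y) ->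
  (qp_lux mu w (EFin \o chi x g) <= (Num.max 1 (vol g))%:E)%E.
Proof.
move=> w1; set e := Num.max 1 (vol g).
have e1 : 1 <= e by rewrite le_max lexx.
have e0 : 0 < e by exact: lt_le_trans e1.
apply: lux_le => //; apply: (@le_trans _ _ (\int[mu]_y ((e^-1)%:E * (chi x g y)%:E))%E).
  apply: ge0_integral_le => y _; first exact: poweR_ge0.
  rewrite /= -!EFinM lee_fin ger0_norm//; have w0 : 0 < w y by exact: lt_le_trans (w1 y).
  have [[-> _]|[-> _]] := chiP x g y; last by rewrite mul0r powR0 ?mulr0// gt_eqF.
  rewrite mul1r mulr1 -[leRHS]powRr1 ?invr_ge0 ?(ltW e0)//.
  by apply: ger_powR => //; rewrite invr_gt0 e0 invf_le1.
have eV : (0 <= (e^-1)%:E)%E by rewrite lee_fin invr_ge0 ltW.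
rewrite ge0_integralZl//; last exact: chiE0.
rewrite int_chi -EFinM lee_fin mulrC ler_pdivrMr// mul1r.
by rewrite le_max lexx orbT.
Qed.

(** By [young_chi] the modular at scale [V ^ be * e] is at most [1 + 1]; since [r >= 1], the factor
    2 halves it. *)
Lemma lux_chi_sobolev x g : (qp_lux mu r (EFin \o chi x g) <=
  (2 * vol g `^ be)%:E * qp_lux mu q (EFin \o chi x g))%E.
Proof.
set V := vol g; have V0 : 0 < V by exact: vol_gt0.
have Vb : 0 < V `^ be by rewrite powR_gt0.
apply: lux_le_mul => [|e e0 he]; first exact: mulr_gt0.
apply: lux_le; first by rewrite !mulr_gt0.
have mX : mfun (fun y => poweR (`|(EFin \o chi x g) y| * (e^-1)%:E) (q y)).
  apply: measurable_poweR2 => //; apply: emeasurable_funM => //; apply: measurableT_comp => //.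
  exact/measurable_EFinP.
have mY : mfun (fun y => (V^-1)%:E * (chi x g y)%:E)%E.
  by apply: emeasurable_funM => //; exact/measurable_EFinP.
have X0 y : (0 <= poweR (`|(EFin \o chi x g) y| * (e^-1)%:E) (q y))%E by exact: poweR_ge0.
have Y0 y : (0 <= (V^-1)%:E * (chi x g y)%:E)%E by rewrite mule_ge0// lee_fin// invr_ge0 (ltW V0).
have VV : (0 <= (V^-1)%:E :> \bar R)%E by rewrite lee_fin invr_ge0 (ltW V0).
have h0 : (0 <= (2^-1)%:E :> \bar R)%E by rewrite lee_fin.
apply: (@le_trans _ _ (\int[mu]_y ((2^-1)%:E * (poweR (`|(EFin \o chi x g) y| * (e^-1)%:E) (q y) +
    (V^-1)%:E * (chi x g y)%:E)))%E).
  apply: ge0_integral_le => y _; first exact: poweR_ge0.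
  rewrite /= -!EFinM lee_fin ger0_norm//.
  have [[-> _]|[-> _]] := chiP x g y; last first.
    by rewrite mul0r powR0 ?gt_eqF// mulr_ge0// addr_ge0 ?powR_ge0// mulr0.
  rewrite !mul1r mulr1 !invfM -powRN -mulrA [X in 2^-1 * X]mulrC.
  have eV : 0 < e^-1 by rewrite invr_gt0.
  have hr : 2^-1 `^ r y <= 2^-1 :> R.
    rewrite -[leRHS]powRr1//; apply: ger_powR; last exact: rge1.
    by rewrite invr_gt0 ltr0n invf_le1 ?ler1n ?ltr0n.
  rewrite powRM//; last by rewrite mulr_ge0 ?powR_ge0 ?(ltW eV).
  by apply: ler_pM; rewrite ?powR_ge0//; exact: young_chi.
have mXY : mfun (fun y => poweR (`|(EFin \o chi x g) y| * (e^-1)%:E) (q y) + (V^-1)%:E * (chi x g y)%:E)%E.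
  exact: emeasurable_funD.
have mc := mchiE x g.
have c0 := chiE0 x g.
rewrite ge0_integralZl//; last by move=> y _; rewrite adde_ge0.
rewrite ge0_integralD// ge0_integralZl//.
rewrite int_chi -EFinM mulVf ?gt_eqF//.
apply: (@le_trans _ _ ((2^-1)%:E * (1 + 1))%E); first by apply: lee_wpmul2l => //; exact: leeD2r.
by rewrite -EFinD -EFinM lee_fin; lra.
Qed.

(** The ball itself occurs in the supremum, and for [y] in it [|b y - b_B|] is at most the average
    of [|b y - b z|] over [z] in the ball. *)
Lemma dev_le_maxcomm (al : R) (b : T -> R) x g y : qp_locally_integrable mu b -> be = al / n%:R ->
  (`|((b y - avg b g x) * chi x g y)%:E| <=
   (vol g `^ (- be))%:E * qp_maxcomm mu al b (chi x g) y)%E.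
Proof.
move=> bloc beE; have T0 := maxcomm_ge0 al b (chi x g) y.
have [[-> xy]|[-> _]] := chiP x g y; last first.
  by rewrite mulr0 abse0 mule_ge0// lee_fin powR_ge0.
rewrite mulr1 /= (avg_inv b xy) distrC; apply: le_trans (avg_dist bloc _ _ _) _.
have Vb : 0 < vol g `^ be by rewrite powR_gt0// vol_gt0.
rewrite powRN lee_pdivlMl//; apply: ereal_sup_ubound; exists g => //.
rewrite -beE -/(vol g) powRD ?vol_neq0 ?implybT// powRN powRr1 ?(ltW (vol_gt0 _))// EFinM -muleA.
congr (_ * _)%E; rewrite /Ex; congr (_ * _)%E; apply: eq_integral => z.
rewrite inE => yz; rewrite /dev distrC; have [[-> _]|[_ nz]] := chiP x g z; first by rewrite normr1 mulr1.
by exfalso; apply: nz; exact: qp_ball_trans yz.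
Qed.

(** The factor [vol g ^ (- be)] from testing on the indicator cancels the [vol g ^ be] of
    [lux_chi_sobolev]. *)
Lemma bounded_ddagger_aux (al : R) (b : T -> R) (C : R) : qp_locally_integrable mu b -> be = al / n%:R ->
  (forall x g, (qp_lux mu q (qp_maxcomm mu al b (chi x g)) <= C%:E * qp_lux mu r (EFin \o chi x g))%E) ->
  qp_ddagger mu q b.
Proof.
move=> bloc beE H; exists (2 * `|C|) => x g.
have Vb : 0 < vol g `^ be by rewrite powR_gt0// vol_gt0.
have Vn : 0 < vol g `^ (- be) by rewrite powR_gt0// vol_gt0.
have q0' y : 0 <= q y by exact: ltW.
apply: (@le_trans _ _ (qp_lux mu q (fun y => (vol g `^ (- be))%:E * qp_maxcomm mu al b (chi x g) y)%E)).
  apply: lux_mono => // y; apply: le_trans (dev_le_maxcomm x g y bloc beE) _.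
  exact: lee_abs.
apply: le_trans (lux_scale _ _ Vn) _.
have h1 : ((2 * `|C|)%:E = (vol g `^ (- be))%:E * (`|C|%:E * (2 * vol g `^ be)%:E))%E.
  rewrite -!EFinM powRN; congr EFin; field; by rewrite gt_eqF.
rewrite h1 -muleA; apply: lee_wpmul2l; first by rewrite lee_fin ltW.
apply: le_trans (H x g) _; apply: (@le_trans _ _ (`|C|%:E * qp_lux mu r (EFin \o chi x g))%E).
  by apply: lee_wpmul2r; [exact: lux_ge0|rewrite lee_fin ler_norm].
rewrite -muleA; apply: lee_wpmul2l; first by rewrite lee_fin.
exact: lux_chi_sobolev.
Qed.

Lemma qinf_ge1 : 1 <= qinf.
Proof.
have /andP[h _] := ed_qinf D; apply: le_trans h.
exact/ltW/(q0_gt1 be0 (ed_s D) (ed_sr0 D) (ed_r1 D) (ed_rb D)).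
Qed.

(** At scale [V ^ (1 / qinf)], which is at least 1, [pow_decay] replaces [q] by [qinf]; the
    integrand is at most [k0 / V + decay] on the ball, so the modular is at most [k0 + 2]. *)
Lemma lux_chi_large : exists2 k : R, 1 <= k & forall x g, 0 <= g ->
  (qp_lux mu q (EFin \o chi x g) <= (k * vol g `^ qinf^-1)%:E)%E.
Proof.
pose k0 : R := p%:R `^ (n.+1%:R * C2); have k00 : 0 <= k0 by exact: powR_ge0.
have k01 : 1 <= k0 + 2 by rewrite -[leLHS]add0r lerD// ler1n.
exists (k0 + 2) => // x g g0; set V := vol g; have V0 : 0 < V by exact: vol_gt0.
have V1 : 1 <= V by rewrite -vol0; exact: vol_le.
have qi1 : 1 <= qinf by exact: qinf_ge1.
have qi0 : 0 < qinf by exact: lt_le_trans qi1.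
have W0 : 0 < V `^ qinf^-1 by rewrite powR_gt0.
have W1 : 1 <= V `^ qinf^-1.
  by rewrite -[leLHS](powRr0 V); apply: ler_powR => //; rewrite invr_ge0 ltW.
have mc := mchiE x g.
have cc0 := chiE0 x g.
have kV : (0 <= (k0 / V)%:E :> \bar R)%E by rewrite lee_fin divr_ge0// ltW.
apply: lux_bounded_scale => //; [by move=> y; exact/ltW|].
apply: (@le_trans _ _ (\int[mu]_y ((k0 / V)%:E * (chi x g y)%:E + decay y))%E).
  apply: ae_ge0_le_integral => //.
  - by move=> y _; exact: poweR_ge0.
  - apply: measurable_poweR2 => //; apply: emeasurable_funM => //; exact: measurableT_comp.
  - by move=> y _; rewrite adde_ge0 ?decay_ge0// mule_ge0// cc0.
  - apply: emeasurable_funD; [exact: emeasurable_funM|exact: measurable_decay].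
  - apply: filterS (ed_dec D) => y Hy _; rewrite /= -!EFinM ger0_norm//.
    have [[-> _]|[-> _]] := chiP x g y; last first.
      by rewrite mul0r powR0 ?gt_eqF// mulr0 add0e decay_ge0.
    rewrite mul1r mulr1; have -> : k0 / V = k0 * (V `^ qinf^-1)^-1 `^ qinf.
      by rewrite -powRN -powRrM mulNr mulVf ?gt_eqF// powR_inv1// ltW.
    apply: pow_decay => //; [exact/ltW|exact: ed_C2 D|].
    by rewrite invr_ge0 (ltW W0) invf_le1.
rewrite ge0_integralD//; last 4 first.
- by move=> y _; rewrite mule_ge0// cc0.
- exact: emeasurable_funM.
- by move=> y _; exact: decay_ge0.
- exact: measurable_decay.
rewrite ge0_integralZl// int_chi EFinD; apply: leeD; last exact: integral_decay.
by rewrite -EFinM lee_fin divfK// gt_eqF.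
Qed.

(** On the ball [V ^ (- q / m) <= V^-1 * V ^ (- (M - m) / m)], and the last factor is bounded by the
    local log-Hoelder condition because [m >= 1]. *)
Lemma lux_chi_small x g m M : 1 <= m -> m <= M -> g < 0 -> (M - m) * (- g)%:~R <= C1 ->
  {ae mu, forall y, qp_ball x g y -> m <= q y <= M} ->
  (qp_lux mu q (EFin \o chi x g) <= (p%:R `^ (n%:R * C1) * vol g `^ m^-1)%:E)%E.
Proof.
move=> m1 mM g0 osc_ Hq; set V := vol g; have V0 : 0 < V by exact: vol_gt0.
have V1 : V <= 1 by rewrite -vol0; exact/vol_le/ltW.
have m0 : 0 < m by exact: lt_le_trans m1.
have W0 : 0 < V `^ m^-1 by rewrite powR_gt0.
have W1 : 1 <= (V `^ m^-1)^-1.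
  rewrite invf_ge1//; apply: (@le_trans _ _ (1 `^ m^-1)); last by rewrite powR1.
  by apply: ge0_ler_powR; rewrite ?nnegrE ?invr_ge0 ?(ltW m0) ?(ltW V0).
have WV : (V `^ m^-1)^-1 <= V^-1.
  rewrite lef_pV2// -[leLHS]powRr1 ?(ltW V0)//; apply: ger_powR; first by rewrite V0.
  by rewrite invf_le1.
set k1 : R := p%:R `^ (n%:R * C1).
have k11 : 1 <= k1.
  rewrite -[leLHS](powRr0 p%:R); apply: ler_powR; first exact/ltW/p_gt1R.
  by rewrite mulr_ge0// (ed_C1 D).
have mc := mchiE x g.
have cc0 := chiE0 x g.
have kV : (0 <= (k1 / V)%:E :> \bar R)%E by rewrite lee_fin divr_ge0 ?(ltW V0)// (le_trans ler01).
apply: lux_bounded_scale => //; [by move=> y; exact/ltW|].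
apply: (@le_trans _ _ (\int[mu]_y ((k1 / V)%:E * (chi x g y)%:E))%E); last first.
  by rewrite ge0_integralZl// int_chi -EFinM lee_fin divfK// gt_eqF.
apply: ae_ge0_le_integral => //.
- by move=> y _; exact: poweR_ge0.
- apply: measurable_poweR2 => //; apply: emeasurable_funM => //; exact: measurableT_comp.
- by move=> y _; rewrite mule_ge0// cc0.
- exact: emeasurable_funM.
- apply: filterS Hq => y Hy _; rewrite /= -!EFinM lee_fin ger0_norm//.
  have [[-> xy]|[-> _]] := chiP x g y; last first.
    by rewrite mul0r powR0 ?gt_eqF// mulr0.
  have /andP[my yM] := Hy xy.
  rewrite mul1r mulr1; apply: (@le_trans _ _ ((V `^ m^-1)^-1 `^ M)); first exact: ler_powR.
  have -> : M = (M - m) + m by rewrite subrK.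
  rewrite powRD; last by rewrite invr_eq0 (gt_eqF W0) implybT.
  have -> : (V `^ m^-1)^-1 `^ m = V^-1.
    by rewrite -powRN -powRrM mulNr mulVf ?gt_eqF// powR_inv1// ltW.
  rewrite ler_pM2r ?invr_gt0//; apply: le_trans (vol_pow_osc g0 mM osc_).
  by apply: ge0_ler_powR; rewrite ?nnegrE ?subr_ge0 ?invr_ge0 ?(ltW V0) ?(ltW W0).
Qed.

(** On the ball [G <= 1 + V * (1 + k0) * (c * G) ^ q + V * decay], and the three terms give the
    constant. If [c * G >= 1], then [G <= V * (c * G) ^ q] since [c^-1 <= V]; otherwise
    [G <= 1 + V * (c * G) ^ qinf] and [pow_decay] returns to [q]. *)
Lemma int_le_large : exists2 k : R, 0 <= k & forall (G : T -> R) x g, 0 <= g ->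
  mfun G -> (forall y, 0 <= G y) -> (forall y, ~ qp_ball x g y -> G y = 0) ->
  (\int[mu]_y (((vol g `^ qinf^-1)^-1 * G y) `^ q y)%:E <= 1)%E ->
  (\int[mu]_y (G y)%:E <= (k * vol g)%:E)%E.
Proof.
pose k0 : R := p%:R `^ (n.+1%:R * C2); have k00 : 0 <= k0 by exact: powR_ge0.
exists (1 + (1 + k0) + 2); first by rewrite !addr_ge0.
move=> G x g g0 mG G0 Gx; set V := vol g; have V0 : 0 < V by exact: vol_gt0.
have V1 : 1 <= V by rewrite -vol0; exact: vol_le.
have qi1 : 1 <= qinf by exact: qinf_ge1.
have qi0 : 0 < qinf by exact: lt_le_trans qi1.
have W0 : 0 < V `^ qinf^-1 by rewrite powR_gt0.
have WV : V `^ qinf^-1 <= V.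
  by rewrite -[leRHS]powRr1 ?(ltW V0)//; apply: ler_powR => //; rewrite invf_le1.
set c := (V `^ qinf^-1)^-1; have c0 : 0 < c by rewrite invr_gt0.
have cV : c `^ qinf = V^-1 by rewrite /c -powRN -powRrM mulNr mulVf ?gt_eqF// powR_inv1// ltW.
pose H y := ((c * G y) `^ q y)%:E; move=> HG.
have mH : mfun H.
  by apply/measurable_EFinP; apply: measurable_powR2 => //; exact: measurable_funM.
have H0 y : setT y -> (0 <= H y)%E by rewrite lee_fin powR_ge0.
have mc := mchiE x g.
have cc0 := chiE0 x g.
have Ve : (0 <= V%:E)%E by rewrite lee_fin ltW.
have Vk : (0 <= (V * (1 + k0))%:E)%E by rewrite lee_fin mulr_ge0 ?(ltW V0)// addr_ge0.
have d0 y : setT y -> (0 <= decay y)%E by move=> _; exact: decay_ge0.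
have md := measurable_decay.
have mA : mfun (fun y => (chi x g y)%:E + (V * (1 + k0))%:E * H y)%E.
  by apply: emeasurable_funD => //; exact: emeasurable_funM.
have mB : mfun (fun y => V%:E * decay y)%E by exact: emeasurable_funM.
have A0 y : setT y -> (0 <= (chi x g y)%:E + (V * (1 + k0))%:E * H y)%E.
  by move=> h; rewrite adde_ge0 ?cc0// mule_ge0// H0.
have B0 y : setT y -> (0 <= V%:E * decay y)%E by move=> h; rewrite mule_ge0// d0.
apply: (@le_trans _ _ (\int[mu]_y ((chi x g y)%:E + (V * (1 + k0))%:E * H y + V%:E * decay y))%E).
  apply: ae_ge0_le_integral => //.
  - by move=> y _; rewrite lee_fin.
  - exact/measurable_EFinP.
  - by move=> y h; rewrite adde_ge0 ?A0 ?B0.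
  - exact: emeasurable_funD.
  - apply: filterS (ed_dec D) => y Hy _.
    have [xy|xy] := pselect (qp_ball x g y); last first.
      by rewrite Gx//; apply: adde_ge0; [exact: A0|exact: B0].
    have [[-> _]|[_ nxy]] := chiP x g y; last by exfalso; exact: nxy.
    have [cG|cG] := leP 1 (c * G y).
      apply: (@le_trans _ _ (1%:E + (V * (1 + k0))%:E * H y)%E); last by rewrite leeDl// B0.
      rewrite /H -EFinM -EFinD lee_fin.
      have h1 : c * G y <= (c * G y) `^ q y.
        by rewrite -[leLHS]powRr1 ?(le_trans ler01 cG)//; apply: ler_powR => //; exact/ltW.
      have h2 : G y = c^-1 * (c * G y) by rewrite mulKf// gt_eqF.
      have h3 : G y <= V * (c * G y) `^ q y.
        rewrite {1}h2; apply: ler_pM => //; first by rewrite invr_ge0 ltW.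
          exact: le_trans cG.
        by rewrite /c invrK.
      have h4 : 0 <= V * k0 * (c * G y) `^ q y by rewrite !mulr_ge0 ?powR_ge0 ?(ltW V0).
      by rewrite mulrDr mulr1 mulrDl; lra.
    have cG0 : 0 <= c * G y by rewrite mulr_ge0// ltW.
    have cG01 : 0 <= c * G y <= 1 by rewrite cG0 ltW.
    have h1 : (((c * G y) `^ qinf)%:E <= (k0 * (c * G y) `^ q y)%:E + decay y)%E.
      apply: pow_decay => //; [exact: ltW|exact: ed_C2 D|].
      by move=> i /Hy; rewrite distrC.
    have h2 : G y <= 1 + V * (c * G y) `^ qinf.
      rewrite powRM ?(ltW c0)// cV mulVKf ?gt_eqF//; have [G1|G1] := leP (G y) 1.
        by apply: le_trans G1 _; rewrite lerDl powR_ge0.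
      apply: (@le_trans _ _ (G y `^ qinf)); last by rewrite lerDr.
      by rewrite -[leLHS]powRr1//; apply: ler_powR => //; exact: ltW.
    apply: (@le_trans _ _ (1%:E + V%:E * ((k0 * (c * G y) `^ q y)%:E + decay y))%E).
      apply: (@le_trans _ _ (1%:E + V%:E * ((c * G y) `^ qinf)%:E)%E).
        by rewrite -EFinM -EFinD lee_fin.
      by apply: leeD2l; exact: lee_wpmul2l.
    rewrite ge0_muleDr ?d0//; last by rewrite lee_fin mulr_ge0 ?powR_ge0.
    rewrite addeA; apply: leeD2r; apply: leeD2l; rewrite /H -!EFinM lee_fin mulrA.
    by rewrite ler_wpM2r ?powR_ge0// ler_wpM2l ?(ltW V0)// lerDr.
rewrite ge0_integralD// ge0_integralZl//.
rewrite ge0_integralD//; last 2 first.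
- by move=> y h; rewrite mule_ge0 ?H0.
- exact: emeasurable_funM.
rewrite ge0_integralZl// int_chi mulrDl EFinD; apply: leeD.
  rewrite mulrDl mul1r EFinD; apply: leeD2l; rewrite [(1 + k0) * V]mulrC -[leRHS]mule1.
  exact: lee_wpmul2l.
by rewrite mulrC EFinM; apply: lee_wpmul2l => //; exact: integral_decay.
Qed.

(** On the ball [G <= 1 + V * (c * G) ^ m] and [(c * G) ^ m <= 1 + (c * G) ^ q]. As [V <= 1],
    [G <= 2 + V * (c * G) ^ q], whose integral over the ball is at most [3 * V]. *)
Lemma int_le_small (G : T -> R) x g m M : 1 <= m -> m <= M -> g < 0 ->
  {ae mu, forall y, qp_ball x g y -> m <= q y <= M} ->
  mfun G -> (forall y, 0 <= G y) -> (forall y, ~ qp_ball x g y -> G y = 0) ->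
  (\int[mu]_y (((vol g `^ m^-1)^-1 * G y) `^ q y)%:E <= 1)%E ->
  (\int[mu]_y (G y)%:E <= (3 * vol g)%:E)%E.
Proof.
move=> m1 mM g0 Hq mG G0 Gx; set V := vol g; have V0 : 0 < V by exact: vol_gt0.
have V1 : V <= 1 by rewrite -vol0; exact/vol_le/ltW.
have m0 : 0 < m by exact: lt_le_trans m1.
have W0 : 0 < V `^ m^-1 by rewrite powR_gt0.
set c := (V `^ m^-1)^-1; have c0 : 0 < c by rewrite invr_gt0.
have cV : c `^ m = V^-1 by rewrite /c -powRN -powRrM mulNr mulVf ?gt_eqF// powR_inv1// ltW.
pose H y := ((c * G y) `^ q y)%:E; move=> HG.
have mH : mfun H.
  by apply/measurable_EFinP; apply: measurable_powR2 => //; exact: measurable_funM.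
have H0 y : setT y -> (0 <= H y)%E by rewrite lee_fin powR_ge0.
have mc := mchiE x g.
have cc0 := chiE0 x g.
have Ve : (0 <= V%:E)%E by rewrite lee_fin ltW.
have mA : mfun (fun y => 2%:E * (chi x g y)%:E)%E by exact: emeasurable_funM.
have mB : mfun (fun y => V%:E * H y)%E by exact: emeasurable_funM.
have A0 y : setT y -> (0 <= 2%:E * (chi x g y)%:E)%E by move=> h; rewrite mule_ge0 ?cc0.
have B0 y : setT y -> (0 <= V%:E * H y)%E by move=> h; rewrite mule_ge0// H0.
apply: (@le_trans _ _ (\int[mu]_y (2%:E * (chi x g y)%:E + V%:E * H y))%E).
  apply: ae_ge0_le_integral => //.
  - by move=> y _; rewrite lee_fin.
  - exact/measurable_EFinP.
  - by move=> y h; rewrite adde_ge0 ?A0 ?B0.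
  - exact: emeasurable_funD.
  - apply: filterS Hq => y Hy _.
    have [xy|xy] := pselect (qp_ball x g y); last first.
      by rewrite Gx//; apply: adde_ge0; [exact: A0|exact: B0].
    have [[-> _]|[_ nxy]] := chiP x g y; last by exfalso; exact: nxy.
    have /andP[my yM] := Hy xy.
    rewrite /H -!EFinM -EFinD lee_fin mulr1.
    have cG0 : 0 <= c * G y by rewrite mulr_ge0// ltW.
    have h2 : G y <= 1 + V * (c * G y) `^ m.
      rewrite powRM ?(ltW c0)// cV mulVKf ?gt_eqF//; have [G1|G1] := leP (G y) 1.
        by apply: le_trans G1 _; rewrite lerDl powR_ge0.
      apply: (@le_trans _ _ (G y `^ m)); last by rewrite lerDr.
      by rewrite -[leLHS]powRr1//; apply: ler_powR => //; exact: ltW.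
    apply: le_trans h2 _; rewrite (_ : 2 = 1 + 1 :> R)// -addrA lerD2l.
    have h3 : (c * G y) `^ m <= 1 + (c * G y) `^ q y.
      have [G1|G1] := leP (c * G y) 1.
        apply: (@le_trans _ _ 1); last by rewrite lerDl powR_ge0.
        apply: (@le_trans _ _ (1 `^ m)); last by rewrite powR1.
        by apply: ge0_ler_powR => //; [exact: ltW|rewrite nnegrE].
      apply: (@le_trans _ _ ((c * G y) `^ q y)); last by rewrite lerDr.
      by apply: ler_powR => //; exact: ltW.
    apply: (@le_trans _ _ (V * (1 + (c * G y) `^ q y))); first by rewrite ler_pM2l.
    by rewrite mulrDr mulr1 lerD2r.
rewrite ge0_integralD// !ge0_integralZl// int_chi.
have -> : ((3 * V)%:E = (2 * V)%:E + V%:E)%E by rewrite -EFinD; congr EFin; ring.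
apply: leeD; first by rewrite EFinM.
by rewrite -[leRHS]mule1; apply: lee_wpmul2l.
Qed.

(** Shared by large and small balls: [c] is the power of the volume comparable to the norm of the
    indicator, and [Dd] is the constant in passing from modular to integral. *)
Lemma Ex_dev_le (b : T -> R) (C A Dd c : R) x g : qp_locally_integrable mu b -> 0 < c -> 0 <= A -> 0 <= Dd ->
  (qp_lux mu q (fun y => ((b y - qp_avg mu b (qp_ball x g)) * \1_(qp_ball x g) y)%:E) <=
    C%:E * qp_lux mu q (fun y => (\1_(qp_ball x g) y)%:E))%E ->
  (qp_lux mu q (EFin \o chi x g) <= (A * c)%:E)%E ->
  (forall G : T -> R, mfun G -> (forall y, 0 <= G y) ->
    (forall y, ~ qp_ball x g y -> G y = 0) ->
    (\int[mu]_y ((c^-1 * G y) `^ q y)%:E <= 1)%E -> (\int[mu]_y (G y)%:E <= (Dd * vol g)%:E)%E) ->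
  (Ex g (dev b (avg b g x)) x <= ((`|C| * A + 1) * Dd)%:E)%E.
Proof.
move=> bloc c0 A0 D0 H HA HG; have mb := measurable_loc bloc.
(* The summand 1 makes the norm strictly smaller than [K * c], so that [lux_lt] gives a modular at
   most 1. *)
set K := `|C| * A + 1; have K0 : 0 < K by rewrite ltr_wpDl// mulr_ge0.
set F := (fun y => ((b y - avg b g x) * chi x g y)).
have V0 := vol_gt0 g.
have mF : mfun F by apply: measurable_funM => //; exact: measurable_funB.
have h1 : (qp_lux mu q (EFin \o F) < (K * c)%:E)%E.
  apply: (@le_lt_trans _ _ (`|C| * A * c)%:E); last first.
    by rewrite lte_fin ltr_pM2r// ltrDl.
  apply: le_trans H _; apply: (@le_trans _ _ (`|C|%:E * qp_lux mu q (EFin \o chi x g))%E).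
    by apply: lee_wpmul2r; [exact: lux_ge0|rewrite lee_fin ler_norm].
  by rewrite -mulrA EFinM; apply: lee_wpmul2l => //; rewrite lee_fin.
have h2 := lux_lt (fun y => ltW (q0 y)) mq h1.
pose G y := K^-1 * `|F y|.
have mG : mfun G by apply: measurable_funM => //; exact: measurableT_comp.
have G0 y : 0 <= G y by rewrite /G mulr_ge0// invr_ge0 ltW.
have GF : (\int[mu]_y (G y)%:E <= (Dd * vol g)%:E)%E.
  apply: HG => //.
    by move=> y xy; rewrite /G /F; have [[_ ]|[-> _]] := chiP x g y; [|rewrite mulr0 normr0 mulr0].
  apply: le_trans h2; apply: ge0_integral_le => y _; first by rewrite lee_fin powR_ge0.
  by rewrite /G /= lee_fin invfM mulrCA mulrA mulrC.
have -> : Ex g (dev b (avg b g x)) x = (((vol g)^-1)%:E * (K%:E * \int[mu]_y (G y)%:E))%E.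
  rewrite /Ex; congr (_ * _)%E; rewrite -ge0_integralZl//; last 3 first.
  - exact/measurable_EFinP.
  - by move=> y _; rewrite lee_fin.
  - by rewrite lee_fin ltW.
  rewrite -(integral_indic_mul mu (qp_ball x g : set T)); apply: eq_integral => y _.
  have -> : (K%:E * (G y)%:E = (`|F y|)%:E)%E by rewrite -EFinM /G mulVKf ?gt_eqF.
  rewrite /F normrM mulrC [`|chi x g y|]ger0_norm// EFinM.
apply: (@le_trans _ _ (((vol g)^-1)%:E * (K%:E * (Dd * vol g)%:E))%E).
  apply: lee_wpmul2l; first exact: volV_ge0.
  by apply: lee_wpmul2l => //; rewrite lee_fin ltW.
by rewrite -!EFinM lee_fin mulrCA [Dd * _]mulrC mulKf ?gt_eqF.
Qed.

Lemma ddagger_BMO_aux (b : T -> R) : qp_locally_integrable mu b -> qp_ddagger mu q b -> qp_BMO mu b.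
Proof.
move=> bloc [C HC].
have [k k1 Hk] := lux_chi_large; have [l l0 Hl] := int_le_large.
set k2 : R := p%:R `^ (n%:R * C1); have k20 : 0 <= k2 by exact: powR_ge0.
exists ((`|C| * k + 1) * l + (`|C| * k2 + 1) * 3) => x g.
have k0 : 0 <= k by exact: le_trans k1.
have W0 t : 0 < vol g `^ t by rewrite powR_gt0// vol_gt0.
have [g0|g0] := leP 0 g.
  apply: (@le_trans _ _ ((`|C| * k + 1) * l)%:E); last first.
    by rewrite lee_fin lerDl mulr_ge0// addr_ge0// mulr_ge0.
  apply: (@Ex_dev_le b C k l (vol g `^ qinf^-1) x g) => //; first exact: Hk.
  by move=> G mG G0 Gx; exact: (Hl G x g g0 mG G0 Gx).
apply: (@le_trans _ _ ((`|C| * k2 + 1) * 3)%:E); last first.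
  by rewrite lee_fin lerDr mulr_ge0// addr_ge0// mulr_ge0.
have [m [M [qm mM osc_ Hq]]] := ed_loc D x g0.
have m1 : 1 <= m.
  by apply: le_trans qm; exact/ltW/(q0_gt1 be0 (ed_s D) (ed_sr0 D) (ed_r1 D) (ed_rb D)).
apply: (@Ex_dev_le b C k2 3 (vol g `^ m^-1) x g) => //.
  exact: lux_chi_small osc_ Hq.
by move=> G mG G0 Gx; exact: int_le_small Hq mG G0 Gx.
Qed.

End Converse.

Lemma ddagger_ae (q q' : T -> R) (b : T -> R) : qp_locally_integrable mu b ->
  mfun q -> mfun q' -> {ae mu, forall x, q x = q' x} ->
  qp_ddagger mu q b = qp_ddagger mu q' b.
Proof.
move=> bloc mq mq' qq'; have mb := measurable_loc bloc.
have mchi x g : mfun (\1_(qp_ball x g : set T) : T -> R).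
  by apply: measurable_indic; exact: measurable_qp_ball.
have E1 x g : qp_lux mu q (fun y => ((b y - qp_avg mu b (qp_ball x g)) * \1_(qp_ball x g) y)%:E) =
    qp_lux mu q' (fun y => ((b y - qp_avg mu b (qp_ball x g)) * \1_(qp_ball x g) y)%:E).
  apply: lux_ae => //; apply/measurable_EFinP; apply: measurable_funM => //.
  exact: measurable_funB.
have E2 x g : qp_lux mu q (fun y => (\1_(qp_ball x g) y)%:E) = qp_lux mu q' (fun y => (\1_(qp_ball x g) y)%:E).
  by apply: lux_ae => //; exact/measurable_EFinP.
by apply: propext; split=> -[C HC]; exists C => x g; have := HC x g; rewrite E1 E2.
Qed.

Theorem bounded_ddagger (alpha : R) (b r q : T -> R) : 0 < alpha < n%:R -> qp_locally_integrable mu b ->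
  qp_admissible mu alpha r q -> qp_bounded_op mu r q (qp_maxcomm mu alpha b) -> qp_ddagger mu q b.
Proof.
move=> an bloc adm [C HC]; have /andP[al0 aln] := an.
have [r' [r0 [r1 [s [qinf [C1 [C2 [D rr' qq' mr mq]]]]]]]] := admissible_data an adm.
have be0 : 0 < alpha / n%:R by rewrite divr_gt0// (lt_trans al0).
have [_ mq'] := Clog_bounds be0 D; have mr' := ed_mr D; have mb := measurable_loc bloc.
rewrite (ddagger_ae bloc mq mq' qq').
apply: (bounded_ddagger_aux be0 D bloc erefl (C := C)) => x g.
have mchi : mfun (\1_(qp_ball x g : set T) : T -> R).
  by apply: measurable_indic; exact: measurable_qp_ball.
have mE : mfun (EFin \o (\1_(qp_ball x g : set T) : T -> R)) by exact/measurable_EFinP.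
have lr := lux_ae mr mr' mE rr'.
have fin : (qp_lux mu r (EFin \o (\1_(qp_ball x g : set T) : T -> R)) < +oo)%E.
  rewrite lr; apply: (@le_lt_trans _ _ (Num.max 1 (vol g))%:E); last exact: ltry.
  apply: (lux_chi_fin x g) => y.
  exact: (ltW (r_gt1 (ed_s D) (ed_sr0 D) (ed_rb D) y)).
have [mT HT] := HC _ mchi fin.
by rewrite -(lux_ae mq mq' mT qq') -lr.
Qed.

Theorem ddagger_BMO (alpha : R) (b r q : T -> R) : 0 < alpha < n%:R -> qp_locally_integrable mu b ->
  qp_admissible mu alpha r q -> qp_ddagger mu q b -> qp_BMO mu b.
Proof.
move=> an bloc adm H; have /andP[al0 aln] := an.
have [r' [r0 [r1 [s [qinf [C1 [C2 [D rr' qq' mr mq]]]]]]]] := admissible_data an adm.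
have be0 : 0 < alpha / n%:R by rewrite divr_gt0// (lt_trans al0).
have [_ mq'] := Clog_bounds be0 D.
apply: (ddagger_BMO_aux be0 D bloc).
by rewrite -(ddagger_ae bloc mq mq' qq').
Qed.

(** * Constant exponents *)

Lemma essinf_cst (A : set T) (c : R) : ~ mu.-negligible A -> qp_essinf_on mu A (cst c) = c%:E.
Proof.
by move=> nA; apply/eqP; rewrite eq_le essinf_ge ?essinf_le//; apply: aeW => x _.
Qed.

Lemma esssup_cst (A : set T) (c : R) : ~ mu.-negligible A -> qp_esssup_on mu A (cst c) = c%:E.
Proof.
by move=> nA; apply/eqP; rewrite eq_le esssup_ge ?esssup_le//; apply: aeW => x _.
Qed.

Lemma Clog_cst (c : R) : qp_Clog mu (cst c).
Proof.
split; exists 0 => x.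
  move=> g; rewrite essinf_cst ?esssup_cst; [|exact: ball_not_null|exact: ball_not_null].
  by rewrite subee// mule0.
by move=> y; rewrite /cst subrr normr0 mul0r.
Qed.

(** A constant [rho] halfway between 1 and [n / alpha] works. Such a pair is what lets the
    statements about all exponents imply something about one pair, or about [b]. *)
Lemma admissible_exists (alpha : R) : 0 < alpha < n%:R -> exists r q, qp_admissible mu alpha r q.
Proof.
move=> /andP[al0 aln]; have h1 : 1 < n%:R / alpha by rewrite ltr_pdivlMr// mul1r.
pose rho : R := (1 + n%:R / alpha) / 2.
exists (cst rho), (cst (rho^-1 - alpha / n%:R)^-1); split.
- exact: Clog_cst.
- exact: Clog_cst.
- split; first exact: measurable_cst.
  rewrite essinf_cst ?esssup_cst; [|exact: setT_not_null|exact: setT_not_null].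
  by rewrite lte_fin (midf_lt h1) ltry.
- rewrite esssup_cst; last exact: setT_not_null.
  by rewrite lte_fin (midf_lt h1).
- by move=> x; rewrite /cst invrK.
Qed.

End Measure.

Theorem theorem2 (R : realType) (p n : nat)
    (mu : {measure set (QpM p n) -> \bar R}) (alpha : R) (b : QpM p n -> R) :
  prime p -> qp_padic_haar mu -> 0 < alpha < n%:R -> qp_locally_integrable mu b ->
  [<-> qp_BMO mu b;
       forall r q : QpM p n -> R, qp_admissible mu alpha r q ->
         qp_bounded_op mu r q (qp_maxcomm mu alpha b);
       exists r q : QpM p n -> R, qp_admissible mu alpha r q /\
         qp_bounded_op mu r q (qp_maxcomm mu alpha b);
       exists r q : QpM p n -> R, qp_admissible mu alpha r q /\ qp_ddagger mu q b;
       forall r q : QpM p n -> R, qp_admissible mu alpha r q -> qp_ddagger mu q b].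
Proof.
move=> /prime_gt1 p_gt1 haar an bloc; tfae.
- by move=> bmo r q adm; exact: (BMO_bounded p_gt1 haar an bloc bmo adm).
- move=> bnd; have [r [q adm]] := admissible_exists p_gt1 haar an.
  by exists r, q; split=> //; exact: bnd.
- move=> [r [q [adm bnd]]]; exists r, q; split=> //.
  exact: (bounded_ddagger p_gt1 haar an bloc adm bnd).
- move=> [r [q [adm dag]]] r' q' adm'.
  have bmo := ddagger_BMO p_gt1 haar an bloc adm dag.
  exact: (bounded_ddagger p_gt1 haar an bloc adm' (BMO_bounded p_gt1 haar an bloc bmo adm')).
- move=> dag; have [r [q adm]] := admissible_exists p_gt1 haar an.
  exact: (ddagger_BMO p_gt1 haar an bloc adm (dag _ _ adm)).
Qed.
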